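(* Let $X,X_1,X_2,\dots$ be i.i.d. with law $\mathbf P$ on $(S,\mathcal F)$, let $\widehat{\mathbf P}_n$ be the empirical measure of $X_1,\dots,X_n$, and let $k_n$ be positive integers with $k_n\to\infty$ and $k_n/n<c_0<\infty$ for all $n$. Given $X_1,\dots,X_n$, let $X_1^*,\dots,X_{k_n}^*$ be i.i.d. with law $\widehat{\mathbf P}_n$ and let $\mathbf P^*_{k_n}$ be their empirical measure. Let $a_n>0$ be a decreasing sequence with $a_n\to0$, $a_{n+1}/a_n\to1$ and $k_na_n^2\to\infty$ as $n\to\infty$. (1) Let $h:\mathbb R_+\to\mathbb R_+$ be an increasing function such that $\sum_{n=1}^\infty h(ca_n)<\infty$ for all $c>0$, and let $\Omega_0\subset\Lambda_{0\Theta_{2,h}}$. Then $$\liminf_{n\to\infty}(k_na_n^2)^{-1}\ln(\widehat{\mathbf P}_n)_*\big(\mathbf P^*_{k_n}\in\widehat{\mathbf P}_n+a_n\Omega_0\big)\ge-\rho_0^2(\mathrm{int}(\Omega_0),\mathbf P)\quad a.s._*$$ and $$\limsup_{n\to\infty}(k_na_n^2)^{-1}\ln(\widehat{\mathbf P}_n)^*\big(\mathbf P^*_{k_n}\in\widehat{\mathbf P}_n+a_n\Omega_0\big)\le-\rho_0^2(\mathrm{cl}(\Omega_0),\mathbf P)\quad a.s.^*,$$ where the interior $\mathrm{int}$ and closure $\mathrm{cl}$ are taken in the $\tau_{\Theta_{2,h}}$-topology of $\Lambda_{0\Theta_{2,h}}$, and the outer and inner probabilities $(\widehat{\mathbf P}_n)^*$,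 $(\widehat{\mathbf P}_n)_*$ are taken with respect to the $\sigma$-algebra $\sigma_{\Theta_{2,h}}$. (2) Let $t>2$, let $\Omega_0\subset\Lambda_{0\Theta_t}$, and suppose $a_n=o(n^{-1/t})$. Then the same two relations hold, with $\mathrm{int}$ and $\mathrm{cl}$ taken in the $\tau_{\Theta_t}$-topology of $\Lambda_{0\Theta_t}$ and the outer and inner probabilities taken with respect to $\sigma_{\Theta_t}$.
   Context: $S$ is a Hausdorff topological space with Borel $\sigma$-field $\mathcal F$; $\Lambda$ is the set of probability measures on $(S,\mathcal F)$; $\mathbf P\in\Lambda$. All integrals are over $S$. Function classes. For $t>2$, $\Theta_t$ is the set of measurable $f:S\to\mathbb R$ with $\mathbf E|f(X)|^t<\infty$. For $t\ge2$ and $h:\mathbb R_+\to\mathbb R_+$, $\Theta_{t,h}$ is the set of measurable $f:S\to\mathbb R$ with $\mathbf E|f(X)|^t<\infty$ and $\mathbf P(|f(X)|>s^{-1})<h(s)$ for all $s>0$. For a set $\Sigma$ of measurable functions $f$ with $\mathbf E|f(X)|<\infty$: $\Lambda_\Sigma=\{\mathbf Q\in\Lambda:\int|f|\,d\mathbf Q<\infty\ \forall f\in\Sigma\}$; $\Lambda_{0\Sigma}$ is the set of signed measures $\mathbf G$ of bounded variation on $(S,\mathcal F)$ with $\mathbf G(S)=0$ and $\int|f|\,d|\mathbf G|<\infty$ for all $f\in\Sigma$, where $|\mathbf G|$ is the total variation measure. The $\tau_\Sigma$-topology (on $\Lambda_\Sigma$ or $\Lambda_{0\Sigma}$) is the coarsest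 topology making all maps $\mathbf G\mapsto\int f\,d\mathbf G$, $f\in\Sigma$, continuous; $\sigma_\Sigma$ is the smallest $\sigma$-field making all these maps measurable. Rate function: $\rho_0^2(\mathbf G,\mathbf P)=\frac12\int\left(\frac{d\mathbf G}{d\mathbf P}\right)^2d\mathbf P$ if $\mathbf G\ll\mathbf P$, and $=\infty$ otherwise; for a set $\Omega_0$, $\rho_0^2(\Omega_0,\mathbf P)=\inf\{\rho_0^2(\mathbf G,\mathbf P):\mathbf G\in\Omega_0\}$ (with $\inf\emptyset=\infty$). Outer/inner probability: for a probability space $(\Upsilon,\mathcal A,\mathbf Q)$ and $B\subset\Upsilon$, $(\mathbf Q)^*(B)=\inf\{\mathbf Q(A):B\subseteq A,\ A\in\mathcal A\}$ and $(\mathbf Q)_*(B)=1-(\mathbf Q)^*(\Upsilon\setminus B)$. Here $(\widehat{\mathbf P}_n)^*$ and $(\widehat{\mathbf P}_n)_*$ refer to the conditional law of $\mathbf P^*_{k_n}$ given $X_1,\dots,X_n$ on the stated $\sigma$-algebra; they are functions of $X_1,\dots,X_n$. The event $\mathbf P^*_{k_n}\in\widehat{\mathbf P}_n+a_n\Omega_0$ means $\mathbf P^*_{k_n}-\widehat{\mathbf P}_n\in a_n\Omega_0$. Almost sure relations for not necessarily measurable $Z_n$ defined on the probability space of $X_1,X_2,\dots$: ''$\liminf Z_n\ge c$ a.s.$_*$'' means there are measurable $\Delta_n\le Z_n$ with $\mathbf P(\liminf_n\Delta_n\ge c)=1$; ''$\limsup Z_n\le c$ a.s.$^*$'' means $\liminf(-Z_n)\ge-c$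 a.s.$_*$; ''$\limsup Z_n=-\infty$ a.s.$^*$'' means $\liminf(-Z_n)\ge c$ a.s.$_*$ for all $c>0$. When the right-hand side of the upper bound is $-\infty$, it is understood in this last sense. *)

(* Defs.v *)
From HB Require Import structures.
From mathcomp Require Import all_boot all_order all_algebra.
From mathcomp Require Import all_classical all_reals all_analysis.
From mathcomp Require Import measurable_realfun.

Set Implicit Arguments.
Unset Strict Implicit.
Unset Printing Implicit Defensive.

Import Order.TTheory GRing.Theory Num.Theory.
Import numFieldNormedType.Exports.

Local Open Scope classical_set_scope.
Local Open Scope charge_scope.
Local Open Scope ring_scope.

(* S is pointed because the library's measurable types are: this only rules out
   the empty space, which carries no probability measure. *)
Notation borel S := (g_sigma_algebraType (@open S)).

Section function_classes.
Context d (T : measurableType d) (R : realType) (P : probability T R).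

Definition Theta (t : R) : set (T -> R) :=
  [set f : T -> R | measurable_fun setT f /\
           (\int[P]_x ((`|f x| `^ t)%:E) < +oo)%E].

Definition Theta_h (t : R) (h : R -> R) : set (T -> R) :=
  [set f : T -> R | Theta t f /\
           forall s, 0 < s -> (P [set x | (s^-1 < `|f x|)%R] < (h s)%:E)%E].

End function_classes.

Section signed_measures.
Context d (T : measurableType d) (R : realType).
Implicit Type G : {charge set T -> \bar R}.

Lemma hahn_pair G : exists PN, hahn_decomposition G PN.1 PN.2.
Proof. by have [A [B AB]] := Hahn_decomposition G; exists (A, B). Qed.

Definition hahn G : hahn_decomposition G _ _ := svalP (cid (hahn_pair G)).

(* The Jordan decomposition does not depend, on measurable sets, on the Hahn
   decomposition chosen. *)
Definition total_variation G : {measure set T -> \bar R} :=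
  charge_variation (hahn G).

Definition charge_integral G (f : T -> R) : R :=
  \int[jordan_pos (hahn G)]_x f x - \int[jordan_neg (hahn G)]_x f x.

Definition rho2 (P : probability T R) G : \bar R :=
  if `[< G `<< P >]
  then ((2^-1)%:E * \int[P]_x (('d G '/d P) x ^+ 2))%E
  else +oo%E.

End signed_measures.

Section spaces_of_measures.
Context d (T : measurableType d) (R : realType).
Implicit Type Sigma : set (T -> R).

Definition Lambda Sigma : set {measure set T -> \bar R} :=
  [set Q | Q setT = 1%E /\
           forall f, Sigma f -> (\int[Q]_x (`|f x|%:E) < +oo)%E].

(* A sigma-algebra on the space Lambda Sigma: its members are subsets of it. *)
Definition sigma_Lambda Sigma : set (set {measure set T -> \bar R}) :=
  <<s Lambda Sigma,
    \bigcup_(f in Sigma) preimage_set_system (Lambda Sigma)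
      (fun Q : {measure set T -> \bar R} => \int[Q]_x f x) measurable >>.

(* Charges are finite by definition, hence of bounded variation. *)
Definition Lambda0 Sigma : Type :=
  {G : {charge set T -> \bar R} | G setT = 0%E /\
    forall f, Sigma f -> (\int[total_variation G]_x (`|f x|%:E) < +oo)%E}.

HB.instance Definition _ Sigma := gen_eqMixin (Lambda0 Sigma).
HB.instance Definition _ Sigma := gen_choiceMixin (Lambda0 Sigma).

Definition tau Sigma :=
  sup_topology (fun f : {f | Sigma f} => Topological.class
    (initial_topology (fun G : Lambda0 Sigma =>
                         charge_integral (sval G) (sval f)))).

HB.instance Definition _ Sigma :=
  Topological.copy (Lambda0 Sigma) (tau Sigma).

Definition rho2_inf (P : probability T R) Sigma (A : set (Lambda0 Sigma)) :
    \bar R :=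
  ereal_inf [set rho2 P (sval G) | G in A].

(* {Q in Lambda_Sigma : Q - Phat in a A}.  Measures are compared on measurable
   sets only, as their values elsewhere are meaningless. *)
Definition shifted_event Sigma (Phat : {measure set T -> \bar R}) (a : R)
    (A : set (Lambda0 Sigma)) : set {measure set T -> \bar R} :=
  [set Q | Lambda Sigma Q /\
    exists2 G : Lambda0 Sigma, A G &
      forall B, measurable B -> (Q B - Phat B = a%:E * sval G B)%E].

End spaces_of_measures.

Section outer_inner.
Context (R : realType) (Y : Type).
Variables (D : set Y) (F : set (set Y)) (Q : set Y -> \bar R).

(* For a probability Q on the space D with sigma-algebra F. *)
Definition outer_prob (B : set Y) : \bar R :=
  ereal_inf [set Q A | A in [set A | F A /\ B `<=` A]].

Definition inner_prob (B : set Y) : \bar R :=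
  (1 - outer_prob (D `\` B))%E.

End outer_inner.

Section sampling.
Context d (T : measurableType d) (R : realType).

(* The sample is numbered from 0: the data are x 0, ..., x n.-1. *)
Definition empirical (n : nat) (x : nat -> T) : {measure set T -> \bar R} :=
  mscale (n%:R^-1)%:nng (msum (fun i => \d_(x i)) n).

Definition iid d' (Y : measurableType d') (Q : probability Y R) (I : eqType)
    (X : I -> Y -> T) (mu : set T -> \bar R) : Prop :=
  (forall i A, measurable A -> Q (X i @^-1` A) = mu A) /\
  (forall (s : seq I) (A : I -> set T), uniq s ->
     (forall i, measurable (A i)) ->
     Q (\bigcap_(i in [set` s]) (X i @^-1` A i)) =
     (\prod_(i <- s) Q (X i @^-1` A i))%E).

End sampling.

Section almost_sure_bounds.
Context d (O : measurableType d) (R : realType) (P0 : probability O R).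
Implicit Types (Z : nat -> O -> \bar R) (c : \bar R).
Local Open Scope ereal_scope.

Definition as_liminf_ge Z c : Prop :=
  exists Delta : nat -> O -> \bar R,
    [/\ forall n, measurable_fun setT (Delta n),
        forall n w, Delta n w <= Z n w &
        P0 [set w | c <= limn_einf (Delta ^~ w)] = 1].

(* The case -oo is limsup Z = -oo, with Delta allowed to depend on r. *)
Definition as_limsup_le Z c : Prop :=
  if c == -oo
  then forall r : R, (0 < r)%R -> as_liminf_ge (fun n w => - Z n w) r%:E
  else as_liminf_ge (fun n w => - Z n w) (- c).

End almost_sure_bounds.

Section bootstrap.
Context d (T : measurableType d) (R : realType).
Context d1 (O : measurableType d1) d2 (U : measurableType d2).
Variables (X : nat -> O -> T) (Pstar : nat -> O -> probability U R).
Variables (Xstar : nat -> nat -> U -> T) (k : nat -> nat) (a : nat -> R).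

Definition Phat (n : nat) (w : O) : {measure set T -> \bar R} :=
  empirical R n (X ^~ w).

(* Law of the empirical measure of the n-th resample given the data at w. *)
Definition cond_law (n : nat) (w : O)
    (A : set {measure set T -> \bar R}) : \bar R :=
  Pstar n w [set u | A (empirical R (k n) (fun j => Xstar n j u))].

Variables (Sigma : set (T -> R)) (Omega0 : set (Lambda0 Sigma)).

(* lne 0 = -oo *)
Definition log_inner (n : nat) (w : O) : \bar R :=
  ((((k n)%:R * a n ^+ 2)^-1)%:E *
   lne (inner_prob (Lambda Sigma) (sigma_Lambda Sigma) (cond_law n w)
          (shifted_event (Phat n w) (a n) Omega0)))%E.

Definition log_outer (n : nat) (w : O) : \bar R :=
  ((((k n)%:R * a n ^+ 2)^-1)%:E *
   lne (outer_prob (sigma_Lambda Sigma) (cond_law n w)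
          (shifted_event (Phat n w) (a n) Omega0)))%E.

End bootstrap.

(* Main.v *)
(* For almost every data sequence, two facts control the resampling: the law of
   large numbers, and [a_n max_(i < n) |f (X_i)| -> 0] for every test function f;
   the test functions are square integrable.
   Upper bound.  If [L < rho2_inf (closure Omega)], then Omega is covered by
   finitely many half-spaces [sum_i c_i int f_i dG > sqrt (2 L Var phi) + e] with
   [phi = sum_i c_i f_i].  Otherwise some ultrafilter on Omega avoids them all, and
   the integrals of the test functions converge along it to a linear functional
   bounded by [sqrt (2 L Var)]; by Riesz this functional is integration against a
   measure [g P] with [int g^2 dP <= 2 L], which lies in the closure of Omega and
   has rate at most L.  Each half-space is exponentially unlikely by Chernoff.
   Lower bound.  At an interior point [G = g P], truncate g to a bounded b and
   resample with the weights [(1 + a_n (b (X_i) - avg b)) / n].  By Chebyshev the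
   tilted resample falls in the prescribed neighbourhood with probability at
   least 1/2, and the change of measure costs
   [exp (- k_n a_n^2 (int g^2 dP / 2 + delta))]. *)

From HB Require Import structures.
Require Import Defs.
From mathcomp Require Import all_boot all_order all_algebra.
From mathcomp Require Import all_classical all_reals all_analysis.
From mathcomp Require Import measurable_realfun ring lra zify.

Set Implicit Arguments.
Unset Strict Implicit.
Unset Printing Implicit Defensive.

Import Order.TTheory GRing.Theory Num.Theory.
Import numFieldNormedType.Exports.

Local Open Scope classical_set_scope.
Local Open Scope charge_scope.
Local Open Scope ring_scope.

(** * Preliminaries *)

(** Exceptional null sets depend on the test function, and the class of test functions may be
    uncountable. The argument survives because each bound sees only finitely many of them: a finite
    family of half-spaces above, one basic neighbourhood below. The logarithms of outer and inner
    probabilities need not be measurable in the data. The bounds are therefore proved pointwise on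
    measurable good events that hold eventually almost surely; the minorant is the constant bound
    there and [-oo] elsewhere. Each bound carries a slack, which absorbs the number of half-spaces
    or the factor 1/2 because [k_n a_n^2] diverges; a supremum over countably many slacks then
    removes it. Variances appear rather than second moments because charges of total mass 0 do not
    see constants. The conditional law is turned into a finite sum over index functions; this needs
    measurable singletons, and it is where the Hausdorff property enters. *)

Section level_sets.
Context d (T : measurableType d) (R : realType).
Implicit Types (f : T -> R) (c : R).

Lemma measurable_set_ge f c : measurable_fun setT f -> measurable [set x | c <= f x].
Proof.
move=> mf; rewrite (_ : [set x | _] = setT `&` f @^-1` `[c, +oo[); first exact: mf.
by apply/seteqP; split => x /=; rewrite in_itv/= andbT// => -[].
Qed.

Lemma measurable_set_gt f c : measurable_fun setT f -> measurable [set x | c < f x].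
Proof.
move=> mf; rewrite (_ : [set x | _] = setT `&` f @^-1` `]c, +oo[); first exact: mf.
by apply/seteqP; split => x /=; rewrite in_itv/= andbT// => -[].
Qed.

Lemma measurable_set_le f c : measurable_fun setT f -> measurable [set x | f x <= c].
Proof.
move=> mf; rewrite (_ : [set x | _] = setT `&` f @^-1` `]-oo, c]); first exact: mf.
by apply/seteqP; split => x /=; rewrite in_itv/= // => -[].
Qed.

Lemma measurable_set_lt f c : measurable_fun setT f -> measurable [set x | f x < c].
Proof.
move=> mf; rewrite (_ : [set x | _] = setT `&` f @^-1` `]-oo, c[); first exact: mf.
by apply/seteqP; split => x /=; rewrite in_itv/= // => -[].
Qed.

End level_sets.

Section elementary_inequalities.
Context {R : realType}.
Implicit Types (f g : R -> R) (x y z k : R).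

(** By the mean value theorem: a derivative with the sign of its argument makes 0 a minimum. Only
    points between 0 and [x] are constrained, so that both signs of [x] are treated at once and [f]
    may be undefined elsewhere, as for [ln (1 + z)]. *)
Lemma le_at0_of_derive f g x :
  (forall z, `|z| <= `|x| -> 0 <= z * x -> is_derive z 1 f (g z)) ->
  (forall z, `|z| <= `|x| -> 0 <= z * x -> 0 <= z * g z) ->
  f 0 <= f x.
Proof.
move=> df sg.
have [x0|x0|<-//] := ltgtP 0 x.
- have cf : {within `[0, x], continuous f}.
    apply: derivable_within_continuous => z; rewrite in_itv/= => /andP[z0 zx].
    apply: (@ex_derive _ _ _ _ _ _ (g z)); apply: df; last exact: mulr_ge0 (ltW _).
    by rewrite !ger0_norm// ltW.
  have zP z : z \in `]0, x[ -> `|z| <= `|x| /\ 0 <= z * x.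
    rewrite in_itv/= => /andP[z0 zx]; split; last by rewrite mulr_ge0// ltW.
    by rewrite !gtr0_norm// ltW.
  have [z zx e] := MVT x0 (fun z zx => df z (zP z zx).1 (zP z zx).2) cf.
  rewrite -subr_ge0 e subr0; have [h1 h2] := zP z zx.
  have := sg _ h1 h2; move: zx; rewrite in_itv/= => /andP[z0 _].
  by rewrite pmulr_rge0// => gz; rewrite mulr_ge0// ltW.
- have cf : {within `[x, 0], continuous f}.
    apply: derivable_within_continuous => z; rewrite in_itv/= => /andP[z0 zx].
    apply: (@ex_derive _ _ _ _ _ _ (g z)); apply: df; last by rewrite mulr_le0// ltW.
    by rewrite !ler0_norm ?lerN2 ?(ltW x0).
  have zP z : z \in `]x, 0[ -> `|z| <= `|x| /\ 0 <= z * x.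
    rewrite in_itv/= => /andP[z0 zx]; split; last by rewrite mulr_le0// ltW.
    by rewrite !ltr0_norm// lerN2 ltW.
  have [z zx e] := MVT x0 (fun z zx => df z (zP z zx).1 (zP z zx).2) cf.
  rewrite -subr_le0 e sub0r; have [h1 h2] := zP z zx.
  have := sg _ h1 h2; move: zx; rewrite in_itv/= => /andP[_ z0].
  by rewrite nmulr_rge0// => gz; rewrite mulr_le0_ge0// oppr_ge0 ltW.
Qed.

(** The product of the right-hand side with [expR (- y)] has derivative
    [y (2 k - (1/2 + k) y) expR (- y)]. It has the sign of [y] for [y <= k], because [1/2 + k <= 2].
    The coefficient of the square is as close to 1/2 as desired, which is what yields the sharp
    rate. *)
Lemma expR_le_quadratic k x : 0 <= k -> k <= 1 -> x <= k ->
  expR x <= 1 + x + (2^-1 + k) * x ^+ 2.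
Proof.
move=> k0 k1 xk.
pose f y := (1 + y + (2^-1 + k) * y ^+ 2) * expR (- y).
pose g y := (y * (2 * k - (2^-1 + k) * y)) * expR (- y).
have f0 : f 0 = 1 by rewrite /f oppr0 expR0; lra.
have : f 0 <= f x.
  apply: (@le_at0_of_derive _ g) => [z _ _|z zx zx0].
    rewrite /f; apply: is_derive_eq.
    by rewrite /g /GRing.scale /=; field.
  rewrite /g /= mulrA; apply: mulr_ge0; last exact: expR_ge0.
  rewrite mulrA -expr2; apply: mulr_ge0; first exact: sqr_ge0.
  have : z <= k.
    have [x0|x0] := leP 0 x; first by rewrite (le_trans (ler_norm _))// (le_trans zx)// ger0_norm.
    by apply: le_trans k0; rewrite -(nmulr_lge0 _ x0).
  have [z0|z0] := leP 0 z; nra.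
by rewrite f0 /f expRN ler_pdivlMr ?expR_gt0// mul1r.
Qed.

(** The derivative of the difference of the two sides is [y^3 / (1 + y)], which has the sign of
    [y]. *)
Lemma ln1D_le x : -1 < x -> ln (1 + x) <= x - x ^+ 2 / 2 + x ^+ 3 / 3.
Proof.
move=> x1; rewrite -subr_ge0.
pose f y := y - y ^+ 2 / 2 + y ^+ 3 / 3 - ln (1 + y).
pose g y := 1 - y + y ^+ 2 - (1 + y)^-1.
have f0 : f 0 = 0 by rewrite /f addr0 ln1; lra.
have zP z : `|z| <= `|x| -> 0 <= z * x -> 0 < 1 + z.
  move=> zx zx0; have [x0|x0] := leP x 0.
    by move: zx; rewrite (ler0_norm x0) ler_norml; lra.
  by move: zx0; rewrite pmulr_lge0//; lra.
rewrite -[leLHS]f0; apply: (@le_at0_of_derive f g) => z zx zx0.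
  have := zP z zx zx0 => z1.
  have dl : is_derive (1 + z) 1 (@ln R) (1 + z)^-1 by exact: is_derive1_ln.
  rewrite /f; apply: is_derive_eq.
  by rewrite /g /GRing.scale /=; field; lra.
have z1 := zP z zx zx0.
suff -> : z * g z = z ^+ 4 / (1 + z).
  by apply: divr_ge0; [by rewrite exprn_even_ge0|exact: ltW].
by rewrite /g; field; lra.
Qed.

End elementary_inequalities.

Lemma norm_ln1D_le {R : realType} (x : R) : `|x| <= 2^-1 -> `|ln (1 + x)| <= 2 * `|x|.
Proof.
move=> x2; have [x0 x1] : - 2^-1 <= x /\ x <= 2^-1 by apply/andP; rewrite -ler_norml.
have p : 0 < 1 + x by lra.
have h1 : ln (1 + x) <= x by apply: le_ln1Dx; lra.
have h2 : - ln (1 + x) <= - x / (1 + x).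
  rewrite -lnV ?posrE//.
  have e : (1 + x)^-1 = 1 + (- x / (1 + x)) by field; lra.
  by rewrite [in leLHS]e; apply: le_ln1Dx; rewrite ltr_pdivlMr//; lra.
rewrite ler_norml; apply/andP; split; last first.
  by have := ler_norm x; have := normr_ge0 x; lra.
suff : - x / (1 + x) <= 2 * `|x| by lra.
by rewrite ler_pdivrMr//; have := ler_norm (- x); rewrite normrN; have := normr_ge0 x; nra.
Qed.

(** * Deviations of resampled sums *)

Definition avg {R : realType} (n : nat) (u : 'I_n -> R) : R := n%:R^-1 * \sum_(i < n) u i.

Section average.
Context {R : realType} {n : nat}.
Implicit Types (u v : 'I_n -> R).

Lemma avgD u v : avg (fun i => u i + v i) = avg u + avg v.
Proof. by rewrite /avg big_split mulrDr. Qed.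

Lemma avgZ c u : avg (fun i => c * u i) = c * avg u.
Proof. by rewrite /avg -mulr_sumr mulrCA. Qed.

Lemma avg_cst (c : R) : (0 < n)%N -> avg (fun _ : 'I_n => c) = c.
Proof.
by move=> n0; rewrite /avg sumr_const card_ord -[c *+ n]mulr_natl mulrA mulVf ?mul1r// pnatr_eq0 -lt0n.
Qed.

Lemma eq_avg u v : u =1 v -> avg u = avg v.
Proof. by move=> uv; rewrite /avg; under eq_bigr do rewrite uv. Qed.

Lemma le_avg u v : (forall i, u i <= v i) -> avg u <= avg v.
Proof. by move=> uv; rewrite /avg ler_wpM2l ?invr_ge0// ler_sum. Qed.

Lemma avg_ge0 u : (forall i, 0 <= u i) -> 0 <= avg u.
Proof. by move=> u0; rewrite /avg mulr_ge0 ?invr_ge0// sumr_ge0. Qed.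

Lemma avg_norm_le u c : (0 < n)%N -> (forall i, `|u i| <= c) -> `|avg u| <= c.
Proof.
move=> n0 uc; rewrite ler_norml; apply/andP; split.
  by rewrite -[leLHS](avg_cst _ n0); apply: le_avg => i; have := uc i; rewrite ler_norml => /andP[].
by rewrite -[leRHS](avg_cst _ n0); apply: le_avg => i; have := uc i; rewrite ler_norml => /andP[].
Qed.

End average.

Section weighted_resampling.
Context {R : realType} (k n : nat).
Implicit Types (q u v : 'I_n -> R) (A B : pred {ffun 'I_k -> 'I_n}).

(* A resample is encoded by the function s giving the index of each draw; wprob q
   is the law of s when the draws are independent with weights q. *)
Definition wprob q A : R := \sum_(s | A s) \prod_(j < k) q (s j).

Lemma prod_weight_ge0 q (s : {ffun 'I_k -> 'I_n}) : (forall i, 0 <= q i) ->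
  0 <= \prod_(j < k) q (s j).
Proof. by move=> q0; apply: prodr_ge0. Qed.

Lemma wprobT q : \sum_i q i = 1 -> wprob q xpredT = 1.
Proof.
move=> q1; rewrite /wprob -(bigA_distr_bigA (fun=> q)).
by rewrite big1// => j _.
Qed.

Lemma wprob_le q A B : (forall i, 0 <= q i) -> (forall s, A s -> B s) ->
  wprob q A <= wprob q B.
Proof.
move=> q0 AB; rewrite /wprob [leRHS](bigID A)/=.
rewrite [X in _ <= X + _](eq_bigl A)/=; last first.
  by move=> s; have [As|//] := boolP (A s); [rewrite AB|rewrite andbF].
by rewrite lerDl sumr_ge0// => s _; exact: prod_weight_ge0.
Qed.

Lemma wprobC q A : \sum_i q i = 1 -> wprob q (predC A) = 1 - wprob q A.
Proof. by move=> q1; apply/eqP; rewrite eq_sym subr_eq addrC -(wprobT q1) {1}/wprob (bigID A). Qed.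

Lemma wprobU q A B : (forall i, 0 <= q i) ->
  wprob q (fun s => A s || B s) <= wprob q A + wprob q B.
Proof.
move=> q0; rewrite /wprob (bigID A)/= lerD//.
  by rewrite le_eqVlt; apply/orP; left; apply/eqP; apply: eq_bigl => s; case: (A s); rewrite ?andbF.
rewrite [leRHS](bigID A)/= -[leLHS]add0r lerD//.
  by rewrite sumr_ge0// => s _; exact: prod_weight_ge0.
by rewrite le_eqVlt; apply/orP; left; apply/eqP; apply: eq_bigl => s; case: (A s); rewrite ?andbF ?andbT.
Qed.

Lemma wprob_exists q (m : nat) (A : 'I_m -> pred {ffun 'I_k -> 'I_n}) (c : 'I_m -> R) :
  (forall i, 0 <= q i) -> (forall l, wprob q (A l) <= c l) ->
  wprob q (fun s => [exists l, A l s]) <= \sum_l c l.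
Proof.
move=> q0 Ac; apply: (@le_trans _ _ (\sum_l wprob q (A l))); last by apply: ler_sum.
rewrite /wprob; under [leRHS]eq_bigr do rewrite big_mkcond/=.
rewrite exchange_big/= big_mkcond/= ler_sum// => s _.
case: ifPn => [/existsP[l Al]|_]; last first.
  by apply: sumr_ge0 => l _; case: ifP => // _; exact: prod_weight_ge0.
rewrite (bigD1 l)//= Al lerDl sumr_ge0// => i _.
by case: ifP => // _; exact: prod_weight_ge0.
Qed.

(** Independence of the draws is [bigA_distr_bigA]: a power of a sum is a sum over index functions.
    What remains is Markov's inequality, term by term. *)
Lemma wprob_chernoff q u c : (forall i, 0 <= q i) ->
  wprob q (fun s => c <= \sum_j u (s j)) <= (\sum_i q i * expR (u i)) ^+ k * expR (- c).
Proof.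
move=> q0.
have -> : (\sum_i q i * expR (u i)) ^+ k =
    \sum_(s : {ffun 'I_k -> 'I_n}) \prod_j (q (s j) * expR (u (s j))).
  by rewrite -(bigA_distr_bigA (fun=> fun i => q i * expR (u i))) prodr_const card_ord.
rewrite mulr_suml /wprob big_mkcond/=; apply: ler_sum => s _.
rewrite big_split/= -mulrA -expR_sum -expRD; case: ifPn => [h|_].
  rewrite ler_peMr ?prod_weight_ge0// -expR0 ler_expR; lra.
by rewrite mulr_ge0 ?prod_weight_ge0// expR_ge0.
Qed.

Lemma wprob_sum2 q v (j l : 'I_k) : \sum_i q i = 1 -> \sum_i q i * v i = 0 ->
  \sum_(s : {ffun 'I_k -> 'I_n}) (\prod_j' q (s j')) * (v (s j) * v (s l)) =
  if j == l then \sum_i q i * v i ^+ 2 else 0.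
Proof.
move=> q1 v0.
(* [F] puts one copy of [v] at position [j] and one at position [l], so that the expectation factors
   over positions. If [j] and [l] differ, the factor at [j] is the mean of [v], which is 0. *)
pose F (j' : 'I_k) i := q i * (if j' == j then v i else 1) * (if j' == l then v i else 1).
transitivity (\sum_(s : {ffun 'I_k -> 'I_n}) \prod_j' F j' (s j')).
  apply: eq_bigr => s _; rewrite /F !big_split/= -mulrA; congr (_ * (_ * _)).
    by rewrite -big_mkcond/= big_pred1_eq.
  by rewrite -big_mkcond/= big_pred1_eq.
rewrite -bigA_distr_bigA/=; have [jl|jl] := eqVneq j l.
  rewrite (bigD1 j)//= [X in _ * X]big1 ?mulr1.
    by apply: eq_bigr => i _; rewrite /F -jl eqxx -mulrA expr2.
  by move=> i ij; rewrite /F -jl (negPf ij); under eq_bigr do rewrite !mulr1.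
rewrite (bigD1 j)//=; suff -> : \sum_i F j i = 0 by rewrite mul0r.
by apply: etrans v0; apply: eq_bigr => i _; rewrite /F eqxx (negPf jl) mulr1.
Qed.

Lemma wprob_chebyshev q v t : (forall i, 0 <= q i) -> \sum_i q i = 1 ->
  \sum_i q i * v i = 0 -> 0 < t ->
  wprob q (fun s => t <= `|\sum_j v (s j)|) <= k%:R * (\sum_i q i * v i ^+ 2) / t ^+ 2.
Proof.
move=> q0 q1 v0 t0.
have <- : \sum_(s : {ffun 'I_k -> 'I_n}) (\prod_j' q (s j')) * (\sum_j v (s j)) ^+ 2 =
    k%:R * (\sum_i q i * v i ^+ 2).
  transitivity (\sum_(s : {ffun 'I_k -> 'I_n}) \sum_(j < k) \sum_(l < k)
      (\prod_j' q (s j')) * (v (s j) * v (s l))).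
    apply: eq_bigr => s _; rewrite expr2 big_distrlr/= mulr_sumr.
    by apply: eq_bigr => j _; rewrite mulr_sumr.
  rewrite exchange_big/= (eq_bigr (fun=> \sum_i q i * v i ^+ 2)).
    by rewrite sumr_const card_ord mulr_natl.
  move=> j _; rewrite exchange_big/= (eq_bigr _ (fun l _ => wprob_sum2 j l q1 v0)).
  by rewrite -big_mkcond/= (big_pred1 j)// => l; rewrite eq_sym.
rewrite ler_pdivlMr ?exprn_gt0// /wprob mulr_suml big_mkcond/=; apply: ler_sum => s _.
case: ifPn => [h|_]; last by rewrite mulr_ge0 ?sqr_ge0 ?prod_weight_ge0.
by rewrite ler_wpM2l ?prod_weight_ge0// -[leRHS]real_normK ?num_real// ler_sqr ?nnegrE// ltW.
Qed.

End weighted_resampling.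

Section deviations.
Context {R : realType}.

(** Chernoff for [theta a (u - avg u)]: in the quadratic bound on the exponential the linear term
    averages to 0 and the square gives the sample variance. *)
Lemma wprob_upper_deviation (n k : nat) (u : 'I_n -> R) (V a theta c kappa : R) :
  (0 < n)%N -> 0 <= kappa -> kappa <= 1 -> 0 <= theta -> 0 < a ->
  avg (fun i => u i ^+ 2) - avg u ^+ 2 <= V ->
  (forall i, theta * a * (u i - avg u) <= kappa) ->
  wprob (fun=> n%:R^-1) (fun s : {ffun 'I_k -> 'I_n} =>
      k%:R * (avg u + a * c) <= \sum_j u (s j)) <=
    expR (- (k%:R * a ^+ 2 * (theta * c - (2^-1 + kappa) * theta ^+ 2 * V))).
Proof.
move=> n0 k0 k1 t0 a0 uV uk.
pose u' i := theta * a * (u i - avg u).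
have q0 i : 0 <= (fun=> n%:R^-1 : R) (i : 'I_n) by rewrite invr_ge0.
apply: (@le_trans _ _ (wprob (fun=> n%:R^-1) (fun s : {ffun 'I_k -> 'I_n} =>
    theta * a ^+ 2 * k%:R * c <= \sum_j u' (s j)))).
  apply: wprob_le => // s h.
  rewrite /u' -mulr_sumr sumrB sumr_const card_ord -[avg u *+ k]mulr_natl.
  have -> : theta * a ^+ 2 * k%:R * c = theta * a * (k%:R * a * c) by ring.
  rewrite ler_wpM2l//; first by rewrite mulr_ge0// ltW.
  by clear q0; move: h; lra.
apply: (le_trans (@wprob_chernoff _ k n _ u' (theta * a ^+ 2 * k%:R * c) q0)); clear q0.
rewrite -mulr_sumr -/(avg (fun i => expR (u' i))).
have e1 : avg (fun i => expR (u' i)) <= expR ((2^-1 + kappa) * theta ^+ 2 * a ^+ 2 * V).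
  apply: (@le_trans _ _ (1 + (2^-1 + kappa) * theta ^+ 2 * a ^+ 2 * V)); last exact: expR_ge1Dx.
  apply: (@le_trans _ _ (avg (fun i => 1 + (u' i + (2^-1 + kappa) * u' i ^+ 2)))).
    by apply: le_avg => i; rewrite addrA; exact: (expR_le_quadratic k0 k1 (uk i)).
  rewrite avgD avg_cst// lerD2l avgD.
  have -> : avg (fun i => u' i) = 0.
    by rewrite /u' avgZ (avgD u (fun=> - avg u)) avg_cst// subrr mulr0.
  rewrite avgZ.
  have -> : avg (fun i => u' i ^+ 2) = theta ^+ 2 * a ^+ 2 * (avg (fun i => u i ^+ 2) - avg u ^+ 2).
    rewrite (@eq_avg _ _ _ (fun i => theta ^+ 2 * a ^+ 2 * (u i ^+ 2 + ((- 2 * avg u) * u i + avg u ^+ 2)))).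
      by rewrite avgZ avgD avgD avgZ avg_cst//; ring.
    by move=> i; rewrite /u'; ring.
  rewrite add0r -!mulrA; apply: ler_wpM2l; first by rewrite addr_ge0.
  by do 4 (apply: ler_wpM2l; first by rewrite // ltW).
apply: (@le_trans _ _ (expR ((2^-1 + kappa) * theta ^+ 2 * a ^+ 2 * V) ^+ k *
    expR (- (theta * a ^+ 2 * k%:R * c)))).
  rewrite ler_wpM2r ?expR_ge0//; apply: lerXn2r; rewrite ?nnegrE ?expR_ge0//.
  by apply: avg_ge0 => i; exact: expR_ge0.
by rewrite -expRM_natl -expRD ler_expR; lra.
Qed.

(** [V] and [m] are chosen before [n], [k], [u] and [a], so that they can serve as thresholds in the
    definition of the good data events. *)
Lemma wprob_upper_rate (s2 L eps : R) : 0 <= s2 -> 0 <= L -> 0 < eps ->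
  exists V m, [/\ s2 < V, 0 < m & forall (n k : nat) (u : 'I_n -> R) (a : R),
    (0 < n)%N -> 0 < a -> avg (fun i => u i ^+ 2) - avg u ^+ 2 <= V ->
    (forall i, a * `|u i| <= m) ->
    wprob (fun=> n%:R^-1) (fun s : {ffun 'I_k -> 'I_n} =>
      k%:R * (avg u + a * (Num.sqrt (2 * L * s2) + eps)) <= \sum_j u (s j)) <=
    expR (- (k%:R * a ^+ 2 * L))].
Proof.
move=> s0 L0 e0; set c := Num.sqrt _ + eps.
(* [V'] is the largest variance allowed by the slack: [2 L V' <= 2 L s2 + eps^2 <= c^2], where the
   [+ 1] covers [L = 0]. [V] lies halfway between [s2] and [V'], and [kappa] is such that
   [(1/2 + kappa) V <= V' / 2]. Then [theta = c / V'] maximizes [theta c - theta^2 V' / 2], with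
   value [c^2 / (2 V') >= L]. *)
pose V' := s2 + eps ^+ 2 / (2 * L + 1).
have d0 : 0 < eps ^+ 2 / (2 * L + 1) by rewrite divr_gt0 ?exprn_gt0//; lra.
pose V := (s2 + V') / 2; pose kappa := (V' - V) / (2 * V').
have V'0 : 0 < V' by rewrite /V'; lra.
have VV' : V < V' by rewrite /V /V'; lra.
have V0 : 0 < V by rewrite /V /V'; lra.
have k0 : 0 < kappa by rewrite divr_gt0//; lra.
have k1 : kappa <= 1 by rewrite ler_pdivrMr//; lra.
have c0 : 0 < c by rewrite ltr_wpDl// sqrtr_ge0.
pose theta := c / V'.
have t0 : 0 < theta by rewrite divr_gt0.
exists V, (kappa / (2 * theta)); split.
- by rewrite /V /V'; lra.
- by rewrite divr_gt0//; lra.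
move=> n k u a n0 a0 uV um.
have avgm : a * `|avg u| <= kappa / (2 * theta).
  rewrite -{1}(gtr0_norm a0) -normrM -avgZ; apply: avg_norm_le => // i.
  by rewrite normrM gtr0_norm.
apply: le_trans (wprob_upper_deviation _ _ n0 (ltW k0) k1 (ltW t0) a0 uV _) _.
  move=> i; have := um i; rewrite -mulrA.
  have h1 := ler_norm (u i); have h2 := ler_norm (- avg u); rewrite normrN in h2.
  move=> h3; apply: (@le_trans _ _ (theta * (kappa / (2 * theta) + kappa / (2 * theta)))).
    by rewrite ler_wpM2l ?(ltW t0)//; nra.
  by rewrite le_eqVlt; apply/orP; left; apply/eqP; field; rewrite gt_eqF.
rewrite ler_expR lerN2; apply: ler_wpM2l; first by rewrite mulr_ge0 ?sqr_ge0.
have kV : kappa * V <= (V' - V) / 2.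
  by rewrite /kappa mulrAC ler_pdivrMr; [nra|lra].
have c2 : 2 * L * V' <= c ^+ 2.
  have : Num.sqrt (2 * L * s2) ^+ 2 = 2 * L * s2 by rewrite sqr_sqrtr// !mulr_ge0.
  have e2 : 2 * L * (eps ^+ 2 / (2 * L + 1)) <= eps ^+ 2.
    by rewrite mulrA ler_pdivrMr; nra.
  rewrite /c /V'; have := sqrtr_ge0 (2 * L * s2); nra.
apply: (@le_trans _ _ (theta * c - 2^-1 * theta ^+ 2 * V')).
  have -> : theta * c - 2^-1 * theta ^+ 2 * V' = c ^+ 2 / (2 * V').
    by rewrite /theta; field; rewrite gt_eqF.
  rewrite ler_pdivlMr ?mulr_gt0//.
  by have -> : L * (2 * V') = 2 * L * V' by ring.
have h : 0 <= theta ^+ 2 * ((V' - V) / 2 - kappa * V).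
  by rewrite mulr_ge0 ?sqr_ge0// subr_ge0.
lra.
Qed.

(* Proved by drawing with the weights (1 + a (b_i - avg b)) / n instead of 1 / n:
   the likelihood ratio is then bounded below on an event of tilted probability at
   least 1 / 2. *)
Lemma wprob_tilt_lower (m : nat) (M B V eps delta : R) :
  0 <= M -> 0 <= B -> 0 < eps -> 0 < delta ->
  exists K0 a0, 0 < a0 /\ forall (n k : nat) (u : 'I_m -> 'I_n -> R)
      (b : 'I_n -> R) (v : 'I_m -> R) (a : R),
    (0 < n)%N -> 0 < a -> a <= a0 -> K0 <= k%:R * a ^+ 2 ->
    (forall i, `|b i| <= M) ->
    (forall l, `|avg (fun i => u l i * b i) - avg (u l) * avg b - v l| <= eps / 2) ->
    (forall l, avg (fun i => u l i ^+ 2) <= B) ->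
    avg (fun i => b i ^+ 2) - avg b ^+ 2 <= V ->
    2^-1 * expR (- (k%:R * a ^+ 2 * (V / 2 + delta))) <=
    wprob (fun=> n%:R^-1) (fun s : {ffun 'I_k -> 'I_n} =>
      [forall l, `|\sum_j u l (s j) - k%:R * (avg (u l) + a * v l)| < k%:R * a * eps]).
Proof.
move=> M0 B0 e0 d0.
(* [C / (k a^2)] is the sum of the Chebyshev bounds below: [m] of them for the neighbourhood and one
   for the likelihood ratio. Hence [K0 = 2 C + 1] leaves at least 1/2 for the good event. *)
pose C := m%:R * (6 * B / eps ^+ 2) + 64 * M ^+ 2 / delta ^+ 2.
have C0 : 0 <= C.
  have := sqr_ge0 M; have : 0 <= B / eps ^+ 2 by rewrite divr_ge0 ?sqr_ge0.
  move=> h1 h2; apply: addr_ge0; last by apply: divr_ge0; [apply: mulr_ge0|exact: sqr_ge0].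
  by rewrite -mulrA; apply: mulr_ge0 => //; apply: mulr_ge0.
(* The first bound keeps [a (b_i - avg b)] in [[-1/2, 1/2]], so that the weights are positive and
   the logarithm can be expanded; the second makes the cubic remainder at most [a^2 delta / 2]. *)
pose a0 := Num.min (2^-1 / (2 * M + 1)) (delta / 2 / ((2 * M) ^+ 3 + 1)).
have M30 : 0 <= (2 * M) ^+ 3 by rewrite exprn_ge0// mulr_ge0.
exists (2 * C + 1), a0; split.
  by rewrite lt_min !divr_gt0//; lra.
move=> n k u b v a n0 a_gt0; rewrite le_min => /andP[aM aM3] kaK bM uv uB bV.
have ka0 : 0 < k%:R * a ^+ 2 by lra.
have k0 : 0 < k%:R :> R by rewrite -(pmulr_lgt0 _ (exprn_gt0 2 a_gt0)).
have {}aM : a * (2 * M) <= 2^-1.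
  by move: aM; rewrite ler_pdivlMr; [nra|lra].
have {}aM3 : a * (2 * M) ^+ 3 <= delta / 2.
  by move: aM3; rewrite ler_pdivlMr; [nra|lra].
pose be i := b i - avg b.
have beM i : `|be i| <= 2 * M.
  rewrite (le_trans (ler_normB _ _))//.
  by have := bM i; have := avg_norm_le n0 bM; lra.
have abe i : `|a * be i| <= 2^-1.
  by rewrite normrM gtr0_norm//; apply: le_trans aM; rewrite ler_wpM2l// ltW.
have abe' i : - 2^-1 <= a * be i /\ a * be i <= 2^-1.
  by apply/andP; rewrite -ler_norml.
have avgbe : avg be = 0.
  by rewrite /be (avgD b (fun=> - avg b)) avg_cst// subrr.
have avgbe2 : avg (fun i => be i ^+ 2) = avg (fun i => b i ^+ 2) - avg b ^+ 2.
  rewrite (@eq_avg _ _ _ (fun i => b i ^+ 2 + ((- 2 * avg b) * b i + avg b ^+ 2))).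
    by rewrite avgD avgD avgZ avg_cst//; ring.
  by move=> i; rewrite /be; ring.
pose q i := n%:R^-1 * (1 + a * be i).
have n0' : 0 < n%:R :> R by rewrite ltr0n.
have q0 i : 0 <= q i.
  by rewrite mulr_ge0 ?invr_ge0//; have [] := abe' i; lra.
have Eq (w : 'I_n -> R) : \sum_i q i * w i = avg (fun i => w i * (1 + a * be i)).
  by rewrite /avg mulr_sumr; apply: eq_bigr => i _; rewrite /q; ring.
have q1 : \sum_i q i = 1.
  rewrite -mulr_sumr -/(avg (fun i => 1 + a * be i)).
  by rewrite avgD avgZ avgbe avg_cst// mulr0 addr0.
have Eq2 (w : 'I_n -> R) : (forall i, 0 <= w i) -> \sum_i q i * w i <= 3 / 2 * avg w.
  move=> w0; rewrite Eq -avgZ; apply: le_avg => i.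
  by have := w0 i; have [] := abe' i; nra.
have var_le (w : 'I_n -> R) (e := \sum_i q i * w i) :
    \sum_i q i * (w i - e) ^+ 2 <= \sum_i q i * w i ^+ 2.
  rewrite (_ : \sum_i q i * (w i - e) ^+ 2 = \sum_i q i * w i ^+ 2 - e ^+ 2).
    by rewrite gerBl sqr_ge0.
  rewrite (eq_bigr (fun i => q i * w i ^+ 2 + ((- 2 * e) * (q i * w i) + e ^+ 2 * q i))).
    by rewrite big_split big_split/= -[X in _ + (X + _)]mulr_sumr -[X in _ + (_ + X)]mulr_sumr q1 -/e; ring.
  by move=> i _; ring.
have centered (w : 'I_n -> R) : \sum_i q i * (w i - \sum_j q j * w j) = 0.
  under eq_bigr do rewrite mulrBr.
  by rewrite sumrB -mulr_suml q1 mul1r subrr.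
have sumC (w : 'I_n -> R) e (s : {ffun 'I_k -> 'I_n}) :
    \sum_j (w (s j) - e) = \sum_j w (s j) - k%:R * e.
  by rewrite sumrB sumr_const card_ord -[e *+ k]mulr_natl.
pose l i := ln (1 + a * be i).
have l2 i : l i ^+ 2 <= 16 * a ^+ 2 * M ^+ 2.
  have h1 : `|l i| <= 4 * a * M.
    apply: le_trans (norm_ln1D_le (abe i)) _; rewrite normrM gtr0_norm//.
    by have := beM i; nra.
  have -> : 16 * a ^+ 2 * M ^+ 2 = (4 * a * M) ^+ 2 by ring.
  by rewrite -[leLHS]real_normK ?num_real// ler_sqr// nnegrE !mulr_ge0// ltW.
(* The left-hand side is the relative entropy of the tilted weights to the uniform ones. In [(x -
   x^2/2 + x^3/3) (1 + x) = x + x^2/2 - x^3/6 + x^4/3] the linear term averages to 0, the square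
   gives the sample variance of [b], and the rest is at most [|x|^3 / 2] since [|x| <= 1/2]. *)
have El : \sum_i q i * l i <= a ^+ 2 * (V / 2 + delta / 2).
  rewrite Eq; apply: (@le_trans _ _ (avg (fun i =>
      a * be i + (a ^+ 2 / 2 * be i ^+ 2 + a ^+ 2 * (delta / 2))))).
    apply: le_avg => i; have [x0 x1] := abe' i.
    apply: (@le_trans _ _ ((a * be i - (a * be i) ^+ 2 / 2 + (a * be i) ^+ 3 / 3) * (1 + a * be i))).
      by rewrite ler_wpM2r//; [lra|apply: ln1D_le; lra].
    have h3 : `|a * be i| ^+ 3 <= a ^+ 2 * (delta / 2).
      apply: (@le_trans _ _ (a ^+ 2 * (a * (2 * M) ^+ 3))); last first.
        by rewrite ler_wpM2l ?sqr_ge0.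
      rewrite normrM gtr0_norm// exprMn.
      have -> : a ^+ 2 * (a * (2 * M) ^+ 3) = a ^+ 3 * (2 * M) ^+ 3 by ring.
      by rewrite ler_wpM2l ?exprn_ge0 ?(ltW a_gt0)// lerXn2r ?nnegrE// mulr_ge0.
    move: h3; rewrite -[a ^+ 2 / 2 * be i ^+ 2](_ : (a * be i) ^+ 2 / 2 = _); last by field.
    move: x0 x1; set x := a * be i => x0 x1 h3.
    have [x00|x00] := leP 0 x.
      rewrite (ger0_norm x00) in h3; have p3 : 0 <= x ^+ 3 by rewrite exprn_ge0.
      have p4 : x ^+ 4 <= x ^+ 3.
        by rewrite exprS -[leRHS]mul1r ler_wpM2r//; lra.
      have -> : (x - x ^+ 2 / 2 + x ^+ 3 / 3) * (1 + x) =
        x + x ^+ 2 / 2 - x ^+ 3 / 6 + x ^+ 4 / 3 by field.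
      lra.
    rewrite (ltr0_norm x00) in h3.
    have p3 : 0 <= - x ^+ 3.
      have : 0 <= (- x) ^+ 3 by apply: exprn_ge0; lra.
      by lra.
    have p4 : x ^+ 4 <= - x ^+ 3.
      have -> : x ^+ 4 = (- x) * (- x ^+ 3) by ring.
      by rewrite -[leRHS]mul1r ler_wpM2r//; lra.
    have -> : (x - x ^+ 2 / 2 + x ^+ 3 / 3) * (1 + x) =
      x + x ^+ 2 / 2 - x ^+ 3 / 6 + x ^+ 4 / 3 by field.
    lra.
  rewrite avgD avgZ avgbe avgD avgZ avgbe2 avg_cst//.
  by have := ler_wpM2l (sqr_ge0 a) bV; lra.
pose El' := \sum_i q i * l i.
pose E0 := fun s : {ffun 'I_k -> 'I_n} => k%:R * a ^+ 2 * (V / 2 + delta) < \sum_j l (s j).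
pose Eu := fun (p : 'I_m) (s : {ffun 'I_k -> 'I_n}) =>
  k%:R * a * eps <= `|\sum_j u p (s j) - k%:R * (avg (u p) + a * v p)|.
have P0 : wprob q E0 <= 64 * M ^+ 2 / delta ^+ 2 / (k%:R * a ^+ 2).
  (* By [El] the tilted mean of the log-likelihood ratio is at most [k a^2 (V/2 + delta/2)], so [E0]
     forces a deviation of the other [k a^2 delta / 2]. *)
  pose t := k%:R * (a ^+ 2 * (delta / 2)).
  have t0 : 0 < t by rewrite !mulr_gt0 ?exprn_gt0// invr_gt0.
  apply: (@le_trans _ _ (wprob q (fun s : {ffun 'I_k -> 'I_n} => t <= `|\sum_j (l (s j) - El')|))).
    apply: wprob_le => // s; rewrite /E0 sumC => h; apply: le_trans (ler_norm _).
    by have := ler_wpM2l (ltW k0) El; rewrite -/El' /t; move: h; lra.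
  apply: (le_trans (@wprob_chebyshev _ k n q (fun i => l i - El') t q0 q1 (centered l) t0)).
  have {}var_le := var_le l.
  have h : \sum_i q i * l i ^+ 2 <= 16 * a ^+ 2 * M ^+ 2.
    rewrite -[leRHS]mul1r -[X in _ <= X * _]q1 mulr_suml; apply: ler_sum => i _.
    exact: (ler_wpM2l (q0 i) (l2 i)).
  rewrite ler_pdivrMr ?exprn_gt0//.
  apply: (@le_trans _ _ (k%:R * (16 * a ^+ 2 * M ^+ 2))).
    by apply: ler_wpM2l; [exact: ltW|exact: le_trans h].
  rewrite le_eqVlt; apply/orP; left; apply/eqP; rewrite /t; field.
  by rewrite !gt_eqF.
have Pu p : wprob q (Eu p) <= 6 * B / eps ^+ 2 / (k%:R * a ^+ 2).
  (* Half of [eps] is spent on the distance from the tilted mean of [u p] to the target, the other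
     half on the fluctuation around that mean. The tilted second moment is at most [3/2 B] because
     the weights are at most [3 / (2 n)]. *)
  pose t := k%:R * a * (eps / 2); pose e := \sum_i q i * u p i.
  have t0 : 0 < t by rewrite !mulr_gt0// invr_gt0.
  apply: (@le_trans _ _ (wprob q (fun s : {ffun 'I_k -> 'I_n} => t <= `|\sum_j (u p (s j) - e)|))).
    apply: wprob_le => // s; rewrite /Eu sumC => h.
    have he : `|k%:R * e - k%:R * (avg (u p) + a * v p)| <= t.
      have -> : e = avg (u p) + a * (avg (fun i => u p i * b i) - avg (u p) * avg b).
        rewrite /e Eq (@eq_avg _ _ _ (fun i => u p i + (a * (u p i * b i) + (- a * avg b) * u p i))).
          by rewrite avgD avgD !avgZ; ring.
        by move=> i; rewrite /be; ring.
      rewrite -mulrBr normrM (gtr0_norm k0) /t -mulrA ler_wpM2l ?(ltW k0)//.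
      rewrite [X in `|X|](_ : _ = a * (avg (fun i => u p i * b i) - avg (u p) * avg b - v p)); last by ring.
      by rewrite normrM gtr0_norm// ler_wpM2l// ltW.
    have := ler_normD (\sum_j u p (s j) - k%:R * e) (k%:R * e - k%:R * (avg (u p) + a * v p)).
    by rewrite addrA subrK; move: h he; rewrite /t; lra.
  apply: (le_trans (@wprob_chebyshev _ k n q (fun i => u p i - e) t q0 q1 (centered (u p)) t0)).
  have {}var_le := var_le (u p).
  have h : \sum_i q i * u p i ^+ 2 <= 3 / 2 * B.
    apply: le_trans (Eq2 _ (fun i => sqr_ge0 (u p i))) _.
    by have := uB p; lra.
  rewrite ler_pdivrMr ?exprn_gt0//.
  apply: (@le_trans _ _ (k%:R * (3 / 2 * B))).
    by apply: ler_wpM2l; [exact: ltW|exact: le_trans h].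
  rewrite le_eqVlt; apply/orP; left; apply/eqP; rewrite /t; field.
  by rewrite !gt_eqF.
pose G := fun s : {ffun 'I_k -> 'I_n} =>
  [forall p, `|\sum_j u p (s j) - k%:R * (avg (u p) + a * v p)| < k%:R * a * eps].
have Pbad : wprob q (fun s => E0 s || [exists p, Eu p s]) <= 2^-1.
  apply: le_trans (wprobU _ _ q0) _.
  apply: (@le_trans _ _ (64 * M ^+ 2 / delta ^+ 2 / (k%:R * a ^+ 2) +
      \sum_(p < m) 6 * B / eps ^+ 2 / (k%:R * a ^+ 2))).
    by apply: lerD => //; exact: wprob_exists.
  rewrite sumr_const card_ord -[X in _ + X]mulr_natl.
  rewrite (_ : _ + _ = C / (k%:R * a ^+ 2)); last by rewrite /C; ring.
  by rewrite ler_pdivrMr//; lra.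
have Pgood : 2^-1 <= wprob q (predC (fun s => E0 s || [exists p, Eu p s])).
  by rewrite wprobC//; lra.
rewrite -/G; apply: (@le_trans _ _ (expR (- (k%:R * a ^+ 2 * (V / 2 + delta))) *
    wprob q (predC (fun s => E0 s || [exists p, Eu p s])))).
  by rewrite mulrC ler_wpM2l ?expR_ge0.
have invn0 (i : 'I_n) : 0 <= n%:R^-1 :> R by rewrite invr_ge0.
apply: (@le_trans _ _ (wprob (fun=> n%:R^-1) (predC (fun s => E0 s || [exists p, Eu p s])))); last first.
  apply: wprob_le => // s /=; rewrite negb_or => /andP[_ h]; apply/forallP => p.
  by rewrite ltNge; apply: contra h => h; apply/existsP; exists p.
clear invn0; rewrite /wprob mulr_sumr; apply: ler_sum => s /=; rewrite negb_or => /andP[h _].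
(* The change of measure: the likelihood ratio of a resample is the exponential of the sum of the
   [l], and it is controlled off [E0]. *)
have -> : \prod_(j < k) q (s j) = \prod_(j < k) n%:R^-1 * expR (\sum_j l (s j)).
  rewrite expR_sum -big_split/=; apply: eq_bigr => j _; rewrite /q /l lnK//.
  by rewrite posrE; have [] := abe' (s j); lra.
rewrite mulrCA ler_piMr ?prodr_ge0// -expRD -[leRHS]expR0 ler_expR.
by move: h; rewrite /E0 -leNgt; lra.
Qed.

End deviations.

(** * Empirical measures and the law of a resample *)

Section empirical_measure.
Context d (T : measurableType d) (R : realType).

Lemma empiricalE (n : nat) (x : nat -> T) (A : set T) :
  empirical R n x A = (avg (fun i : 'I_n => \1_A (x i)))%:E.
Proof.
rewrite /empirical /mscale/= /msum /avg EFinM -sumEFin.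
by congr (_ * _)%E; apply: eq_bigr => i _; rewrite /dirac.
Qed.

Lemma empiricalT (n : nat) (x : nat -> T) : (0 < n)%N -> empirical R n x setT = 1%E.
Proof.
by move=> n0; rewrite empiricalE; under eq_avg do rewrite indicT; rewrite avg_cst.
Qed.

Lemma ge0_integral_empirical (n : nat) (x : nat -> T) (f : T -> R) :
  measurable_fun setT f -> (forall x, 0 <= f x) ->
  (\int[empirical R n x]_y (f y)%:E)%E = (avg (fun i : 'I_n => f (x i)))%:E.
Proof.
move=> mf f0; have mf' : measurable_fun setT (EFin \o f) by exact/measurable_EFinP.
have f0' y : setT y -> (0 <= (f y)%:E)%E by rewrite lee_fin.
rewrite /empirical ge0_integral_mscale//= ge0_integral_measure_sum//.
rewrite /avg EFinM -sumEFin; congr (_ * _)%E; apply: eq_bigr => i _.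
by rewrite integral_dirac//= ?diracT ?mul1e//; exact/measurable_EFinP.
Qed.

Lemma Rintegral_empirical (n : nat) (x : nat -> T) (f : T -> R) :
  measurable_fun setT f ->
  \int[empirical R n x]_y f y = avg (fun i : 'I_n => f (x i)).
Proof.
move=> mf; rewrite /Rintegral integralE.
rewrite funerpos funerneg !ge0_integral_empirical//; last 2 first.
- exact: measurable_funrneg.
- exact: measurable_funrpos.
rewrite -EFinB/= -mulrBr -sumrB.
by rewrite /avg; congr (_ * _); apply: eq_bigr => i _; rewrite -[in RHS](funrposBneg f).
Qed.

End empirical_measure.

Section resample_law.
Context d (T : measurableType d) (R : realType).
Hypothesis measurable_set1 : forall x : T, measurable [set x].
Context d' (U : measurableType d') (Q : probability U R).
Variables (k n : nat) (x : nat -> T) (Y : 'I_k -> {mfun U >-> T}).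
Hypothesis n_gt0 : (0 < n)%N.
Hypothesis iidY : iid Q (fun j => Y j : U -> T) (empirical R n x).

(* The data may have ties: r chooses one index for each value of x. *)
Let r (i : 'I_n) : 'I_n := odflt i [pick i' : 'I_n | x i' == x i].

Let xr i : x (r i) = x i.
Proof. by rewrite /r; case: pickP => [j /eqP//|/(_ i)]; rewrite eqxx. Qed.

Let r_eq (i j : 'I_n) : x i = x j -> r i = r j.
Proof.
move=> e; rewrite /r (@eq_pick _ _ (fun i' : 'I_n => x i' == x j)); last by move=> i'; rewrite /= e.
by case: pickP => [//|/(_ j)]; rewrite eqxx.
Qed.

Let rr i : r (r i) = r i. Proof. by apply: r_eq; rewrite xr. Qed.

(** Restricted to [good] index functions, whose values are representatives, the events [E s] are
    pairwise disjoint. [w s] adds up the weights of all index functions that produce the same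
    resample as [s]. *)
Let E (s : {ffun 'I_k -> 'I_n}) : set U := [set u | forall j, Y j u = x (s j)].
Let good (s : {ffun 'I_k -> 'I_n}) := [forall j, r (s j) == s j].
Let w (s : {ffun 'I_k -> 'I_n}) : R := \prod_j \sum_(i | r i == s j) n%:R^-1.

Let EE s : E s = \bigcap_(j in [set` enum 'I_k]) (Y j @^-1` [set x (s j)]).
Proof.
apply/seteqP; split=> [u Eu j _ /=|u Eu j]; first exact: Eu.
by apply: Eu; rewrite /= mem_enum.
Qed.

Let mE s : measurable (E s).
Proof.
rewrite EE; apply: fin_bigcap_measurable => // j _; rewrite -[X in measurable X]setTI.
exact: measurable_funP.
Qed.

Let QE s : good s -> Q (E s) = (w s)%:E.
Proof.
move=> /forallP gs; rewrite EE; have [lawY indY] := iidY.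
rewrite (indY (enum 'I_k) (fun j => [set x (s j)])) ?enum_uniq// /w.
rewrite -prodEFin big_enum/=; apply: eq_bigr => j _; rewrite lawY// empiricalE; congr _%:E.
rewrite /avg mulr_sumr [RHS]big_mkcond/=; apply: eq_bigr => i _.
rewrite indicE; have [e|ne] := eqVneq (r i) (s j).
  by rewrite mem_set ?mulr1//= -xr e.
rewrite memNset ?mulr0//= => e; move/eqP: ne; apply.
by rewrite (r_eq e); exact/eqP.
Qed.

(** Index functions are grouped by their composition with [r]; the sum over one group is a product
    of sums, namely [w]. *)
Let wprob_w (A : ('I_k -> T) -> Prop) :
  wprob (fun=> n%:R^-1) (fun s : {ffun 'I_k -> 'I_n} => `[< A (fun j => x (s j)) >]) =
  \sum_(s | good s && `[< A (fun j => x (s j)) >]) w s.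
Proof.
rewrite /wprob (partition_big (fun s : {ffun 'I_k -> 'I_n} => [ffun j => r (s j)])
  (fun s => good s && `[< A (fun j => x (s j)) >]))/=; last first.
  move=> s As; apply/andP; split; first by apply/forallP => j; rewrite !ffunE rr.
  apply/asboolP; move/asboolP : As; congr A; apply/funext => j.
  by rewrite ffunE xr.
apply: eq_bigr => s /andP[/forallP gs As]; rewrite /w.
rewrite (bigA_distr_big_dep (fun (j : 'I_k) (i : 'I_n) => r i == s j) (fun _ _ => n%:R^-1))/=; apply: eq_bigl => f.
apply/andP/familyP => [[_ /eqP <- j]|h]; first by rewrite unfold_in ffunE.
have e : [ffun j => r (f j)] = s.
  by apply/ffunP => j; rewrite ffunE; apply/eqP; exact: h.
split; last by rewrite e.
apply/asboolP; move/asboolP : As; congr A; apply/funext => j.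
by rewrite -e ffunE xr.
Qed.

Let wprob_le_law (A : ('I_k -> T) -> Prop) (B : set U) : measurable B ->
  [set u | A (fun j => Y j u)] `<=` B ->
  ((wprob (fun=> n%:R^-1) (fun s : {ffun 'I_k -> 'I_n} => `[< A (fun j => x (s j)) >]))%:E
   <= Q B)%E.
Proof.
move=> mB AB; rewrite wprob_w.
pose l := [seq s <- enum {: {ffun 'I_k -> 'I_n}} | good s && `[< A (fun j => x (s j)) >]].
rewrite (_ : _%:E = Q (\bigcup_(s in [set` l]) E s)); last first.
  rewrite measure_fin_bigcup//=; last first.
    move=> s t; rewrite /= !mem_filter => /andP[/andP[/forallP gs _] _] /andP[/andP[/forallP gt _] _].
    move=> [u [Eu Eu']]; apply/ffunP => j.
    by rewrite -(eqP (gs j)) -(eqP (gt j)); apply: r_eq; rewrite -Eu -Eu'.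
  have ul : uniq l by rewrite filter_uniq// enum_uniq.
  rewrite -fsbig_seq// /l big_filter big_enum_cond/= -sumEFin.
  by apply: eq_big => [s|s /andP[gs _]]; rewrite ?QE.
rewrite le_measure ?inE//; first by apply: fin_bigcup_measurable.
move=> u [s /=]; rewrite mem_filter => /andP[/andP[_ /asboolP As] _] Eu.
by apply: AB => /=; move: As; congr A; apply/funext => j; rewrite Eu.
Qed.

(** [wprob_le_law] gives one inequality only, since draws outside the data are merely improbable.
    Applied to the event and to its complement, whose weights add up to 1, it gives equality. *)
Lemma resample_law (A : ('I_k -> T) -> Prop) : measurable [set u | A (fun j => Y j u)] ->
  Q [set u | A (fun j => Y j u)] =
  (wprob (fun=> n%:R^-1) (fun s : {ffun 'I_k -> 'I_n} => `[< A (fun j => x (s j)) >]))%:E.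
Proof.
move=> mA; apply/eqP; rewrite eq_le; apply/andP; split; last exact: wprob_le_law.
have h := @wprob_le_law (fun y => ~ A y) (~` [set u | A (fun j => Y j u)]) (measurableC mA) _.
rewrite probability_setC// in h; move: h => /(_ (fun _ => id)).
have -> : wprob (fun=> n%:R^-1) (fun s : {ffun 'I_k -> 'I_n} => `[< ~ A (fun j => x (s j)) >]) =
  1 - wprob (fun=> n%:R^-1) (fun s : {ffun 'I_k -> 'I_n} => `[< A (fun j => x (s j)) >]) :> R.
  rewrite -wprobC.
    by apply: eq_bigl => s; rewrite /= asbool_neg.
  by rewrite sumr_const card_ord -[_ *+ n]mulr_natl mulfV// pnatr_eq0 -lt0n.
rewrite -(fineK (fin_num_measure Q _ mA)) -EFinB !lee_fin; lra.
Qed.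

End resample_law.

(** * Strong law of large numbers *)

Section probability_integrals.
Context d (T : measurableType d) (R : realType) (P : probability T R).
Implicit Types (f g : T -> R).

Lemma integrable_bounded f (M : R) : measurable_fun setT f -> (forall x, `|f x| <= M) ->
  P.-integrable setT (EFin \o f).
Proof.
move=> mf fM; apply: measurable_bounded_integrable => //.
  by rewrite -ge0_fin_numE ?fin_num_measure.
exists M; split; first exact: num_real.
by move=> y My x _; exact: le_trans (fM x) (ltW My).
Qed.

Lemma EFin_Rintegral f : P.-integrable setT (EFin \o f) ->
  (\int[P]_x f x)%:E = (\int[P]_x (f x)%:E)%E.
Proof. by move=> If; rewrite /Rintegral fineK//; exact: integrable_fin_num. Qed.

Lemma Rintegral_sum (I : Type) (s : seq I) (F : I -> T -> R) :
  (forall i, P.-integrable setT (EFin \o F i)) ->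
  \int[P]_x (\sum_(i <- s) F i x) = \sum_(i <- s) \int[P]_x F i x.
Proof.
move=> IF; elim: s => [|i s IH].
  under eq_Rintegral do rewrite big_nil.
  by rewrite Rintegral_cst// mul0r big_nil.
under eq_Rintegral do rewrite big_cons.
rewrite RintegralD//; first by rewrite big_cons IH.
have := @integrable_sum _ _ _ P setT measurableT _ s xpredT (fun i => EFin \o F i) (fun i _ => IF i).
apply: eq_integrable => // x _.
by rewrite /= sumEFin.
Qed.

Lemma Rintegral_prob_cst c : \int[P]_x (cst c x) = c.
Proof. by rewrite Rintegral_cst//= probability_setT mulr1. Qed.

End probability_integrals.

Lemma ae_not_limsup d (T : measurableType d) (R : realType) (P : probability T R)
    (E : nat -> set T) : (forall n, measurable (E n)) ->
  (\sum_(n <oo) P (E n) < +oo)%E -> {ae P, forall w, \forall n \near \oo, ~ E n w}.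
Proof.
move=> mE sE; exists (lim_sup_set E); split.
- apply: bigcap_measurable => // k _; exact: bigcup_measurable.
- exact: lim_sup_set_cvg0.
- move=> w /= h n _; apply: contrapT => hn; apply: h; exists n => // m nm Em.
  by apply: hn; exists m.
Qed.

Section iid_sequences.
Context d (T : measurableType d) (R : realType) (P : probability T R).
Context d' (O : measurableType d') (P0 : probability O R).
Variable X : nat -> {RV P0 >-> T}.
Hypothesis iidX : iid P0 (fun i => X i : O -> T) P.

Lemma ge0_integral_law i (f : T -> \bar R) : measurable_fun setT f ->
  (forall x, (0 <= f x)%E) ->
  (\int[P0]_w f (X i w) = \int[P]_x f x)%E.
Proof.
move=> mf f0; rewrite [RHS](eq_measure_integral (pushforward P0 (X i))).
  by rewrite ge0_integral_pushforward.
by move=> A mA _; have [lawX _] := iidX; exact: esym (lawX i A mA).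
Qed.

(** The law of the pair agrees with the product measure on rectangles, hence everywhere; boundedness
    of [u] and [v] then allows Fubini. *)
Lemma Rintegral_mul_indep i j (u v : T -> R) (M N : R) : i != j ->
  measurable_fun setT u -> measurable_fun setT v ->
  (forall x, `|u x| <= M) -> (forall x, `|v x| <= N) ->
  \int[P0]_w (u (X i w) * v (X j w)) = (\int[P]_x u x) * \int[P]_x v x.
Proof.
move=> ij mu mv uM vN.
pose XX w := (X i w, X j w).
have mXX : measurable_fun setT XX.
  by apply/measurable_fun_pairP; split; exact: measurable_funP.
have law : forall B : set (T * T), measurable B -> (P \x P)%E B = pushforward P0 XX B.
  apply: product_measure_unique => A B mA mB.
  have [lawX indX] := iidX.
  have := indX [:: i; j] (fun l => if l == i then A else B).
  rewrite /= inE ij => /(_ isT) h.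
  rewrite !big_cons big_nil mule1 in h.
  rewrite eqxx eq_sym (negPf ij) in h.
  rewrite -(lawX i A)// -(lawX j B)// -h; last by move=> l; case: ifP.
  congr (P0 _); apply/seteqP; split => [w [/= Aw Bw] l|w h' /=].
    by rewrite /= !inE => /orP[] /eqP ->; rewrite ?eqxx// eq_sym (negPf ij).
  split; first by have := h' i; rewrite /= inE eqxx => /(_ isT).
  by have := h' j; rewrite /= !inE eqxx orbT eq_sym (negPf ij) => /(_ isT).
pose f (z : T * T) := u z.1 * v z.2.
have mf : measurable_fun setT f.
  by apply: measurable_funM; exact: measurableT_comp.
have fb z : `|f z| <= M * N by rewrite normrM ler_pM.
have If : (P \x P)%E.-integrable setT (EFin \o f) by exact: integrable_bounded fb.
rewrite /Rintegral.
transitivity (fine (\int[(P \x P)%E]_z (f z)%:E)%E).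
  rewrite (eq_measure_integral (pushforward P0 XX)); last by move=> A mA _; exact: law.
  have mf' : measurable_fun setT (EFin \o f) by exact/measurable_EFinP.
  have If' : P0.-integrable (XX @^-1` setT) ((EFin \o f) \o XX).
    exact: (integrable_bounded P0 (measurableT_comp mf mXX) (fun w => fb (XX w))).
  by rewrite (integral_pushforward mXX mf' If').
transitivity (fine (\int[P]_x \int[P]_y (f (x, y))%:E)%E).
  by congr fine; apply: esym; exact: (@integral12_prod_meas1 _ _ _ _ _ P P (EFin \o f) If).
transitivity (fine (\int[P]_x (u x * \int[P]_y v y)%:E)%E).
  congr fine; apply: eq_integral => x _.
  under eq_integral => y _ do rewrite /f /= EFinM.
  rewrite integralZl//; last exact: integrable_bounded vN.
  by rewrite EFinM EFin_Rintegral//; exact: integrable_bounded vN.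
have := @RintegralZr _ _ _ P setT u (\int[P]_y v y) measurableT (integrable_bounded P mu uM).
by [].
Qed.

Lemma measurable_sum_law (v : T -> R) n : measurable_fun setT v ->
  measurable_fun setT (fun w => \sum_(i < n) v (X i w)).
Proof. by move=> mv; apply: measurable_sum => i; exact: measurableT_comp. Qed.

Lemma law_sum_chebyshev (v : T -> R) (M t : R) n :
  measurable_fun setT v -> (forall x, `|v x| <= M) -> \int[P]_x v x = 0 -> 0 < t ->
  (P0 [set w | t <= `|\sum_(i < n) v (X i w)|]%R <=
   (n%:R * (\int[P]_x (v x ^+ 2)) / t ^+ 2)%:E)%E.
Proof.
move=> mv vM v0 t0.
have M0 : 0 <= M by apply: le_trans (vM point).
have vvM i j w : `|v (X i w) * v (X j w)| <= M * M by rewrite normrM ler_pM.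
have mvv i j : measurable_fun setT (fun w => v (X i w) * v (X j w)).
  by apply: measurable_funM; exact: measurableT_comp.
have Ivv i j := integrable_bounded P0 (mvv i j) (vvM i j).
have E2 : \int[P0]_w ((\sum_(i < n) v (X i w)) ^+ 2) = n%:R * (\int[P]_x (v x ^+ 2)).
  under eq_Rintegral => w _.
    rewrite expr2 big_distrlr/=; over.
  rewrite Rintegral_sum; last first.
    move=> i; have := @integrable_sum _ _ _ P0 setT measurableT _ (enum 'I_n) xpredT 
      (fun j => EFin \o _) (fun j _ => Ivv i j).
    by apply: eq_integrable => // x _; rewrite /= sumEFin big_enum.
  rewrite (eq_bigr (fun=> \int[P]_x (v x ^+ 2))); last first.
    move=> i _; rewrite Rintegral_sum; last by move=> j; exact: Ivv.
    rewrite (bigD1 i)//= big1 ?addr0; last first.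
      move=> j ji; rewrite (@Rintegral_mul_indep _ _ v v M M)// ?v0 ?mulr0//.
      by rewrite eq_sym.
    rewrite /Rintegral; congr fine.
    under eq_integral do rewrite -expr2.
    apply: (@ge0_integral_law i (fun x => (v x ^+ 2)%:E)).
      by apply/measurable_EFinP; exact: measurable_funX.
    by move=> x; rewrite lee_fin sqr_ge0.
  by rewrite sumr_const card_ord mulr_natl.
pose A := [set w | t <= `|\sum_(i < n) v (X i w)|].
have mZ := measurable_sum_law n mv.
have mA : measurable A by apply: measurable_set_ge; exact: measurableT_comp.
rewrite EFinM lee_pdivlMr ?exprn_gt0// -E2 muleC -integral_cst//.
rewrite EFin_Rintegral; last first.
  apply: (@integrable_bounded _ _ _ _ _ ((\sum_(i < n) M) ^+ 2)); first exact: measurable_funX.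
  move=> w; rewrite normrX lerXn2r ?nnegrE//; first exact: sumr_ge0.
  by apply: le_trans (ler_norm_sum _ _ _) _; exact: ler_sum.
apply: (@le_trans _ _ (\int[P0]_(w in A) ((\sum_(i < n) v (X i w)) ^+ 2)%:E)%E).
  apply: ge0_le_integral => //.
  - by move=> w _; rewrite lee_fin sqr_ge0.
  - by apply/measurable_EFinP; apply: measurable_funTS; exact: measurable_funX.
  - move=> w Aw; rewrite lee_fin -[leRHS]real_normK ?num_real//.
    by rewrite ler_sqr ?nnegrE// ltW.
apply: ge0_subset_integral => //.
  by apply/measurable_EFinP; exact: measurable_funX.
by move=> w _; rewrite lee_fin sqr_ge0.
Qed.

End iid_sequences.

Section scalar_series.
Context {R : realType}.

Lemma nneseries_le_bound (u : nat -> \bar R) (C : \bar R) : (forall n, (0 <= u n)%E) ->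
  (forall n, (\sum_(0 <= i < n) u i <= C)%E) -> (\sum_(i <oo) u i <= C)%E.
Proof.
by move=> u0 uC; apply: lime_le; [exact: is_cvg_nneseries|exact: nearW].
Qed.

Lemma sum_inv_sqr_le n : \sum_(i < n) (i.+1%:R ^+ 2)^-1 <= 2 :> R.
Proof.
(* Strengthened so that the induction telescopes: [1 / x^2 <= 2 / x - 2 / (1 + x)] for [x >= 1]. *)
suff : \sum_(i < n) (i.+1%:R ^+ 2)^-1 <= 2 - 2 / n.+1%:R :> R.
  by move/le_trans; apply; rewrite gerBl divr_ge0.
elim: n => [|n IH]; first by rewrite big_ord0; lra.
rewrite big_ord_recr/= (le_trans (lerD IH (lexx _)))//.
have p : 1 <= n.+1%:R :> R by rewrite ler1n.
have -> : n.+2%:R = 1 + n.+1%:R :> R by rewrite -natr1 addrC.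
move: p; set x := n.+1%:R => p.
rewrite -subr_ge0.
have -> : 2 - 2 / (1 + x) - (2 - 2 / x + (x ^+ 2)^-1) = (x - 1) / (x ^+ 2 * (1 + x)).
  by field; rewrite !gt_eqF//; lra.
by rewrite divr_ge0 ?mulr_ge0 ?sqr_ge0//; lra.
Qed.

(** The terms with [2^m <= r] grow geometrically up to [r], the later ones decay geometrically. The
    two invariants of the induction say which regime has been reached. *)
Lemma sum_min_dyadic_le (r : R) n : 0 <= r ->
  \sum_(m < n) Num.min (2 ^+ m) (r ^+ 2 / 2 ^+ m) <= 4 * r.
Proof.
move=> r0.
suff [h1 h2] : (2 ^+ n <= r -> \sum_(m < n) Num.min (2 ^+ m) (r ^+ 2 / 2 ^+ m) <= 2 ^+ n) /\
    (r < 2 ^+ n -> \sum_(m < n) Num.min (2 ^+ m) (r ^+ 2 / 2 ^+ m) <= 4 * r - 2 * (r ^+ 2 / 2 ^+ n)).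
  have [h|h] := leP (2 ^+ n) r; first by rewrite (le_trans (h1 h))//; lra.
  by rewrite (le_trans (h2 h))// gerBl mulr_ge0// divr_ge0 ?sqr_ge0// exprn_ge0.
elim: n => [|n [IH1 IH2]].
  rewrite big_ord0 expr0; split=> [//|r1]; rewrite divr1; nra.
rewrite big_ord_recr/=; set s := \sum_(i < n) _ in IH1 IH2 *.
have p0 : 0 < 2 ^+ n :> R by rewrite exprn_gt0.
have m1 : Num.min (2 ^+ n) (r ^+ 2 / 2 ^+ n) <= 2 ^+ n by rewrite ge_min lexx.
have m2 : Num.min (2 ^+ n) (r ^+ 2 / 2 ^+ n) <= r ^+ 2 / 2 ^+ n by rewrite ge_min lexx orbT.
rewrite exprS; split => h.
  have := IH1 (_ : 2 ^+ n <= r); have h' : 2 ^+ n <= r by lra.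
  by move=> /(_ h'); lra.
have e : 2 * (r ^+ 2 / (2 * 2 ^+ n)) = r ^+ 2 / 2 ^+ n by field; rewrite gt_eqF.
rewrite e; have [h'|h'] := leP (2 ^+ n) r; last by have := IH2 h'; lra.
have := IH1 h'; move: m1 m2; set q := Num.min _ _ => m1 m2 sp.
have : r ^+ 2 / 2 ^+ n <= 2 * r by rewrite ler_pdivrMr//; nra.
nra.
Qed.

Lemma exists_dyadic n : (0 < n)%N -> exists m, (2 ^ m <= n < 2 ^ m.+1)%N.
Proof.
by move=> n0; exists (trunc_log 2 n); rewrite trunc_logP ?trunc_log_ltn.
Qed.

Lemma exists_square n : (0 < n)%N -> exists m, (m.+1 ^ 2 <= n < m.+2 ^ 2)%N.
Proof.
elim: n => // n IH _; have [->|n0] := posnP n; first by exists 0%N.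
have [m /andP[h1 h2]] := IH n0.
have [h|h] := leqP (m.+2 ^ 2) n.+1; last by exists m; lia.
by exists m.+1; rewrite h/=; rewrite !expnS !expn0 in h1 h2 h *; lia.
Qed.

End scalar_series.

Section truncation.
Context d (T : measurableType d) (R : realType) (P : probability T R).

Lemma measurable_norm_gt (g : T -> R) (M : R) : measurable_fun setT g ->
  measurable [set x | M < `|g x|].
Proof.
by move=> mg; apply: measurable_set_gt; exact: measurableT_comp.
Qed.

Lemma integrable_le_norm (f g : T -> R) : measurable_fun setT f ->
  (forall x, `|f x| <= g x) -> P.-integrable setT (EFin \o g) ->
  P.-integrable setT (EFin \o f).
Proof.
move=> mf fg Ig; apply: le_integrable Ig => //; first exact/measurable_EFinP.
by move=> x _; rewrite /= lee_fin (le_trans (fg x))// ler_norm.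
Qed.

Lemma le_RintegralT (f g : T -> R) : P.-integrable setT (EFin \o f) ->
  P.-integrable setT (EFin \o g) -> (forall x, f x <= g x) ->
  \int[P]_x f x <= \int[P]_x g x.
Proof. by move=> If Ig fg; apply: le_Rintegral. Qed.

(** Dominated convergence. The truncated function [g] is separate from the integrand [f], so that
    one level of [g] can serve several integrands at once. *)
Lemma integral_tail_small (f g : T -> R) (eps : R) :
  P.-integrable setT (EFin \o f) -> measurable_fun setT g -> 0 < eps ->
  exists M : nat, \int[P]_x (`|f x| * \1_[set x | M%:R < `|g x|] x) <= eps.
Proof.
move=> If mg e0.
have mf : measurable_fun setT f by apply/measurable_EFinP; exact: measurable_int If.
have mfn : measurable_fun setT (fun x => `|f x|) by exact: measurableT_comp.
pose h n x := `|f x| * \1_[set x | n%:R < `|g x|] x.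
have mh n : measurable_fun setT (h n).
  by apply: measurable_funM => //; apply: measurable_indic; exact: measurable_norm_gt.
have [] := @dominated_convergence _ _ _ P setT measurableT (fun n => EFin \o h n)
  (cst 0%E) (fun x => `|f x|%:E) _ _ _ _ _.
- by move=> n; apply/measurable_EFinP.
- exact: measurable_cst.
- apply: aeW => x _; apply: cvg_near_cst; exists (Num.truncn `|g x|).+1 => // n /= nM.
  rewrite /h indicE memNset ?mulr0//= => h'; move: h'; apply/negP; rewrite -leNgt.
  by rewrite (le_trans (ltW (Num.Theory.truncnS_gt _)))// ler_nat.
- exact: integrable_norm.
- apply: aeW => x n _; rewrite /= lee_fin normrM normr_id ler_piMr//.
  by rewrite indicE; case: (_ \in _); rewrite ?normr1 ?normr0.
move=> _ _; rewrite integral0 => /fine_cvgP[_ /cvgrPdist_le /(_ _ e0)[N _ /(_ N (leqnn N))]].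
rewrite /= sub0r normrN => hN; exists N.
by rewrite (le_trans (ler_norm _)).
Qed.

End truncation.

Section slln.
Context d (T : measurableType d) (R : realType) (P : probability T R).
Context d' (O : measurableType d') (P0 : probability O R).
Variable X : nat -> {RV P0 >-> T}.
Hypothesis iidX : iid P0 (fun i => X i : O -> T) P.

Lemma sumr_ord_cat (u : nat -> R) m n : (m <= n)%N ->
  \sum_(i < n) u i = \sum_(i < m) u i + \sum_(m <= i < n) u i.
Proof. by move=> mn; rewrite -!(big_mkord xpredT) -big_cat_nat. Qed.

Lemma slln_bounded (u : T -> R) (M eps : R) : measurable_fun setT u ->
  (forall x, `|u x| <= M) -> 0 < eps ->
  {ae P0, forall w, \forall n \near \oo,
    `|\sum_(i < n) u (X i w) - n%:R * \int[P]_x u x| <= n%:R * eps}.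
Proof.
move=> mu uM e0.
have Iu := integrable_bounded P mu uM.
set m := \int[P]_x u x; pose v x := u x - m.
have mv : measurable_fun setT v by exact: measurable_funB.
have v0 : \int[P]_x v x = 0.
  by rewrite RintegralB//= ?Rintegral_prob_cst ?subrr//; exact: finite_measure_integrable_cst.
pose K := M + `|m|.
have vK x : `|v x| <= K by rewrite (le_trans (ler_normB _ _))// lerD2r.
have K0 : 0 <= K by apply: le_trans (vK point).
(* Along squares the Chebyshev bounds are of order [1 / j^2], hence summable. Between consecutive
   squares there are at most [2 j.+1 + 1] terms, each bounded by [K], which is negligible against
   [j.+1^2]. *)
pose N j := (j.+1 ^ 2)%N.
pose S n w := \sum_(i < n) v (X i w).
pose E j := [set w | (N j)%:R * (eps / 2) <= `|S (N j) w|].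
have mE j : measurable (E j).
  apply: (@measurable_set_ge _ _ _ (fun w => `|S (N j) w|)).
  by apply: measurableT_comp => //; exact: measurable_sum_law.
have I2 : 0 <= \int[P]_x (v x ^+ 2) by apply: Rintegral_ge0 => x _; exact: sqr_ge0.
pose C := (\int[P]_x (v x ^+ 2)) * 4 / eps ^+ 2.
have C0 : 0 <= C by rewrite divr_ge0 ?sqr_ge0// mulr_ge0.
have PE j : (P0 (E j) <= (C * (j.+1%:R ^+ 2)^-1)%:E)%E.
  have N0 : 0 < (N j)%:R :> R by rewrite ltr0n expn_gt0.
  apply: le_trans (law_sum_chebyshev iidX (N j) mv vK v0 _) _.
    by rewrite mulr_gt0// divr_gt0.
  rewrite lee_fin le_eqVlt; apply/orP; left; apply/eqP.
  rewrite /C /N natrX; field.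
  by rewrite !gt_eqF.
have sE : (\sum_(j <oo) P0 (E j) < +oo)%E.
  apply: (@le_lt_trans _ _ (C * 2)%:E); last exact: ltry.
  apply: nneseries_le_bound => // n; rewrite big_mkord.
  apply: (@le_trans _ _ (\sum_(j < n) (C * (j.+1%:R ^+ 2)^-1)%:E)%E); first exact: lee_sum.
  by rewrite sumEFin lee_fin -mulr_sumr ler_wpM2l// sum_inv_sqr_le.
have := ae_not_limsup mE sE; apply: filterS => w [J _ hJ].
(* From here on [12 K <= j.+1 eps], so the incomplete block contributes at most
   [3 j.+1 K <= j.+1^2 eps / 4]. *)
pose J0 := maxn J (Num.truncn (12 * K / eps)).+1.
exists (J0.+1 ^ 2)%N => // n /= nJ.
have n0 : (0 < n)%N by apply: leq_trans nJ; rewrite expn_gt0.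
have [j /andP[jn nj]] := exists_square n0.
have Jj : (J0 <= j)%N.
  have : (J0.+1 ^ 2 < j.+2 ^ 2)%N by exact: leq_ltn_trans nj.
  by rewrite ltn_sqr.
have -> : \sum_(i < n) u (X i w) - n%:R * m = S n w.
  by rewrite /S /v sumrB sumr_const card_ord -[m *+ n]mulr_natl.
rewrite /S (@sumr_ord_cat (fun i => v (X i w)) (N j) n)//.
have h1 : `|S (N j) w| <= (N j)%:R * (eps / 2).
  rewrite ltW// ltNge; apply/negP; apply: (hJ j) => /=.
  by apply: leq_trans Jj; exact: leq_maxl.
have h2 : `|\sum_(N j <= i < n) v (X i w)| <= (2 * j.+1%:R + 1) * K.
  rewrite (le_trans (ler_norm_sum _ _ _))//.
  apply: (@le_trans _ _ (\sum_(N j <= i < n) K)); first by apply: ler_sum.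
  rewrite sumr_const_nat -[K *+ _]mulr_natl ler_wpM2r//.
  rewrite -natrM natr1 ler_nat.
  by move: nj; rewrite /N !expnS expn0; lia.
have j1 : 1 <= j.+1%:R :> R by rewrite ler1n.
have h3 : 12 * K <= j.+1%:R * eps.
  rewrite -ler_pdivrMr//; apply: (@le_trans _ _ (Num.truncn (12 * K / eps)).+1%:R).
    by rewrite ltW// Num.Theory.truncnS_gt.
  rewrite ler_nat; apply: leq_trans (leqnSn _); apply: leq_trans Jj; exact: leq_maxr.
have h4 : (N j)%:R <= n%:R :> R by rewrite ler_nat.
rewrite (le_trans (ler_normD _ _))// (le_trans (lerD h1 h2))//.
apply: (@le_trans _ _ ((N j)%:R * eps)); last by rewrite ler_wpM2r// ltW.
move: h3 j1; rewrite /N natrX; set x := j.+1%:R => h3 j1; nra.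
Qed.

(* Up to time 2^m, truncate f at 2^m. The truncated second moments, weighted by
   2^-m, and the probabilities of exceeding the truncation are summable by
   [sum_min_dyadic_le]; monotonicity of the sums fills the gaps between dyadic
   times. *)
Lemma slln_tail (f : T -> R) (eps : R) : P.-integrable setT (EFin \o f) ->
  (forall x, 0 <= f x) -> \int[P]_x f x <= eps -> 0 < eps ->
  {ae P0, forall w, \forall n \near \oo,
    \sum_(i < n) f (X i w) <= n%:R * (4 * eps)}.
Proof.
move=> If f0 fe e0.
have mf : measurable_fun setT f by apply/measurable_EFinP; exact: measurable_int If.
(* [q m] controls both sources of error: [2^m] times the indicator of [f > 2^m] is at most [q m],
   and the square of the truncated function is at most [2^m q m]. *)
pose q m x : R := Num.min (2 ^+ m) (f x ^+ 2 / 2 ^+ m).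
have p2 m : 0 < 2 ^+ m :> R by rewrite exprn_gt0.
have q0 m x : 0 <= q m x.
  by rewrite le_min (ltW (p2 m)) divr_ge0 ?sqr_ge0// ltW.
have mq m : measurable_fun setT (q m).
  apply: measurable_minr => //; apply: measurable_funM => //; exact: measurable_funX.
have qb m x : `|q m x| <= 2 ^+ m by rewrite ger0_norm// ge_min lexx.
have Iq m := integrable_bounded P (mq m) (qb m).
pose A m := [set x | 2 ^+ m < `|f x|].
have mA m : measurable (A m) by exact: measurable_norm_gt.
pose g m x := f x * \1_(~` A m) x.
have g0 m x : 0 <= g m x by rewrite mulr_ge0.
have gb m x : `|g m x| <= 2 ^+ m.
  rewrite ger0_norm// /g indicE; have [h|h] := boolP (x \in _).
    by rewrite mulr1; move: h; rewrite inE /A/= => /negP; rewrite -leNgt ger0_norm.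
  by rewrite mulr0 ltW.
have gf m x : g m x <= f x by rewrite /g ler_piMr// indicE lern1 leq_b1.
have mg m : measurable_fun setT (g m).
  by apply: measurable_funM => //; apply: measurable_indic; exact: measurableC.
have Ig m := integrable_bounded P (mg m) (gb m).
pose e m := \int[P]_x g m x.
have em m : e m <= eps by apply: le_trans fe; exact: le_RintegralT.
have em0 m : 0 <= e m by exact: Rintegral_ge0.
pose v m x := g m x - e m.
have mv m : measurable_fun setT (v m) by exact: measurable_funB.
have v0 m : \int[P]_x v m x = 0.
  by rewrite RintegralB//= ?Rintegral_prob_cst ?subrr//; exact: finite_measure_integrable_cst.
have vb m x : `|v m x| <= 2 ^+ m + eps.
  rewrite (le_trans (ler_normB _ _))// lerD//.
  by rewrite ger0_norm.
pose N m := (2 ^ m)%N.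
pose S n w := \sum_(i < n) f (X i w).
pose E m := [set w | (N m)%:R * (2 * eps) <= S (N m) w].
have mE m : measurable (E m).
  apply: (@measurable_set_ge _ _ _ (S (N m))); exact: (measurable_sum_law X (N m) mf).
pose B m := \big[setU/set0]_(i < N m) (X i @^-1` A m).
have mXA m i : measurable (X i @^-1` A m).
  by rewrite -[X in measurable X]setTI; exact: measurable_funP.
pose D m := [set w | (N m)%:R * eps <= `|\sum_(i < N m) v m (X i w)|].
have mD m : measurable (D m).
  apply: (@measurable_set_ge _ _ _ (fun w => `|\sum_(i < N m) v m (X i w)|)).
  by apply: measurableT_comp => //; exact: measurable_sum_law.
have mB m : measurable (B m) by apply: bigsetU_measurable.
have BE m : B m = \bigcup_(i in `I_(N m)) (X i @^-1` A m) by rewrite bigcup_mkord.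
(* If no observation exceeds the truncation level, the sum equals the truncated one, whose mean is
   at most [N m * eps]; exceeding twice that amount is a deviation of at least [N m * eps]. *)
have EBD m : E m `<=` B m `|` D m.
  move=> w Ew; have [Bw|Bw] := pselect (B m w); [by left|right].
  rewrite /D/=; move: Ew; rewrite /E/= => Ew.
  rewrite (le_trans _ (ler_norm _))// /v sumrB sumr_const card_ord -[e m *+ _]mulr_natl.
  suff -> : \sum_(i < N m) g m (X i w) = S (N m) w.
    have := ler_wpM2l (ler0n R (N m)) (em m); lra.
  apply: eq_bigr => i _; rewrite /g indicE mem_set ?mulr1//= => Aw.
  by apply: Bw; rewrite BE; exists (i : nat) => //=.
have PB m : (P0 (B m) <= (\int[P]_x q m x)%:E)%E.
  apply: le_trans (Boole_inequality P0 (A := fun i => X i @^-1` A m) _) _; first by [].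
  have [lawX _] := iidX.
  rewrite (eq_bigr (fun=> P (A m))); last by move=> i _; exact: lawX.
  rewrite -(fineK (fin_num_measure P _ (mA m))) sumEFin sumr_const card_ord -[_ *+ N m]mulr_natl EFinM.
  rewrite fineK ?fin_num_measure//.
  rewrite [X in (_ * X <= _)%E](_ : _ = \int[P]_x (\1_(A m) x)%:E)%E; last by rewrite integral_indic// setIT.
  have mI : measurable_fun setT (fun x => (\1_(A m) x)%:E : \bar R).
    by apply/measurable_EFinP; exact: measurable_indic.
  have I0 x : setT x -> (0 <= (\1_(A m) x)%:E :> \bar R)%E by rewrite lee_fin.
  rewrite -ge0_integralZl// EFin_Rintegral//; apply: ge0_le_integral => //.
  - exact: emeasurable_funM.
  - exact/measurable_EFinP.
  - move=> x _; rewrite -EFinM lee_fin /N natrX indicE.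
    have [h|h] := boolP (x \in _); last by rewrite mulr0.
    rewrite mulr1 le_min lexx/= ler_pdivlMr// -expr2 ler_sqr ?nnegrE ?(ltW (p2 m))//.
    by move: h; rewrite inE /A/= ger0_norm// => /ltW.
have PD m : (P0 (D m) <= ((\int[P]_x q m x) / eps ^+ 2)%:E)%E.
  have N0 : 0 < (N m)%:R :> R by rewrite ltr0n expn_gt0.
  apply: le_trans (law_sum_chebyshev iidX (N m) (mv m) (vb m) (v0 m) _) _.
    by rewrite mulr_gt0.
  rewrite lee_fin ler_pdivrMr ?exprn_gt0// ?mulr_gt0//.
  rewrite (_ : _ / _ * _ = (N m)%:R ^+ 2 * \int[P]_x q m x); last by field; rewrite gt_eqF.
  rewrite expr2 -mulrA ler_wpM2l//.
  rewrite -RintegralZl//; apply: (@le_trans _ _ (\int[P]_x (g m x ^+ 2))); last first.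
    apply: le_RintegralT.
    - apply: (@integrable_bounded _ _ _ _ _ ((2 ^+ m) ^+ 2)); first exact: measurable_funX.
      by move=> x; rewrite normrX lerXn2r ?nnegrE// ltW.
    - apply: (@integrable_bounded _ _ _ _ _ ((N m)%:R * 2 ^+ m)); first exact: measurable_funM.
      by move=> x; rewrite normrM ger0_norm// ler_wpM2l.
    - move=> x; rewrite /N natrX /q minr_pMr ?(ltW (p2 m))// le_min.
      rewrite [X in _ && (_ <= X)]mulrC divfK ?gt_eqF// -[2 ^+ m * _]expr2.
      rewrite !lerXn2r ?nnegrE ?(ltW (p2 m))//.
      by have := gb m x; rewrite ger0_norm.
  apply: (@le_trans _ _ (\int[P]_x (g m x ^+ 2 + ((- 2 * e m) * g m x + e m ^+ 2)))).
    by rewrite le_eqVlt; apply/orP; left; apply/eqP; apply: eq_Rintegral => x _; rewrite /v; ring.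
  have Ig2 : P.-integrable setT (EFin \o (fun x => g m x ^+ 2)).
    apply: (@integrable_bounded _ _ _ _ _ ((2 ^+ m) ^+ 2)); first exact: measurable_funX.
    by move=> x; rewrite normrX lerXn2r ?nnegrE// ltW.
  have Ig1 : P.-integrable setT (EFin \o (fun x => (- 2 * e m) * g m x)).
    by have := integrableZl measurableT (- 2 * e m) (Ig m); apply: eq_integrable.
  have Ic : P.-integrable setT (EFin \o (fun x : T => e m ^+ 2)).
    exact: finite_measure_integrable_cst.
  rewrite RintegralD//; last first.
    by have := integrableD measurableT Ig1 Ic; apply: eq_integrable.
  rewrite RintegralD// RintegralZl// (Rintegral_prob_cst P (e m ^+ 2)) -/(e m).
  by have := sqr_ge0 (e m); lra.
pose C := 1 + (eps ^+ 2)^-1.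
have C0 : 0 <= C by rewrite addr_ge0// invr_ge0 sqr_ge0.
have PE m : (P0 (E m) <= (C * \int[P]_x q m x)%:E)%E.
  apply: (@le_trans _ _ (P0 (B m `|` D m))).
    by apply: le_measure; rewrite ?inE//; exact: measurableU.
  apply: le_trans (measureU2 _ _ _) _ => //.
  apply: le_trans (leeD (PB m) (PD m)) _.
  by rewrite -EFinD lee_fin /C mulrDl mul1r [X in _ + X]mulrC.
have sE : (\sum_(m <oo) P0 (E m) < +oo)%E.
  apply: (@le_lt_trans _ _ (C * (4 * \int[P]_x f x))%:E); last exact: ltry.
  apply: nneseries_le_bound => // n; rewrite big_mkord.
  apply: (@le_trans _ _ (\sum_(m < n) (C * \int[P]_x q m x)%:E)%E); first exact: lee_sum.
  rewrite sumEFin lee_fin -mulr_sumr ler_wpM2l//.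
  rewrite -(@Rintegral_sum _ _ _ P _ (index_enum 'I_n) (fun m : 'I_n => q m))//.
  rewrite -RintegralZl//; apply: le_RintegralT.
  - have := @integrable_sum _ _ _ P setT measurableT _ (index_enum 'I_n) xpredT
      (fun m : 'I_n => EFin \o q m) (fun m _ => Iq m).
    by apply: eq_integrable => // x _; rewrite /= sumEFin.
  - by have := integrableZl measurableT 4 If; apply: eq_integrable.
  - by move=> x; exact: sum_min_dyadic_le.
have := ae_not_limsup mE sE; apply: filterS => w [J _ hJ].
exists (2 ^ J)%N => // n /= nJ.
have n0 : (0 < n)%N by apply: leq_trans nJ; rewrite expn_gt0.
have [j /andP[jn nj]] := exists_dyadic n0.
have Jj : (J < j.+1)%N.
  by rewrite -(ltn_exp2l (m := 2))//; exact: leq_ltn_trans nj.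
have := hJ j.+1 (ltnW Jj); rewrite /E/= => /negP; rewrite -ltNge => h.
(* The sum up to [n] is at most the sum up to [2^(j+1) <= 2 n], which turns the constant 2 of [E]
   into 4. *)
apply: (@le_trans _ _ (S (N j.+1) w)).
  by rewrite /S /N (@sumr_ord_cat (fun i => f (X i w)) n (2 ^ j.+1) (ltnW nj)) lerDl sumr_ge0.
apply: le_trans (ltW h) _.
have : (2 ^ j)%:R <= n%:R :> R by rewrite ler_nat.
rewrite /N expnS natrM; set x := (2 ^ j)%:R; nra.
Qed.

Lemma slln (f : T -> R) (eps : R) : P.-integrable setT (EFin \o f) -> 0 < eps ->
  {ae P0, forall w, \forall n \near \oo,
    `|avg (fun i : 'I_n => f (X i w)) - \int[P]_x f x| <= eps}.
Proof.
move=> If e0.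
have mf : measurable_fun setT f by apply/measurable_EFinP; exact: measurable_int If.
(* Six shares of [eps]: one for the bounded part, four for the tail by [slln_tail], one for the
   difference of the means. *)
have d0 : 0 < eps / 6 by rewrite divr_gt0.
have [M hM] := integral_tail_small If mf d0.
pose A := [set x | M%:R < `|f x|].
have mA : measurable A by exact: measurable_norm_gt.
pose u x := f x * \1_(~` A) x; pose t x := `|f x| * \1_A x.
have mu : measurable_fun setT u.
  by apply: measurable_funM => //; apply: measurable_indic; exact: measurableC.
have mt : measurable_fun setT t.
  by apply: measurable_funM; [exact: measurableT_comp|exact: measurable_indic].
have uM x : `|u x| <= M%:R.
  rewrite /u indicE; have [h|h] := boolP (x \in _); last by rewrite mulr0 normr0.
  by rewrite mulr1; move: h; rewrite inE /A/= => /negP; rewrite -leNgt.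
have fut x : `|f x - u x| <= t x.
  rewrite /u /t !indicE in_setC; case: (x \in A); rewrite /= ?mulr1 ?mulr0 ?subr0//.
  by rewrite subrr normr0.
have t0 x : 0 <= t x by exact: le_trans (fut x).
have It : P.-integrable setT (EFin \o t).
  apply: (integrable_le_norm mt _ (integrable_norm If)) => x; rewrite ger0_norm//.
  by rewrite /t/= ler_piMr// indicE lern1 leq_b1.
have Iu := integrable_bounded P mu uM.
have Efu : `|\int[P]_x f x - \int[P]_x u x| <= eps / 6.
  rewrite -RintegralB//; apply: le_trans hM.
  apply: le_trans (le_normr_Rintegral measurableT _) _.
    by have := integrableB measurableT If Iu; apply: eq_integrable.
  apply: le_RintegralT => //.
  apply: (integrable_le_norm _ _ It).
    by apply: measurableT_comp => //; exact: measurable_funB.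
  by move=> x; rewrite normr_id.
have h1 := slln_bounded mu uM d0.
have h2 := slln_tail It t0 hM d0.
near=> w.
have [N1 _ hN1] : \forall n \near \oo, `|\sum_(i < n) u (X i w) - n%:R * \int[P]_x u x| <= n%:R * (eps / 6).
  by near: w.
have [N2 _ hN2] : \forall n \near \oo, \sum_(i < n) t (X i w) <= n%:R * (4 * (eps / 6)).
  by near: w.
exists (maxn 1 (maxn N1 N2)) => // n /=; rewrite !geq_max => /andP[n0 /andP[n1 n2]].
have n0' : 0 < n%:R :> R by rewrite ltr0n.
rewrite -(ler_pM2l n0') -{1}(gtr0_norm n0') -normrM mulrBr /avg mulVKf ?gt_eqF//.
have {}hN1 := hN1 n n1; have {}hN2 := hN2 n n2.
have h3 : `|\sum_(i < n) f (X i w) - \sum_(i < n) u (X i w)| <= n%:R * (4 * (eps / 6)).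
  rewrite -sumrB; apply: le_trans (ler_norm_sum _ _ _) _; apply: le_trans hN2.
  by apply: ler_sum.
have h4 : `|n%:R * \int[P]_x f x - n%:R * \int[P]_x u x| <= n%:R * (eps / 6).
  by rewrite -mulrBr normrM gtr0_norm// ler_pM2l.
move: hN1 h3 h4; rewrite !ler_norml => /andP[a1 a2] /andP[b1 b2] /andP[c1 c2].
by apply/andP; split; lra.
Unshelve. all: by end_near. Qed.

End slln.

(** * Charges and their densities *)

Section finite_copy.
Context d (T : measurableType d) (R : realType) (m : {measure set T -> \bar R}).
Hypothesis mT : (m setT < +oo)%E.

(** The proof of finiteness is an argument, so that a finite-measure structure can be attached to a
    measure known to be finite only through a proposition. *)
Definition measure_finite_copy (_ : (m setT < +oo)%E) : set T -> \bar R := m.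
Local Notation m' := (measure_finite_copy mT).

HB.instance Definition _ := Measure.on m'.

Let m'_fin : fin_num_fun m'. Proof. exact: (lty_fin_num_fun mT). Qed.

HB.instance Definition _ := @Measure_isFinite.Build _ _ _ m' m'_fin.

End finite_copy.

Section charge_integrals.
Context d (T : measurableType d) (R : realType).

Lemma exists_charge_sub (m1 m2 : {measure set T -> \bar R}) (c : R) :
  (m1 setT < +oo)%E -> (m2 setT < +oo)%E ->
  exists G : {charge set T -> \bar R}, forall A, measurable A ->
    (G A = c%:E * (m1 A - m2 A))%E.
Proof.
move=> m1T m2T.
pose m1f : {finite_measure set T -> \bar R} := measure_finite_copy m1T.
pose m2f : {finite_measure set T -> \bar R} := measure_finite_copy m2T.
pose G1 : {charge set T -> \bar R} := charge_of_finite_measure m1f.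
pose G2 : {charge set T -> \bar R} := charge_of_finite_measure m2f.
pose G3 : {charge set T -> \bar R} := cadd G1 (cscale (-1) G2).
exists (cscale c G3) => A mA.
rewrite -[LHS]/(c%:E * (G1 A + (- 1%R)%:E * G2 A))%E EFinN mulN1e.
by [].
Qed.

Section jordan.
Variables (G : {charge set T -> \bar R}) (P N : set T).
Hypothesis GPN : hahn_decomposition G P N.

Lemma jordan_pos_measurable A : measurable A -> jordan_pos GPN A = G (A `&` P).
Proof. by move=> mA; rewrite jordan_posE cjordan_posE /crestr0 mem_set. Qed.

Lemma jordan_neg_measurable A : measurable A -> jordan_neg GPN A = (- G (A `&` N))%E.
Proof. by move=> mA; rewrite jordan_negE cjordan_negE /crestr0 mem_set. Qed.

Variables (m1 m2 : {measure set T -> \bar R}).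
Hypothesis m1T : (m1 setT < +oo)%E.
Hypothesis m2T : (m2 setT < +oo)%E.
Hypothesis GE : forall A, measurable A -> G A = (m1 A - m2 A)%E.

Let f1 : fin_num_fun m1. Proof. exact: lty_fin_num_fun. Qed.
Let f2 : fin_num_fun m2. Proof. exact: lty_fin_num_fun. Qed.

Let mP : measurable P. Proof. by have [[]] := GPN. Qed.
Let mN : measurable N. Proof. by have [_ []] := GPN. Qed.

Let pos_le A : measurable A -> (jordan_pos GPN A <= m1 A)%E.
Proof.
move=> mA; have mAP : measurable (A `&` P) by exact: measurableI.
rewrite jordan_pos_measurable// GE//; apply: (@le_trans _ _ (m1 (A `&` P))).
  by rewrite leeBlDr ?f2// leeDl.
by apply: le_measure; rewrite ?inE.
Qed.

Let neg_le A : measurable A -> (jordan_neg GPN A <= m2 A)%E.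
Proof.
move=> mA; have mAN : measurable (A `&` N) by exact: measurableI.
rewrite jordan_neg_measurable// GE// fin_num_oppeB ?f1 ?f2//.
apply: (@le_trans _ _ (m2 (A `&` N))).
  by rewrite addeC leeBlDr ?f1// leeDl.
by apply: le_measure; rewrite ?inE.
Qed.

(** The identity [G+ - G- = m1 - m2] is rearranged into sums, so that both sides are measures and
    their integrals can be compared. *)
Let balance A : measurable A ->
  measure_add (jordan_pos GPN) m2 A = measure_add m1 (jordan_neg GPN) A.
Proof.
move=> mA; rewrite !measure_addE; have := jordan_decomp GPN mA.
rewrite /cadd/= cscaleN1 GE//.
have p1 : jordan_pos GPN A \is a fin_num by rewrite fin_num_measure.
have p2 : jordan_neg GPN A \is a fin_num by rewrite fin_num_measure.
move: p1 p2 (f1 mA) (f2 mA).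
case: (jordan_pos GPN A) => //= r1 _; case: (jordan_neg GPN A) => //= r2 _.
case: (m1 A) => //= r3 _; case: (m2 A) => //= r4 _ [e]; congr _%:E; lra.
Qed.

Variable f : T -> R.
Hypothesis mf : measurable_fun setT f.
Hypothesis If1 : m1.-integrable setT (EFin \o f).
Hypothesis If2 : m2.-integrable setT (EFin \o f).

Let mef : measurable_fun setT (EFin \o f). Proof. exact/measurable_EFinP. Qed.
Let menf : measurable_fun setT (fun x => `|f x|%:E).
Proof. by apply/measurable_EFinP; exact: measurableT_comp. Qed.

Let pos_lty : (\int[jordan_pos GPN]_x (`|f x|%:E) < +oo)%E.
Proof.
apply: le_lt_trans (ge0_le_measure_integral pos_le measurableT _ menf) _ => //.
by case/integrableP : If1.
Qed.

Let neg_lty : (\int[jordan_neg GPN]_x (`|f x|%:E) < +oo)%E.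
Proof.
apply: le_lt_trans (ge0_le_measure_integral neg_le measurableT _ menf) _ => //.
by case/integrableP : If2.
Qed.

Lemma charge_variation_integral_lty :
  (\int[charge_variation GPN]_x (`|f x|%:E) < +oo)%E.
Proof.
rewrite (eq_measure_integral (measure_add (jordan_pos GPN) (jordan_neg GPN))); last first.
  by move=> A mA _; apply: esym; exact: measure_addE.
by rewrite ge0_integral_measure_add// lte_add_pinfty.
Qed.

Lemma jordan_integral_sub :
  \int[jordan_pos GPN]_x f x - \int[jordan_neg GPN]_x f x =
  \int[m1]_x f x - \int[m2]_x f x.
Proof.
have Ip : (jordan_pos GPN).-integrable setT (EFin \o f) by apply/integrableP.
have In : (jordan_neg GPN).-integrable setT (EFin \o f) by apply/integrableP.
have : (\int[measure_add (jordan_pos GPN) m2]_x (f x)%:E =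
        \int[measure_add m1 (jordan_neg GPN)]_x (f x)%:E)%E.
  by apply: eq_measure_integral => A mA _; exact: balance.
rewrite !integral_measure_add// /Rintegral.
have p1 := integrable_fin_num measurableT Ip.
have p2 := integrable_fin_num measurableT In.
have p3 := integrable_fin_num measurableT If1.
have p4 := integrable_fin_num measurableT If2.
move: p1 p2 p3 p4; rewrite /comp.
case: (\int[_]_x _)%E => //= r1 _.
case: (\int[_]_x _)%E => //= r2 _.
case: (\int[_]_x _)%E => //= r3 _.
by case: (\int[_]_x _)%E => //= r4 _ [e]; lra.
Qed.

End jordan.

Lemma charge_integral_sub (G : {charge set T -> \bar R}) (m1 m2 : {measure set T -> \bar R})
    (f : T -> R) : (m1 setT < +oo)%E -> (m2 setT < +oo)%E ->
  (forall A, measurable A -> G A = (m1 A - m2 A)%E) ->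
  measurable_fun setT f ->
  m1.-integrable setT (EFin \o f) -> m2.-integrable setT (EFin \o f) ->
  charge_integral G f = \int[m1]_x f x - \int[m2]_x f x.
Proof. by move=> m1T m2T GE mf I1 I2; exact: jordan_integral_sub. Qed.

Lemma total_variation_integral_lty (G : {charge set T -> \bar R})
    (m1 m2 : {measure set T -> \bar R})
    (f : T -> R) : (m1 setT < +oo)%E -> (m2 setT < +oo)%E ->
  (forall A, measurable A -> G A = (m1 A - m2 A)%E) ->
  measurable_fun setT f ->
  m1.-integrable setT (EFin \o f) -> m2.-integrable setT (EFin \o f) ->
  (\int[Defs.total_variation G]_x (`|f x|%:E) < +oo)%E.
Proof.
move=> m1T m2T GE mf I1 I2.
exact: (charge_variation_integral_lty (hahn G) m1T m2T GE mf I1 I2).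
Qed.

End charge_integrals.

Section densities.
Context d (T : measurableType d) (R : realType) (P : probability T R).

(** [h] need only be nonnegative almost everywhere: it coincides there with the Radon-Nikodym
    derivative of [nu], which carries the change of variables. *)
Lemma integral_density (nu : {finite_measure set T -> \bar R}) (h f : T -> R) :
  P.-integrable setT (EFin \o h) ->
  (forall A, measurable A -> nu A = \int[P]_(x in A) (h x)%:E)%E ->
  measurable_fun setT f -> P.-integrable setT (EFin \o (fun x => f x * h x)) ->
  nu.-integrable setT (EFin \o f) /\ \int[nu]_x f x = \int[P]_x (f x * h x).
Proof.
move=> Ih nuE mf Ifh.
have numu : nu `<< P.
  apply/null_content_dominatesP => A mA PA0; rewrite nuE//.
  apply: null_set_integral => //.
  by apply: measurable_funTS; exact: measurable_int Ih.
pose r := Radon_Nikodym_SigmaFinite.f nu P.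
have Ir : P.-integrable setT r by exact: Radon_Nikodym_SigmaFinite.f_integrable.
have rh : ae_eq P setT r (EFin \o h).
  apply: integral_ae_eq => //; first exact: measurable_int Ih.
  by move=> A _ mA; rewrite -nuE// (Radon_Nikodym_SigmaFinite.f_integral numu mA).
have mef : measurable_fun setT (EFin \o f) by exact/measurable_EFinP.
have mh := measurable_int _ Ih.
have mr := measurable_int _ Ir.
have menf : measurable_fun setT (fun x => `|f x|%:E).
  by apply/measurable_EFinP; exact: measurableT_comp.
have r0 x : (0 <= r x)%E by exact: Radon_Nikodym_SigmaFinite.f_ge0.
have If : nu.-integrable setT (EFin \o f).
  apply/integrableP; split => //.
  rewrite /= -(Radon_Nikodym_SigmaFinite.change_of_variables numu)//.
  have [_] := integrableP _ _ _ Ifh; apply: le_lt_trans.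
  rewrite le_eqVlt; apply/orP; left; apply/eqP.
  apply: ge0_ae_eq_integral => //.
  - exact: emeasurable_funM.
  - by apply: measurableT_comp => //; exact: measurable_int Ifh.
  - by move=> x _; rewrite mule_ge0.
  - apply: filterS rh => x /(_ I) rx _.
    have := r0 x; rewrite -/r rx /= => hx.
    by rewrite lee_fin in hx; rewrite -EFinM normrM (ger0_norm hx).
split => //; rewrite /Rintegral -(Radon_Nikodym_change_of_variables numu measurableT If).
congr fine; apply: ae_eq_integral => //.
- by apply: emeasurable_funM.
- exact: measurable_int Ifh.
have h2 := ae_eq_Radon_Nikodym_SigmaFinite numu measurableT.
apply: filterS2 rh h2 => x /(_ I) rx /(_ I) r'x _.
by rewrite -r'x -/r rx.
Qed.

(** On a Hahn decomposition [A], [B], the densities of the two Jordan parts are [g] on [A] and [- g]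
    on [B]; the two pieces recombine into [f g]. *)
Lemma charge_integral_density (G : {charge set T -> \bar R}) (g f : T -> R) :
  P.-integrable setT (EFin \o g) ->
  (forall A, measurable A -> G A = \int[P]_(x in A) (g x)%:E)%E ->
  measurable_fun setT f -> P.-integrable setT (EFin \o (fun x => f x * g x)) ->
  charge_integral G f = \int[P]_x (f x * g x) /\
  (\int[Defs.total_variation G]_x (`|f x|%:E) < +oo)%E.
Proof.
move=> Ig GE mf Ifg.
pose p : {finite_measure set T -> \bar R} := jordan_pos (hahn G).
pose q : {finite_measure set T -> \bar R} := jordan_neg (hahn G).
set A := (sval (cid (hahn_pair G))).1; set B := (sval (cid (hahn_pair G))).2.
have [[mA posA] [mB negB] AB AB0] := hahn G.
have mg : measurable_fun setT g by apply/measurable_EFinP; exact: measurable_int Ig.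
have IgA D : measurable D -> P.-integrable setT (EFin \o (fun x => g x * \1_D x)).
  move=> mD; apply: (integrable_le_norm _ _ (integrable_norm Ig)).
    by apply: measurable_funM => //; exact: measurable_indic.
  by move=> x /=; rewrite normrM ler_piMr// indicE; case: (_ \in _); rewrite ?normr1 ?normr0.
have IfgA D : measurable D -> P.-integrable setT (EFin \o (fun x => f x * (g x * \1_D x))).
  move=> mD; apply: (integrable_le_norm _ _ (integrable_norm Ifg)).
    by apply: measurable_funM => //; apply: measurable_funM => //; exact: measurable_indic.
  by move=> x /=; rewrite mulrA normrM ler_piMr// indicE; case: (_ \in _); rewrite ?normr1 ?normr0.
have gD C D : measurable C -> measurable D ->
    (\int[P]_(x in C `&` D) (g x)%:E = \int[P]_(x in C) (g x * \1_D x)%:E)%E.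
  move=> mC mD; rewrite integral_mkcondr; apply: eq_integral => x _.
  by rewrite /patch indicE; case: (x \in D); rewrite ?mulr1 ?mulr0.
have [Ip ep] : p.-integrable setT (EFin \o f) /\
    \int[p]_x f x = \int[P]_x (f x * (g x * \1_A x)).
  apply: integral_density => //; [exact: IgA| |exact: IfgA].
  by move=> C mC; rewrite -gD// -GE; [exact: jordan_pos_measurable|exact: measurableI].
have [Iq eq] : q.-integrable setT (EFin \o f) /\
    \int[q]_x f x = \int[P]_x (f x * (- g x * \1_B x)).
  apply: integral_density => //.
  - have := integrableN (IgA _ mB); apply: eq_integrable => // x _.
    by rewrite /= mulNr.
  - move=> C mC; under eq_integral do rewrite mulNr EFinN.
    rewrite integralN// -?gD// -?GE; [exact: jordan_neg_measurable|exact: measurableI|].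
    apply: integrable_add_def => //.
    exact: (integrableS measurableT mC (@subsetT _ _) (IgA _ mB)).
  - have := integrableN (IfgA _ mB); apply: eq_integrable => // x _.
    by rewrite /= mulNr mulrN.
split.
  rewrite /charge_integral -/p -/q ep eq -RintegralB//; last 2 first.
  - exact: IfgA.
  - have := integrableN (IfgA _ mB); apply: eq_integrable => // x _.
    by rewrite /= mulNr mulrN.
  apply: eq_Rintegral => x _; rewrite !indicE.
  have : (A `|` B) x by rewrite AB.
  have [xA|xA] := boolP (x \in A); have [xB|xB] := boolP (x \in B).
  - by move: xA xB; rewrite !inE => xA xB; have : (A `&` B) x by []; rewrite AB0.
  - by move=> _ /=; ring.
  - by move=> _ /=; ring.
  - by move: xA xB; rewrite !notin_setE => xA xB [].
rewrite (eq_measure_integral (measure_add p q)); last first.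
  by move=> C mC _; apply: esym; exact: measure_addE.
rewrite ge0_integral_measure_add//; last first.
  by apply/measurable_EFinP; exact: measurableT_comp.
by case/integrableP : Ip => _ Ip; case/integrableP : Iq => _ Iq; rewrite lte_add_pinfty.
Qed.

Lemma rho2_density (G : {charge set T -> \bar R}) (g : T -> R) :
  P.-integrable setT (EFin \o g) ->
  (forall A, measurable A -> G A = \int[P]_(x in A) (g x)%:E)%E ->
  rho2 P G = ((2^-1)%:E * \int[P]_x (g x ^+ 2)%:E)%E.
Proof.
move=> Ig GE; have GP : G `<< P.
  apply/null_content_dominatesP => A mA PA0; rewrite GE//.
  apply: null_set_integral => //.
  by apply: measurable_funTS; exact: measurable_int Ig.
have mg := measurable_int _ Ig.
have e : ae_eq P setT ('d G '/d P) (EFin \o g).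
  apply: integral_ae_eq => //; first exact: Radon_Nikodym_integrable.
  by move=> A _ mA; rewrite -GE// (Radon_Nikodym_integral GP mA).
rewrite /rho2 asboolT//; congr (_ * _)%E.
apply: ae_eq_integral => //.
- under eq_fun do rewrite expe2.
  by apply: emeasurable_funM; apply: measurable_int (Radon_Nikodym_integrable GP).
- apply/measurable_EFinP; apply: measurable_funX; exact/measurable_EFinP.
by apply: filterS e => x /(_ I) ex _; rewrite ex.
Qed.

Lemma rho2_lty_density (G : {charge set T -> \bar R}) : (rho2 P G < +oo)%E ->
  exists g : T -> R, [/\ P.-integrable setT (EFin \o g),
    forall A, measurable A -> (G A = \int[P]_(x in A) (g x)%:E)%E &
    P.-integrable setT (EFin \o (fun x => g x ^+ 2))].
Proof.
rewrite /rho2; case: ifPn => [/asboolP GP h|//].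
pose g x := fine ('d G '/d P x).
have gE : EFin \o g = 'd G '/d P.
  by apply/funext => x; rewrite /g /= fineK// Radon_Nikodym_fin_num.
exists g; split.
- by rewrite gE; exact: Radon_Nikodym_integrable.
- by move=> A mA; rewrite (Radon_Nikodym_integral GP mA) -gE.
apply/integrableP; split.
  apply/measurable_EFinP; apply: measurable_funX; apply/measurable_EFinP.
  by rewrite gE.
have e : (\int[P]_x ('d G '/d P) x ^+ 2)%E = (\int[P]_x `|(EFin \o (fun x => (g x ^+ 2)%R)) x|)%E.
  apply: eq_integral => x _; rewrite -gE /= ger0_norm ?sqr_ge0//.
by rewrite -e ltey; apply/eqP => h'; move: h; rewrite h' mulry gtr0_sg ?invr_gt0// mul1e ltxx.
Qed.

End densities.

(** * Square-integrable functions *)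

(** The case [D = 0] is kept because variances may vanish: a nonnegative affine function is
    constant. It serves for Cauchy-Schwarz and for the optimality conditions of the Riesz
    argument. *)
Lemma quadratic_ge0_discr {R : realFieldType} (A B D : R) : 0 <= D ->
  (forall t, 0 <= A + t * B + t ^+ 2 * D) -> B ^+ 2 <= 4 * A * D.
Proof.
rewrite le_eqVlt => /orP[/eqP <- h|D0 h].
  have [->|B0] := eqVneq B 0; first by rewrite expr0n/= mulr0.
  by have := h (- (A + 1) / B); rewrite mulr0 addr0 divfK//; lra.
have := h (- B / (2 * D)).
have -> : A + - B / (2 * D) * B + (- B / (2 * D)) ^+ 2 * D = (4 * A * D - B ^+ 2) / (4 * D).
  by field; rewrite gt_eqF.
by rewrite pmulr_lge0 ?subr_ge0// invr_gt0 mulr_gt0.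
Qed.

Section square_integrable.
Context d (T : measurableType d) (R : realType) (P : probability T R).
Implicit Types (f g h : T -> R) (a b c : R).

Definition L2 f := measurable_fun setT f /\ P.-integrable setT (EFin \o (fun x => f x ^+ 2)).
Definition ip f g : R := \int[P]_x (f x * g x).
Definition cov f g : R := ip f g - (\int[P]_x f x) * \int[P]_x g x.

Lemma integrable_scale a f : P.-integrable setT (EFin \o f) ->
  P.-integrable setT (EFin \o (fun x => a * f x)).
Proof.
move=> If; have := integrableZl measurableT a If.
by apply: eq_integrable.
Qed.

Lemma L2_mul_integrable f g : L2 f -> L2 g -> P.-integrable setT (EFin \o (fun x => f x * g x)).
Proof.
move=> [mf If] [mg Ig]; have := integrableD measurableT If Ig.
apply: (@integrable_le_norm _ _ _ _ _ (fun x => f x ^+ 2 + g x ^+ 2)).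
  exact: measurable_funM.
move=> x; rewrite normrM -(real_normK (num_real (f x))) -(real_normK (num_real (g x))).
by have := sqr_ge0 (`|f x| - `|g x|); have := sqr_ge0 (`|f x|); have := sqr_ge0 (`|g x|); nra.
Qed.

Lemma L2_bounded f (M : R) : measurable_fun setT f -> (forall x, `|f x| <= M) -> L2 f.
Proof.
move=> mf fM; split => //; apply: (@integrable_bounded _ _ _ _ _ (M ^+ 2)).
  exact: measurable_funX.
by move=> x; rewrite normrX lerXn2r ?nnegrE//; apply: le_trans (fM x).
Qed.

Lemma L2_cst c : L2 (cst c).
Proof. exact: (L2_bounded (M := `|c|)). Qed.

Lemma L2_integrable f : L2 f -> P.-integrable setT (EFin \o f).
Proof.
move=> Lf; have := L2_mul_integrable Lf (L2_cst 1).
by apply: eq_integrable => // x _; rewrite /= mulr1.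
Qed.

Lemma L2Z a f : L2 f -> L2 (fun x => a * f x).
Proof.
move=> [mf If]; split; first exact: measurable_funM.
have := integrableZl measurableT (a ^+ 2) If.
by apply: eq_integrable => // x _; rewrite /= -EFinM exprMn.
Qed.

Lemma L2D f g : L2 f -> L2 g -> L2 (fun x => f x + g x).
Proof.
move=> Lf Lg; have Ifg := L2_mul_integrable Lf Lg; move: Lf Lg => [mf If] [mg Ig].
split; first exact: measurable_funD.
have := integrableD measurableT (integrableD measurableT If (integrableZl measurableT 2 Ifg)) Ig.
by apply: eq_integrable => // x _; rewrite /= -EFinM -!EFinD; congr _%:E; ring.
Qed.

Lemma L2B f g : L2 f -> L2 g -> L2 (fun x => f x - g x).
Proof.
move=> Lf Lg; have := L2D Lf (L2Z (- 1) Lg); congr L2.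
by apply/funext => x; rewrite mulN1r.
Qed.

Lemma ipC f g : ip f g = ip g f.
Proof. by apply: eq_Rintegral => x _; rewrite mulrC. Qed.

Lemma ip_linl a f b g h : L2 f -> L2 g -> L2 h ->
  ip (fun x => a * f x + b * g x) h = a * ip f h + b * ip g h.
Proof.
move=> Lf Lg Lh; rewrite /ip.
have I1 := L2_mul_integrable Lf Lh; have I2 := L2_mul_integrable Lg Lh.
rewrite -!RintegralZl// -RintegralD//; last 2 first.
- exact: integrable_scale.
- exact: integrable_scale.
by apply: eq_Rintegral => x _; rewrite mulrDl !mulrA.
Qed.

Lemma Rintegral_lin a f b g : P.-integrable setT (EFin \o f) -> P.-integrable setT (EFin \o g) ->
  \int[P]_x (a * f x + b * g x) = a * (\int[P]_x f x) + b * \int[P]_x g x.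
Proof.
by move=> If Ig; rewrite RintegralD ?RintegralZl//; exact: integrable_scale.
Qed.

Lemma cov_linl a f b g h : L2 f -> L2 g -> L2 h ->
  cov (fun x => a * f x + b * g x) h = a * cov f h + b * cov g h.
Proof.
move=> Lf Lg Lh; rewrite /cov ip_linl// Rintegral_lin; [ring|exact: L2_integrable..].
Qed.

Lemma covC f g : cov f g = cov g f.
Proof. by rewrite /cov ipC mulrC. Qed.

Lemma ip_lin a f b g : L2 f -> L2 g ->
  ip (fun x => a * f x + b * g x) (fun x => a * f x + b * g x) =
  a ^+ 2 * ip f f + 2 * a * b * ip f g + b ^+ 2 * ip g g.
Proof.
move=> Lf Lg; have L := L2D (L2Z a Lf) (L2Z b Lg).
rewrite ip_linl// [X in a * X + _]ipC [X in _ + b * X = _]ipC !ip_linl// (ipC g f); ring.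
Qed.

Lemma cov_lin a f b g : L2 f -> L2 g ->
  cov (fun x => a * f x + b * g x) (fun x => a * f x + b * g x) =
  a ^+ 2 * cov f f + 2 * a * b * cov f g + b ^+ 2 * cov g g.
Proof.
move=> Lf Lg; have L := L2D (L2Z a Lf) (L2Z b Lg).
rewrite cov_linl// [X in a * X + _]covC [X in _ + b * X = _]covC !cov_linl// (covC g f); ring.
Qed.

Lemma ip_ge0 f : 0 <= ip f f.
Proof. by apply: Rintegral_ge0 => x _; rewrite -expr2 sqr_ge0. Qed.

Lemma cauchy_schwarz f g : L2 f -> L2 g -> ip f g ^+ 2 <= ip f f * ip g g.
Proof.
move=> Lf Lg.
have h : (2 * ip f g) ^+ 2 <= 4 * ip f f * ip g g.
  apply: quadratic_ge0_discr => [|t]; first exact: ip_ge0.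
  have := ip_ge0 (fun x => 1 * f x + t * g x); rewrite ip_lin//; lra.
lra.
Qed.

Definition center f := fun x => f x - \int[P]_x f x.

Lemma L2_center f : L2 f -> L2 (center f).
Proof. by move=> Lf; exact: (L2B Lf (L2_cst _)). Qed.

Lemma Rintegral_center f : L2 f -> \int[P]_x center f x = 0.
Proof.
move=> Lf; rewrite RintegralB//; last 2 first.
- exact: L2_integrable.
- exact: L2_integrable (L2_cst _).
by rewrite (Rintegral_prob_cst P) subrr.
Qed.

Lemma ip_centerr f g : L2 f -> L2 g -> ip f (center g) = cov f g.
Proof.
move=> Lf Lg; rewrite ipC /center.
have -> : (fun x => g x - \int[P]_x g x) = (fun x => 1 * g x + (- \int[P]_x g x) * cst 1 x).
  by apply/funext => x; rewrite mul1r mulr1.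
rewrite ip_linl//; last exact: L2_cst.
rewrite mul1r ipC /cov mulNr; congr (_ - _); rewrite mulrC; congr (_ * _).
by apply: eq_Rintegral => x _; rewrite mul1r.
Qed.

Lemma cov_ge0 f : L2 f -> 0 <= cov f f.
Proof.
move=> Lf; rewrite -ip_centerr// -(_ : ip (center f) (center f) = ip f (center f)) ?ip_ge0//.
rewrite {1}/center.
have -> : (fun x => f x - \int[P]_x f x) = (fun x => 1 * f x + (- \int[P]_x f x) * cst 1 x).
  by apply/funext => x; rewrite mul1r mulr1.
have Lc := L2_center Lf.
rewrite ip_linl//; last exact: L2_cst.
rewrite (_ : ip (cst 1) (center f) = 0) ?mulr0 ?addr0 ?mul1r//.
by rewrite -(Rintegral_center Lf); apply: eq_Rintegral => x _; rewrite mul1r.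
Qed.

Lemma ip_center f : L2 f -> ip (center f) (center f) = cov f f.
Proof.
move=> Lf; rewrite ip_centerr//; last exact: L2_center.
have -> : center f = (fun x => 1 * f x + (- \int[P]_x f x) * cst 1 x).
  by apply/funext => x; rewrite mul1r mulr1.
rewrite cov_linl//; last exact: L2_cst.
rewrite (_ : cov (cst 1) f = 0) ?mulr0 ?addr0 ?mul1r//.
rewrite /cov (Rintegral_prob_cst P) mul1r (_ : ip _ _ = \int[P]_x f x) ?subrr//.
by apply: eq_Rintegral => x _; rewrite mul1r.
Qed.

Definition norm2 f := Num.sqrt (ip f f).

Lemma norm2_sqr f : norm2 f ^+ 2 = ip f f.
Proof. by rewrite sqr_sqrtr// ip_ge0. Qed.

Lemma ip_le_norm2 f g : L2 f -> L2 g -> `|ip f g| <= norm2 f * norm2 g.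
Proof.
move=> Lf Lg; rewrite -[leRHS]ger0_norm ?mulr_ge0 ?sqrtr_ge0//.
rewrite -ler_sqr ?nnegrE// !real_normK ?num_real// exprMn !norm2_sqr.
exact: cauchy_schwarz.
Qed.

Lemma norm2D f g : L2 f -> L2 g -> norm2 (fun x => f x + g x) <= norm2 f + norm2 g.
Proof.
move=> Lf Lg; rewrite -ler_sqr ?nnegrE ?addr_ge0 ?sqrtr_ge0// norm2_sqr.
have -> : ip (fun x => f x + g x) (fun x => f x + g x) = ip f f + 2 * ip f g + ip g g.
  have := ip_lin 1 1 Lf Lg; rewrite !expr1n !mul1r !mulr1 => <-.
  by congr ip; apply/funext => x; rewrite !mul1r.
have := ip_le_norm2 Lf Lg; rewrite ler_norml => /andP[_ h].
by rewrite sqrrD !norm2_sqr; lra.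
Qed.

End square_integrable.

Lemma measurable_fun_limn_einf d (T : measurableType d) (R : realType)
    (f : nat -> T -> \bar R) : (forall n, measurable_fun setT (f n)) ->
  measurable_fun setT (fun x => limn_einf (f ^~ x)).
Proof.
move=> mf; rewrite (_ : (fun x => _) = (fun x => - limn_esup (fun m => - f m x))%E).
  apply: measurableT_comp => //; apply: measurable_fun_limn_esup => m.
  exact: measurableT_comp.
by apply/funext => x; rewrite (limn_esupN (f ^~ x)) oppeK.
Qed.

(** * Completeness of the space of square-integrable functions *)

Section L2_completeness.
Context d (T : measurableType d) (R : realType) (P : probability T R).
Variables (h : nat -> T -> R) (C : R).
Hypothesis Lh : forall n, L2 P (h n).
Hypothesis C0 : 0 <= C.
Hypothesis hC : forall n,
  ip P (fun x => h n.+1 x - h n x) (fun x => h n.+1 x - h n x) <= C * (4 ^+ n)^-1.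

Let dist (f g : T -> R) := ip P (fun x => f x - g x) (fun x => f x - g x).

Let mh n : measurable_fun setT (h n). Proof. by have [] := Lh n. Qed.

(** By [(x + y)^2 <= 2 x^2 + 2 y^2]. The constant [4 C] is the fixed point of the resulting
    recursion: [2 C + 2 (4 C) / 4 = 4 C]. *)
Let dist_tail n j : dist (h (n + j)%N) (h n) <= 4 * C * (4 ^+ n)^-1.
Proof.
elim: j n => [|j IH] n.
  rewrite addn0 /dist (_ : ip _ _ _ = 0).
    by rewrite !mulr_ge0 ?invr_ge0 ?exprn_ge0.
  rewrite /ip -(Rintegral_prob_cst P 0); apply: eq_Rintegral => x _.
  by rewrite subrr mulr0.
have L1 : L2 P (fun x => h n.+1 x - h n x) by exact: L2B.
have L2' : L2 P (fun x => h (n + j.+1)%N x - h n.+1 x) by exact: L2B.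
have h1 := IH n.+1; rewrite addSnnS in h1.
apply: (@le_trans _ _ (2 * dist (h n.+1) (h n) + 2 * dist (h (n + j.+1)%N) (h n.+1))).
  have e := ip_lin 1 1 L1 L2'.
  have e' := ip_ge0 P (fun x => 1 * (h n.+1 x - h n x) + (-1) * (h (n + j.+1)%N x - h n.+1 x)).
  rewrite ip_lin// in e'.
  rewrite /dist (_ : (fun x => h (n + j.+1)%N x - h n x) =
    fun x => 1 * (h n.+1 x - h n x) + 1 * (h (n + j.+1)%N x - h n.+1 x)).
    by rewrite e; lra.
  by apply/funext => x; ring.
have := hC n; rewrite -/(dist _ _) exprS invfM in h1 * => h2.
have := mulr_ge0 C0 (_ : 0 <= (4 ^+ n)^-1 :> R); rewrite invr_ge0 exprn_ge0// => /(_ isT) h3.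
move: h1 h2 h3; set q := (4 ^+ n)^-1; lra.
Qed.

(** From [|y| <= e / 2 + y^2 / (2 e)] with [e = 2^-n], which balances the two terms. *)
Let dist1 n : \int[P]_x `|h n.+1 x - h n x| <= (1 + C) / 2 * (2 ^+ n)^-1.
Proof.
have L1 : L2 P (fun x => h n.+1 x - h n x) by exact: L2B.
have I1 := L2_mul_integrable L1 L1.
have p2 : 0 < 2 ^+ n :> R by rewrite exprn_gt0.
apply: (@le_trans _ _ (\int[P]_x ((2 ^+ n)^-1 / 2 * cst 1 x +
    2 ^+ n / 2 * ((h n.+1 x - h n x) * (h n.+1 x - h n x))))).
  apply: le_RintegralT.
  - exact: integrable_norm (L2_integrable L1).
  - have := integrableD measurableT
      (integrable_scale ((2 ^+ n)^-1 / 2) (L2_integrable (L2_cst P 1)))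
      (integrable_scale (2 ^+ n / 2) I1).
    by apply: eq_integrable.
  - move=> x; set y := h n.+1 x - h n x.
    rewrite -subr_ge0.
    have -> : (2 ^+ n)^-1 / 2 * cst 1 x + 2 ^+ n / 2 * (y * y) - `|y| =
       2 ^+ n / 2 * (`|y| - (2 ^+ n)^-1) ^+ 2.
      rewrite -expr2 -(real_normK (num_real y)) /cst; field.
      by rewrite gt_eqF.
    by rewrite mulr_ge0 ?sqr_ge0// divr_ge0// ltW.
rewrite Rintegral_lin//; last exact: L2_integrable (L2_cst P 1).
rewrite (Rintegral_prob_cst P 1) mulr1 -/(ip P _ _).
have h1 := ler_wpM2l (_ : 0 <= 2 ^+ n / 2) (hC n).
apply: (@le_trans _ _ ((2 ^+ n)^-1 / 2 + 2 ^+ n / 2 * (C * (4 ^+ n)^-1))).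
  by rewrite lerD2l h1// divr_ge0// ltW.
have -> : 4 ^+ n = 2 ^+ n * 2 ^+ n :> R by rewrite -exprMn; congr (_ ^+ _); ring.
by rewrite le_eqVlt; apply/orP; left; apply/eqP; field; rewrite gt_eqF.
Qed.

Let sum_geometric n : \sum_(i < n) (2 ^+ i)^-1 <= 2 :> R.
Proof.
suff : \sum_(i < n) (2 ^+ i)^-1 = 2 - 2 * (2 ^+ n)^-1 :> R.
  by move=> ->; rewrite gerBl mulr_ge0// invr_ge0 exprn_ge0.
elim: n => [|n IH]; first by rewrite big_ord0 expr0 invr1; lra.
by rewrite big_ord_recr/= IH exprS invfM; field; rewrite expf_neq0.
Qed.

(** By [dist1] the series of the [|h_(n+1) - h_n|] has a finite integral, so it converges almost
    everywhere and [h] converges by telescoping. *)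
Let ae_cvg : {ae P, forall x, cvgn (h ^~ x)}.
Proof.
pose u n x := `|h n.+1 x - h n x|.
have mu n : measurable_fun setT (u n).
  by apply: measurableT_comp => //; exact: measurable_funB.
have meu n : measurable_fun setT (fun x => (u n x)%:E) by exact/measurable_EFinP.
have Iu n : P.-integrable setT (EFin \o u n).
  exact: (integrable_norm (L2_integrable (L2B (Lh n.+1) (Lh n)))).
pose s x := (\sum_(n <oo) (u n x)%:E)%E.
have s0 x : (0 <= s x)%E by apply: nneseries_ge0 => n _ _; rewrite lee_fin normr_ge0.
have Is : P.-integrable setT s.
  apply/integrableP; split.
    by apply: ge0_emeasurable_sum => // n x _ _; rewrite lee_fin normr_ge0.
  under eq_integral do rewrite gee0_abs//.
  rewrite integral_nneseries//; last by move=> n x _; rewrite lee_fin normr_ge0.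
  apply: (@le_lt_trans _ _ ((1 + C) / 2 * 2)%:E); last exact: ltry.
  apply: nneseries_le_bound => [n|n].
    by apply: integral_ge0 => x _; rewrite lee_fin normr_ge0.
  rewrite big_mkord; under eq_bigr do rewrite -EFin_Rintegral//.
  rewrite sumEFin lee_fin.
  apply: (@le_trans _ _ (\sum_(i < n) (1 + C) / 2 * (2 ^+ i)^-1)).
    by apply: ler_sum => i _; exact: dist1.
  by rewrite -mulr_sumr ler_wpM2l// divr_ge0//; move: C0; lra.
apply: filterS (integrable_ae measurableT Is) => x /(_ I) sx.
have cu : cvgn (series (u ^~ x)).
  apply: nondecreasing_is_cvgn.
    by apply: nondecreasing_series => n _ _; exact: normr_ge0.
  exists (fine (s x)) => _ [n _ <-]; rewrite -lee_fin fineK// /series/= -sumEFin.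
  by apply: nneseries_lim_ge => k _ _; rewrite lee_fin normr_ge0.
have : cvgn (series (fun n => h n.+1 x - h n x)) by exact: normed_cvg.
move=> cv; have : cvgn (series (fun n => h n.+1 x - h n x) \+ cst (h 0%N x)).
  by apply: is_cvgD => //; exact: is_cvg_cst.
rewrite (_ : series _ \+ _ = h ^~ x)//; apply/funext => n.
by rewrite /series /= telescope_sumr// subrK.
Qed.

Lemma L2_complete : exists g, L2 P g /\ forall n,
  ip P (fun x => h n x - g x) (fun x => h n x - g x) <= 4 * C * (4 ^+ n)^-1.
Proof.
(* The upper limit is measurable and defined everywhere; it is the limit off a null set. *)
pose g x := fine (limn_esup (fun n => (h n x)%:E)).
have mg : measurable_fun setT g.
  apply: measurableT_comp => //; apply: measurable_fun_limn_esup => n.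
  exact/measurable_EFinP.
have hg : {ae P, forall x, h n x @[n --> \oo] --> g x}.
  apply: filterS ae_cvg => x cx.
  have -> : g x = limn (h ^~ x); last exact: cx.
  have cE : (h n x)%:E @[n --> \oo] --> (limn (h ^~ x))%:E.
    by apply: cvg_EFin => //; exact: nearW.
  by rewrite /g; have [_ ->] := cvg_limn_einf_sup cE.
(* Fatou's lemma passes the bound of [dist_tail] to the limit. *)
have key n : (\int[P]_x ((h n x - g x) ^+ 2)%:E <= (4 * C * (4 ^+ n)^-1)%:E)%E.
  pose f m x := ((h n x - h m x) ^+ 2)%:E.
  have mf m : measurable_fun setT (f m).
    by apply/measurable_EFinP; apply: measurable_funX; exact: measurable_funB.
  have f0 m x : setT x -> (0 <= f m x)%E by rewrite lee_fin sqr_ge0.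
  have -> : (\int[P]_x ((h n x - g x) ^+ 2)%:E = \int[P]_x limn_einf (f ^~ x))%E.
    apply: ae_eq_integral => //.
    - by apply/measurable_EFinP; apply: measurable_funX; exact: measurable_funB.
    - exact: measurable_fun_limn_einf.
    - apply: filterS hg => x hx _.
      have [//|->//] := @cvg_limn_einf_sup _ (f ^~ x) ((h n x - g x) ^+ 2)%:E.
      apply: cvg_EFin; first exact: nearW.
      rewrite /comp /f /= expr2; under eq_fun do rewrite expr2.
      by apply: cvgM; apply: cvgB => //; exact: cvg_cst.
  apply: le_trans (fatou P measurableT mf f0) _.
  have b m : (n <= m)%N -> (\int[P]_x f m x <= (4 * C * (4 ^+ n)^-1)%:E)%E.
    move=> nm; have L1 : L2 P (fun x => h n x - h m x) by exact: L2B.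
    rewrite /f -EFin_Rintegral; last by case: L1.
    rewrite lee_fin; have := dist_tail n (m - n); rewrite subnKC//.
    apply: le_trans; rewrite le_eqVlt; apply/orP; left; apply/eqP.
    by apply: eq_Rintegral => x _; ring.
  rewrite limn_einf_lim; apply: lime_le; first exact: is_cvg_einfs.
  exists n => // m /= nm; apply: le_trans (b m nm).
  by apply: ereal_inf_lbound; exists m => /=.
have Lhg n : L2 P (fun x => h n x - g x).
  split; first exact: measurable_funB.
  apply/integrableP; split; first by apply/measurable_EFinP; apply: measurable_funX; exact: measurable_funB.
  apply: le_lt_trans (ltry (4 * C * (4 ^+ n)^-1)); apply: le_trans (key n).
  rewrite le_eqVlt; apply/orP; left; apply/eqP; apply: eq_integral => x _.
  by rewrite /= ger0_norm// sqr_ge0.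
exists g; split.
  have := L2B (Lh 0) (Lhg 0%N); congr L2; apply/funext => x; ring.
move=> n; have := key n; rewrite -EFin_Rintegral; last by case: (Lhg n).
rewrite lee_fin; apply: le_trans.
by rewrite le_eqVlt; apply/orP; left; apply/eqP; apply: eq_Rintegral => x _; rewrite expr2.
Qed.

End L2_completeness.

Lemma le_add_geometric {R : realType} (x y K : R) :
  (forall n, x <= y + K * (2 ^+ n)^-1) -> x <= y.
Proof.
move=> h; rewrite leNgt; apply/negP => yx.
have K0 : 0 < K by have := h 0%N; rewrite expr0 invr1 mulr1; lra.
pose m := (Num.truncn (K / (x - y))).+1.
have m1 : K / (x - y) < m%:R by exact: Num.Theory.truncnS_gt.
have m2 : m%:R <= 2 ^+ m :> R.
  by rewrite -natrX ler_nat ltnW// ltn_expl.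
have p : 0 < 2 ^+ m :> R by rewrite exprn_gt0.
have := h m; rewrite leNgt => /negP; apply.
rewrite -ltrBrDl ltr_pdivrMr// mulrC -ltr_pdivrMr ?subr_gt0//.
exact: lt_le_trans m2.
Qed.

Lemma inv4X {R : realFieldType} n : (4 ^+ n)^-1 = (2 ^+ n)^-1 ^+ 2 :> R.
Proof. by rewrite exprVn -exprM mulnC exprM; congr (_ ^+ _)^-1; ring. Qed.

Section combinations.
Context {R : realType} (I : Type).
Implicit Types (s t : seq (R * I)) (a b : R).

(* Formal linear combinations are used in place of a quotient, so that a linear
   functional on the span is just a function l on the index set. *)
Definition lcomb (l : I -> R) s := \sum_(p <- s) p.1 * l p.2.

Definition lscale a s := [seq (a * p.1, p.2) | p <- s].

Lemma lcomb_lin l a s b t :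
  lcomb l (lscale a s ++ lscale b t) = a * lcomb l s + b * lcomb l t.
Proof.
rewrite /lcomb big_cat /lscale !big_map/= !mulr_sumr.
by congr (_ + _); apply: eq_bigr => p _; rewrite mulrA.
Qed.

Definition fcomb (T : Type) (F : I -> T -> R) s := fun x => lcomb (F ^~ x) s.

Lemma fcomb_lin (T : Type) (F : I -> T -> R) a s b t :
  fcomb F (lscale a s ++ lscale b t) = fun x => a * fcomb F s x + b * fcomb F t x.
Proof. by apply/funext => x; exact: lcomb_lin. Qed.

End combinations.

(** * Representation of functionals dominated by the standard deviation *)

Section riesz.
Context d (T : measurableType d) (R : realType) (P : probability T R).
Variables (I : Type) (F : I -> T -> R) (l : I -> R) (c : R).
Hypothesis LF : forall i, L2 P (F i).
Hypothesis c0 : 0 <= c.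

Lemma L2_fcomb s : L2 P (fcomb F s).
Proof.
elim: s => [|p s IH].
  by have := L2_cst P 0; congr L2; apply/funext => x; rewrite /fcomb /lcomb big_nil.
have := L2D (L2Z p.1 (LF p.2)) IH; congr L2; apply/funext => x.
by rewrite /fcomb /lcomb big_cons.
Qed.

Hypothesis l_le : forall s, lcomb l s <= Num.sqrt (c * cov P (fcomb F s) (fcomb F s)).

(* The representing function is the limit of a minimizing sequence of
   V s / 2 - l s, where V is the variance. *)
Let V s := cov P (fcomb F s) (fcomb F s).
Let V0 s : 0 <= V s. Proof. by apply: cov_ge0; exact: L2_fcomb. Qed.
Let J s := V s / 2 - lcomb l s.

Let J_lin a s b t : J (lscale a s ++ lscale b t) =
  (a ^+ 2 * V s + 2 * a * b * cov P (fcomb F s) (fcomb F t) + b ^+ 2 * V t) / 2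
  - (a * lcomb l s + b * lcomb l t).
Proof.
rewrite /J {1}/V fcomb_lin cov_lin; [|exact: L2_fcomb..].
by rewrite lcomb_lin.
Qed.

(** Since [l s <= sqrt (c V s)], complete the square in [sqrt (V s)]. *)
Let J_ge s : - (c / 2) <= J s.
Proof.
have h := l_le s; rewrite /J -/(V s).
have := sqr_ge0 (Num.sqrt c - Num.sqrt (V s)).
by move: h; rewrite -/(V s) sqrtrM// sqrrB !sqr_sqrtr//; lra.
Qed.

Let A := [set J s | s in setT].
Let m := inf A.

Let hasA : has_inf A.
Proof. by split; [exists (J [::]), [::]|exists (- (c / 2)) => _ [s _ <-]]. Qed.

Let m_le s : m <= J s.
Proof. by apply: ge_inf; [case: hasA|exists s]. Qed.

Let minimizing n : {s | J s < m + (4 ^+ n)^-1}.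
Proof.
apply/cid; have e0 : 0 < (4 ^+ n)^-1 :> R by rewrite invr_gt0 exprn_gt0.
by have [_ [s _ <-] h] := inf_adherent e0 hasA; exists s.
Qed.

Let s_ n := sval (minimizing n).
Let e n : R := (2 ^+ n)^-1.
Let e0 n : 0 < e n. Proof. by rewrite invr_gt0 exprn_gt0. Qed.

Let Js n : J (s_ n) < m + e n ^+ 2.
Proof.
by rewrite /s_; case: minimizing => s /=; rewrite inv4X.
Qed.

Let phi n := fcomb F (s_ n).
Let Lphi n : L2 P (phi n). Proof. exact: L2_fcomb. Qed.

(** The parallelogram identity: [J] at the midpoint is the mean of the two values minus an eighth of
    the variance of the difference, and it is at least [m]. *)
Let step n : cov P (fun x => 1 * phi n.+1 x + (-1) * phi n x)
  (fun x => 1 * phi n.+1 x + (-1) * phi n x) <= 8 * (4 ^+ n)^-1.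
Proof.
have := m_le (lscale 2^-1 (s_ n.+1) ++ lscale 2^-1 (s_ n)).
rewrite J_lin cov_lin// -/(phi _) -/(phi _) -/(V _) -/(V _) => h.
have h1 := Js n.+1; have h2 := Js n.
have e1 : e n.+1 ^+ 2 <= e n ^+ 2.
  rewrite /e lerXn2r ?nnegrE ?(ltW (e0 _))//.
  by rewrite lef_pV2 ?posrE ?exprn_gt0// exprS; have := exprn_ge0 n (_ : 0 <= 2 :> R); lra.
rewrite inv4X -/(e n).
move: h h1 h2; rewrite /J; lra.
Qed.

(** Approximate first-order condition: [J (s_n + t F_i) >= m > J (s_n) - e n ^+ 2] for all [t] is a
    nonnegative quadratic in [t], and its discriminant gives the bound. *)
Let cov_close n i : (cov P (phi n) (F i) - l i) ^+ 2 <= 2 * e n ^+ 2 * cov P (F i) (F i).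
Proof.
have -> : 2 * e n ^+ 2 * cov P (F i) (F i) = 4 * e n ^+ 2 * (cov P (F i) (F i) / 2) by field.
apply: quadratic_ge0_discr => [|t]; first by rewrite divr_ge0// cov_ge0.
have := m_le (lscale 1 (s_ n) ++ lscale t [:: (1, i)]).
have ei : fcomb F [:: (1, i)] = F i.
  by apply/funext => x; rewrite /fcomb /lcomb big_seq1 mul1r.
have li : lcomb l [:: (1, i)] = l i by rewrite /lcomb big_seq1 mul1r.
rewrite J_lin li {2}/V ei -/(phi n); have := Js n; rewrite /J; lra.
Qed.

(** The same variation along [s_n] itself shows that [V (s_n)] nearly equals [l (s_n)], which is at
    most [sqrt (c V (s_n))]; divide by [sqrt (V (s_n))]. *)
Let V_le n : Num.sqrt (V (s_ n)) <= Num.sqrt c + 2 * e n.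
Proof.
set v := V (s_ n); set k := lcomb l (s_ n).
have v0 : 0 <= v by exact: V0.
have h : (v - k) ^+ 2 <= 4 * e n ^+ 2 * (v / 2).
  apply: quadratic_ge0_discr => [|t]; first by rewrite divr_ge0.
  have := m_le (lscale (1 + t) (s_ n) ++ lscale 0 [::]).
  by rewrite J_lin; have := Js n; rewrite /J -/v -/k; lra.
have [v00|v00] := eqVneq v 0.
  by rewrite v00 sqrtr0 addr_ge0 ?sqrtr_ge0// mulr_ge0// ltW.
have vp : 0 < Num.sqrt v by rewrite sqrtr_gt0 lt_neqAle eq_sym v00.
have k_le : k <= Num.sqrt c * Num.sqrt v by rewrite -sqrtrM//; exact: l_le.
have vk : v - k <= 2 * e n * Num.sqrt v.
  apply: le_trans (ler_norm _) _.
  rewrite -ler_sqr ?nnegrE ?mulr_ge0 ?(ltW vp) ?(ltW (e0 n))//.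
  rewrite real_normK ?num_real// exprMn sqr_sqrtr//.
  by have := mulr_ge0 (sqr_ge0 (e n)) v0; lra.
rewrite -(ler_pM2r vp) -expr2 sqr_sqrtr//; lra.
Qed.

Let h n := center P (phi n).

Lemma riesz_span : exists g, [/\ L2 P g, \int[P]_x g x = 0, ip P g g <= c &
  forall i, ip P (F i) g = l i].
Proof.
have Lh n : L2 P (h n) by exact: L2_center.
have hC n : ip P (fun x => h n.+1 x - h n x) (fun x => h n.+1 x - h n x) <= 8 * (4 ^+ n)^-1.
  apply: le_trans (step n); rewrite -ip_center; last by apply: L2D; exact: L2Z.
  rewrite (_ : (fun x => h n.+1 x - h n x) =
    center P (fun x => 1 * phi n.+1 x + -1 * phi n x))//.
  apply/funext => x; rewrite /h /center Rintegral_lin; [ring|exact: L2_integrable..].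
have [g [Lg hg]] := L2_complete Lh (ler0n R 8) hC.
have Lhg n : L2 P (fun x => g x - h n x) by exact: L2B.
(* [L2_complete] bounds the square by [4 * 8 = 32] times [e n ^+ 2], at most [(6 e n)^2]. *)
have dist n : norm2 P (fun x => g x - h n x) <= 6 * e n.
  rewrite -ler_sqr ?nnegrE ?sqrtr_ge0 ?mulr_ge0 ?(ltW (e0 n))// norm2_sqr.
  have -> : ip P (fun x => g x - h n x) (fun x => g x - h n x) =
            ip P (fun x => h n x - g x) (fun x => h n x - g x).
    by apply: eq_Rintegral => x _; ring.
  apply: le_trans (hg n) _.
  rewrite inv4X -/(e n).
  by have := sqr_ge0 (e n); lra.
have ipg f n : L2 P f -> ip P f g = ip P f (h n) + ip P f (fun x => g x - h n x).
  move=> Lf; rewrite /ip -RintegralD//; [|exact: L2_mul_integrable..].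
  by apply: eq_Rintegral => x _; ring.
have ip_close f n : L2 P f -> `|ip P f g - ip P f (h n)| <= norm2 P f * 6 * e n.
  move=> Lf; rewrite (ipg f n Lf) addrC addKr.
  apply: le_trans (ip_le_norm2 Lf (Lhg n)) _.
  by rewrite -mulrA ler_wpM2l// sqrtr_ge0.
exists g; split => //.
- have L1 := L2_cst P 1.
  have e1 f : \int[P]_x f x = ip P (cst 1) f.
    by apply: eq_Rintegral => x _; rewrite mul1r.
  rewrite e1; apply/eqP; rewrite -normr_le0.
  apply: (@le_add_geometric _ _ _ (norm2 P (cst 1) * 6)) => n; rewrite add0r.
  have := ip_close (cst 1) n L1; rewrite -(e1 (h n)) Rintegral_center// subr0.
  by [].
- rewrite -norm2_sqr -[leRHS]sqr_sqrtr// ler_sqr ?nnegrE ?sqrtr_ge0//.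
  apply: (@le_add_geometric _ _ _ 8) => n.
  have := norm2D (Lh n) (Lhg n).
  have -> : (fun x => h n x + (g x - h n x)) = g by apply/funext => x; ring.
  have : norm2 P (h n) <= Num.sqrt c + 2 * e n by rewrite /norm2 ip_center//; exact: V_le.
  by have := dist n; rewrite -/(e n); lra.
move=> i; apply/eqP; rewrite -subr_eq0 -normr_le0.
pose K := norm2 P (F i) * 6 + 2 * Num.sqrt (cov P (F i) (F i)).
apply: (@le_add_geometric _ _ _ K) => n; rewrite add0r -/(e n).
have h1 := ip_close (F i) n (LF i).
have h2 : `|ip P (F i) (h n) - l i| <= 2 * e n * Num.sqrt (cov P (F i) (F i)).
  rewrite /h ip_centerr// covC.
  rewrite -ler_sqr ?nnegrE ?mulr_ge0 ?sqrtr_ge0 ?(ltW (e0 n))//.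
  rewrite real_normK ?num_real// exprMn sqr_sqrtr ?cov_ge0//.
  apply: le_trans (cov_close n i) _.
  by have := mulr_ge0 (sqr_ge0 (e n)) (cov_ge0 (LF i)); lra.
have := ler_normD (ip P (F i) g - ip P (F i) (h n)) (ip P (F i) (h n) - l i).
rewrite addrA subrK => h3; apply: le_trans h3 _.
by rewrite /K mulrDl; lra.
Qed.

End riesz.

(** * The tau-topology *)

Lemma fmap_ultra (A B : Type) (f : A -> B) (F : set_system A) :
  UltraFilter F -> UltraFilter (f @ F).
Proof.
move=> FU; have FP : ProperFilter F by exact: ultra_proper.
split; first exact: fmap_proper_filter.
move=> G GP FG; apply/seteqP; split=> [C GC|]; last exact: FG.
have [//|h] := in_ultra_setVsetC (f @^-1` C) FU.
have GC' : G (~` C) by exact: FG.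
by have [x []] := filter_ex (filterI GC GC').
Qed.

Section tau_topology.
Context d (T : measurableType d) (R : realType) (P : probability T R).
Variable Sigma : set (T -> R).
Implicit Types (G H : Lambda0 Sigma) (f : {f | Sigma f}).

Definition pairing G f : R := charge_integral (sval G) (sval f).

Lemma tau_cvg (F : set_system (Lambda0 Sigma)) (FF : Filter F) G :
  (forall f, pairing H f @[H --> F] --> pairing G f) -> F --> G.
Proof.
move=> h.
apply: (iffRL (@cvg_sup (Lambda0 Sigma) {f | Sigma f}
  (fun f => Topological.class (initial_topology (fun G : Lambda0 Sigma =>
     charge_integral (sval G) (sval f)))) F G FF)).
move=> f A; rewrite nbhsE => -[B [[C oC <-] CG] BA].
apply: filterS BA _; apply: (h f); exact: open_nbhs_nbhs.
Qed.

Lemma exists_density_Lambda0 (g : T -> R) : (forall phi : T -> R, Sigma phi -> L2 P phi) ->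
  L2 P g -> \int[P]_x g x = 0 ->
  exists G, rho2 P (sval G) = (2^-1 * ip P g g)%:E /\ forall f, pairing G f = ip P (sval f) g.
Proof.
move=> SL2 Lg g0; have Ig := L2_integrable Lg.
have If phi : Sigma phi -> P.-integrable setT (EFin \o (fun x => phi x * g x)).
  by move=> Sf; apply: L2_mul_integrable => //; exact: SL2.
pose G0 : {charge set T -> \bar R} := induced_charge Ig.
have GE A : measurable A -> (G0 A = \int[P]_(x in A) (g x)%:E)%E by [].
have mf phi : Sigma phi -> measurable_fun setT phi by case/SL2.
have PG : G0 setT = 0%E /\ forall phi, Sigma phi ->
    (\int[Defs.total_variation G0]_x (`|phi x|%:E) < +oo)%E.
  split; first by rewrite GE// -EFin_Rintegral// g0.
  by move=> phi Sf; have [] := charge_integral_density Ig GE (mf phi Sf) (If phi Sf).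
exists (exist _ G0 PG); split => /=.
  rewrite (rho2_density Ig GE) EFinM; congr (_ * _)%E.
  rewrite -EFin_Rintegral; last by case: Lg.
  by congr _%:E; apply: eq_Rintegral => x _; rewrite expr2.
by move=> [f Sf]; rewrite /pairing /=; have [-> _] := charge_integral_density Ig GE (mf f Sf) (If f Sf).
Qed.

(** Instead of unfolding the supremum topology, let [B] be the filter generated by the
    finite-dimensional neighbourhoods of [G]. It converges to [G] by [tau_cvg], so it contains
    [Omega]. *)
Lemma interior_basis (Omega : set (Lambda0 Sigma)) G : interior Omega G ->
  exists (m : nat) (f : 'I_m -> {f | Sigma f}) (e : R), 0 < e /\
    forall H, (forall i, `|pairing H (f i) - pairing G (f i)| < e) -> Omega H.
Proof.
move=> oG.
pose N (p : {m : nat & 'I_m -> {f | Sigma f}} * {posnum R}) : set (Lambda0 Sigma) :=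
  [set H | forall i, `|pairing H (projT2 p.1 i) - pairing G (projT2 p.1 i)| < p.2%:num].
pose B := filter_from setT N.
have FB : Filter B.
  apply: filter_from_filter.
    by exists (existT _ 0%N (fun i : 'I_0 => False_rect _ (notF (valP i))), 1%:pos).
  move=> [[m1 f1] e1] [[m2 f2] e2] _ _.
  exists (existT (fun m => 'I_m -> {f | Sigma f}) (m1 + m2)%N (fun i : 'I_(m1 + m2) =>
      match fintype.split i with inl j => f1 j | inr j => f2 j end),
    (Num.min e1%:num e2%:num)%:pos) => //.
  move=> H /= h; split => i /=.
    have e : fintype.split (lshift m2 i) = inl i by exact: (unsplitK (inl i)).
    by move: (h (lshift m2 i)) => /=; rewrite e lt_min => /andP[].
  have e : fintype.split (rshift m1 i) = inr i by exact: (unsplitK (inr i)).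
  by move: (h (rshift m1 i)) => /=; rewrite e lt_min => /andP[].
have cB : B --> G.
  apply: tau_cvg => f; apply/cvgrPdist_lt => e e0.
  exists (existT _ 1%N (fun _ => f), PosNum e0) => // H /= h.
  by rewrite distrC; exact: (h ord0).
have [[[m f] e] _ h] : B Omega by exact: cB.
by exists m, f, e%:num; split.
Qed.

Lemma half_space_cover (Omega : set (Lambda0 Sigma)) (L : R) :
  (forall phi : T -> R, Sigma phi -> L2 P phi) -> 0 <= L -> (L%:E < rho2_inf P (closure Omega))%E ->
  exists (m : nat) (s : 'I_m -> seq (R * {f | Sigma f})) (e : 'I_m -> R),
    (forall i, 0 < e i) /\
    forall G, Omega G -> exists i,
      Num.sqrt (2 * L * cov P (fcomb sval (s i)) (fcomb sval (s i))) + e i <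
      lcomb (pairing G) (s i).
Proof.
move=> SL2 L0 Lrho; apply: contrapT => nocover.
have L2S (f : {f | Sigma f}) : L2 P (sval f) by case: f => f /= /SL2.
pose c (s : seq (R * {f | Sigma f})) : R :=
  Num.sqrt (2 * L * cov P (fcomb sval s) (fcomb sval s)).
pose K (p : seq (R * {f | Sigma f}) * {posnum R}) : set (Lambda0 Sigma) :=
  [set G | lcomb (pairing G) p.1 <= c p.1 + p.2%:num].
pose KK := foldr (fun p A => K p `&` A) Omega.
have KKcat l1 l2 : KK (l1 ++ l2) `<=` KK l1 `&` KK l2.
  elim: l1 => [|p l1 IH] G /=.
    move=> h; split => //; elim: l2 h => [//|q l2 IH] /= [_]; exact: IH.
  by move=> [Kp /IH [h1 h2]].
(* If some [KK l] were empty, the finite list [l] itself would be a cover. Hence the sets [KK l]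
   generate a proper filter. *)
have KK0 l : KK l !=set0.
  apply/set0P/negP => /eqP KKl; apply: nocover.
  exists (size l), (fun i => (tnth (in_tuple l) i).1), (fun i => (tnth (in_tuple l) i).2%:num).
  split => // G OG; apply: contrapT => h.
  suff : KK l G by rewrite KKl.
  have {}h i : K (tnth (in_tuple l) i) G.
    by rewrite /K/= leNgt; apply/negP => lt; apply: h; exists i.
  have {}h i : (i < size l)%N -> K (nth ([::], 1%:pos) l i) G.
    by move=> il; have := h (Ordinal il); rewrite (tnth_nth ([::], 1%:pos)).
  move: h; clear -OG; elim: l => [//|p l IH] /= h; split; first exact: (h 0%N).
  by apply: IH => i il; exact: (h i.+1).
pose F0 := filter_from setT KK.
have FF0 : ProperFilter F0.
  apply: filter_from_proper => [|l _]; last exact: KK0.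
  apply: filter_from_filter; first by exists [::].
  by move=> l1 l2 _ _; exists (l1 ++ l2).
have [U [UU F0U]] := ultraFilterLemma FF0.
have FU : ProperFilter U by exact: ultra_proper.
have FU' : Filter U by case: FU.
have UK p : U (K p).
  by apply: F0U; exists [:: p] => // G /= [].
(* Taking [f] and [- f] with slack 1 confines the pairing to a compact segment, where the image
   ultrafilter converges. *)
have bounded f :
    U [set G | - (c [:: (- 1, f)] + 1) <= pairing G f <= c [:: (1, f)] + 1].
  have h1 := UK ([:: (1, f)], PosNum ltr01); have h2 := UK ([:: (-1, f)], PosNum ltr01).
  apply: (@filterS _ U FU' _ _ _ (@filterI _ U FU' _ _ h1 h2)) => G [].
  rewrite /K/= /lcomb !big_seq1/= mul1r mulN1r => h1' h2'.
  by apply/andP; split; lra.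
have limf f : {x : R | pairing G f @[G --> U] --> x}.
  apply/cid; have := @segment_compact R (- (c [:: (- 1, f)] + 1)) (c [:: (1, f)] + 1).
  rewrite compact_ultra => /(_ (pairing^~ f @ U)) [||x [_ h]]; last by exists x.
  - exact: (fmap_ultra _ UU).
  - by apply: (@filterS _ U FU' _ _ _ (bounded f)) => G' /=; rewrite in_itv.
pose l f := sval (limf f).
have lP f : pairing G f @[G --> U] --> l f by exact: (svalP (limf f)).
have lcP s : lcomb (pairing G) s @[G --> U] --> lcomb l s.
  elim: s => [|p s IH].
    rewrite /lcomb big_nil; under eq_fun do rewrite big_nil; exact: cvg_cst.
  rewrite /lcomb big_cons; under eq_fun do rewrite big_cons.
  by apply: cvgD => //; apply: cvgM => //; exact: cvg_cst.
(* The ultrafilter lies in [K (s, e)] for every positive slack [e], so the limit functional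
   satisfies the bound without slack. *)
have l_le s : lcomb l s <= c s.
  apply/ler_addgt0Pl => e e0; rewrite addrC.
  apply: (cvgr_to_le (lcP s)); exact: (UK (s, PosNum e0)).
have [g [Lg g0 gL gl]] := riesz_span L2S (mulr_ge0 (ler0n R 2) L0) l_le.
have [G [rG Gf]] := exists_density_Lambda0 SL2 Lg g0.
have UG : U --> G.
  apply: tau_cvg => f; rewrite Gf gl; exact: lP.
have clG : closure Omega G.
  move=> B /UG UB; have UO : U Omega by apply: F0U; exists [::].
  exact: filter_ex (filterI UO UB).
have : (rho2_inf P (closure Omega) <= L%:E)%E.
  apply: (@le_trans _ _ (rho2 P (sval G))); first by apply: ereal_inf_lbound; exists G.
  by rewrite rG lee_fin; lra.
by rewrite leNgt Lrho.
Qed.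

End tau_topology.

(** * Almost sure bounds *)

Section almost_sure_bounds.
Context d (O : measurableType d) (R : realType) (P0 : probability O R).
Local Open Scope ereal_scope.

Lemma limn_einf_ge_near (u : nat -> \bar R) c :
  (\forall n \near \oo, c <= u n) -> c <= limn_einf u.
Proof.
move=> [N _ h]; rewrite limn_einf_lim; apply: lime_ge; first exact: is_cvg_einfs.
exists N => // n /= Nn; apply: le_ereal_inf_tmp => _ [m /= nm] <-.
by apply: h => /=; exact: leq_trans nm.
Qed.

Lemma le_limn_einf (u v : nat -> \bar R) : (forall n, u n <= v n) ->
  limn_einf u <= limn_einf v.
Proof.
move=> uv; rewrite !limn_einf_lim; apply: lee_lim; [exact: is_cvg_einfs..|].
apply: nearW => n; apply: le_ereal_inf_tmp => _ [m /= nm] <-.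
by apply: le_trans (uv m); apply: ereal_inf_lbound; exists m.
Qed.

Lemma prob1_ae (A : set O) : measurable A -> {ae P0, forall w, A w} -> P0 A = 1.
Proof.
move=> mA [N [mN N0 AN]]; apply/eqP; rewrite eq_le probability_le1//=.
have <- : P0 (~` N) = 1 by rewrite probability_setC// N0 sube0.
apply: le_measure; rewrite ?inE//; first exact: measurableC.
by move=> w Nw; apply: contrapT => Aw; apply: Nw; apply: AN.
Qed.

Lemma measurable_limn_einf_ge (f : nat -> O -> \bar R) c :
  (forall n, measurable_fun setT (f n)) ->
  measurable [set w | c <= limn_einf (f ^~ w)].
Proof.
move=> mf; rewrite -[X in measurable X]setTI.
by apply: emeasurable_fun_c_infty => //; exact: measurable_fun_limn_einf.
Qed.

(** [Z] may fail to be measurable. The minorant is [c] on the good events from [N0] on, and [-oo]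
    otherwise. *)
Lemma as_liminf_ge_good (Z : nat -> O -> \bar R) (E : nat -> set O) (N0 : nat) c :
  (forall n, measurable (E n)) ->
  {ae P0, forall w, \forall n \near \oo, E n w} ->
  (forall n w, (N0 <= n)%N -> E n w -> c <= Z n w) -> as_liminf_ge P0 Z c.
Proof.
move=> mE aeE EZ.
pose Delta n w := if (N0 <= n)%N && (w \in E n) then c else -oo.
have mD n : measurable_fun setT (Delta n).
  rewrite /Delta; case: (N0 <= n)%N => /=; last exact: measurable_cst.
  apply: measurable_fun_ifT => //.
  apply: (measurable_fun_bool true).
  rewrite (_ : _ @^-1` _ = E n) ?setTI//.
  by apply/seteqP; split => w /=; [exact: set_mem|exact: mem_set].
exists Delta; split => //.
  move=> n w; rewrite /Delta; case: ifPn => [/andP[Nn]|_]; last exact: leNye.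
  rewrite inE => En.
  exact: EZ.
apply: prob1_ae; first exact: measurable_limn_einf_ge.
apply: filterS aeE => w [N1 _ h]; apply: limn_einf_ge_near.
exists (maxn N0 N1) => // n /=; rewrite geq_max => /andP[n0 n1].
by rewrite /Delta n0 mem_set//=; exact: h.
Qed.

Lemma as_liminf_ge_Noo (Z : nat -> O -> \bar R) : as_liminf_ge P0 Z -oo.
Proof.
apply: (@as_liminf_ge_good _ (fun=> setT) 0%N) => //.
- by apply: aeW => w; exact: nearW.
- by move=> *; exact: leNye.
Qed.

(** The pointwise supremum of countably many minorants is again a measurable minorant, and countably
    many almost sure events hold together. *)
Lemma as_liminf_ge_sup (Z : nat -> O -> \bar R) (c_ : nat -> \bar R) c :
  (forall j, as_liminf_ge P0 Z (c_ j)) ->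
  (forall x, (forall j, c_ j <= x) -> c <= x) -> as_liminf_ge P0 Z c.
Proof.
move=> Zc c_sup.
pose D j := sval (cid (Zc j)).
have mD j n : measurable_fun setT (D j n) by rewrite /D; case: cid => ? [].
have DZ j n w : D j n w <= Z n w by rewrite /D; case: cid => ? [].
have D1 j : P0 [set w | c_ j <= limn_einf ((D j) ^~ w)] = 1 by rewrite /D; case: cid => ? [].
exists (fun n w => esups (fun j => D j n w) 0%N); split.
- by move=> n; apply: measurable_fun_esups => j; exact: mD.
- by move=> n w; apply: ge_ereal_sup => _ [j _ <-]; exact: DZ.
apply: prob1_ae.
  by apply: measurable_limn_einf_ge => n; apply: measurable_fun_esups => j; exact: mD.
have : {ae P0, forall w, forall j, c_ j <= limn_einf ((D j) ^~ w)}.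
  apply/ae_foralln => j; exists (~` [set w | c_ j <= limn_einf ((D j) ^~ w)]); split => //.
  - by apply: measurableC; apply: measurable_limn_einf_ge => n; exact: mD.
  - have mA : measurable [set w | c_ j <= limn_einf ((D j) ^~ w)] by exact: measurable_limn_einf_ge.
    have e : P0 (~` [set w | c_ j <= limn_einf ((D j) ^~ w)]) = 0.
      by rewrite probability_setC// D1 subee.
    exact: e.
apply: filterS => w h; apply: c_sup => j; apply: le_trans (h j) _.
apply: le_limn_einf => n; apply: ereal_sup_ubound; by exists j.
Qed.

End almost_sure_bounds.

(** * Almost sure behaviour of averages and maxima of the data *)

Section data_laws.
Context d (T : measurableType d) (R : realType) (P : probability T R).
Context d' (O : measurableType d') (P0 : probability O R).
Variable X : nat -> {RV P0 >-> T}.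
Hypothesis iidX : iid P0 (fun i => X i : O -> T) P.

Lemma measurable_avg (f : T -> R) n : measurable_fun setT f ->
  measurable_fun setT (fun w => avg (fun i : 'I_n => f (X i w))).
Proof.
by move=> mf; apply: measurable_funM => //; exact: (measurable_sum_law X n mf).
Qed.

Lemma slln_cov (u v : T -> R) (eps : R) : L2 P u -> L2 P v -> 0 < eps ->
  {ae P0, forall w, \forall n \near \oo,
    `|avg (fun i : 'I_n => u (X i w) * v (X i w)) -
      avg (fun i : 'I_n => u (X i w)) * avg (fun i : 'I_n => v (X i w)) - cov P u v| <= eps}.
Proof.
move=> Lu Lv e0.
set mu := \int[P]_x u x; set mv := \int[P]_x v x.
(* [K] collects the coefficients of [dl]: one for the mean of the product, one for the product of
   the two errors (which uses [dl <= 1]), then [|mu|] and [|mv|] for the mixed terms. *)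
pose K := 2 + `|mu| + `|mv|.
have K0 : 0 < K by rewrite /K; have := normr_ge0 mu; have := normr_ge0 mv; lra.
pose dl := Num.min 1 (eps / K).
have d0 : 0 < dl by rewrite lt_min ltr01 divr_gt0.
have h1 := slln iidX (L2_mul_integrable Lu Lv) d0.
have h2 := slln iidX (L2_integrable Lu) d0.
have h3 := slln iidX (L2_integrable Lv) d0.
move: h1 h2 h3; apply: filterS3 => w [N1 _ h1] [N2 _ h2] [N3 _ h3].
exists (maxn N1 (maxn N2 N3)) => // n /=; rewrite !geq_max => /andP[n1 /andP[n2 n3]].
have hC := h1 n n1; have hA := h2 n n2; have hB := h3 n n3.
rewrite -/mu in hA; rewrite -/mv in hB; rewrite /cov -/mu -/mv /ip.
set A := avg (fun i : 'I_n => u (X i w)) in hA *.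
set B := avg (fun i : 'I_n => v (X i w)) in hB *.
set C := avg (fun i : 'I_n => u (X i w) * v (X i w)) in hC *.
have -> : C - A * B - (\int[P]_x (u x * v x) - mu * mv) =
  (C - \int[P]_x (u x * v x)) - ((A - mu) * (B - mv) + (A - mu) * mv + mu * (B - mv)) by ring.
apply: le_trans (ler_normB _ _) _.
have d1 : dl <= 1 by rewrite ge_min lexx.
have dK : dl * K <= eps by rewrite -ler_pdivlMr// ge_min lexx orbT.
have t1 : `|(A - mu) * (B - mv)| <= dl * 1.
  by rewrite normrM ler_pM// (le_trans hB).
have t2 : `|(A - mu) * mv| <= dl * `|mv| by rewrite normrM ler_wpM2r.
have t3 : `|mu * (B - mv)| <= dl * `|mu| by rewrite normrM mulrC ler_wpM2r.
have t4 := ler_normD ((A - mu) * (B - mv) + (A - mu) * mv) (mu * (B - mv)).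
have t5 := ler_normD ((A - mu) * (B - mv)) ((A - mu) * mv).
by move: dK; rewrite /K; lra.
Qed.

Variable a : nat -> R.
Hypothesis a_gt0 : forall n, (0 < n)%N -> 0 < a n.
Hypothesis a_decr : forall n, (0 < n)%N -> a n.+1 <= a n.
Hypothesis a_0 : a n @[n --> \oo] --> (0 : R).

Definition max_small (f : T -> R) := forall c, 0 < c ->
  {ae P0, forall w, \forall n \near \oo, forall i : 'I_n, a n * `|f (X i w)| <= c}.

(** By Borel-Cantelli only finitely many observations are large at their own scale. The others stay
    small since [a] decreases; the finitely many exceptions are killed by [a n -> 0]. *)
Lemma max_small_tail (f : T -> R) : measurable_fun setT f ->
  (forall c, 0 < c -> (\sum_(n <oo) P [set x | (c < a n.+1 * `|f x|)%R] < +oo)%E) ->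
  max_small f.
Proof.
move=> mf sf c c0; have [lawX _] := iidX.
(* Observation [i] is numbered from 0 and first enters the sample at [n = i.+1]; this is the scale
   used for it. *)
pose B i := [set x | c < a i.+1 * `|f x|].
have mB i : measurable (B i).
  have -> : B i = [set x | c / a i.+1 < `|f x|].
    by apply/seteqP; split => x; rewrite /B/= ltr_pdivrMr ?a_gt0// mulrC.
  exact: measurable_norm_gt.
have mE i : measurable (X i @^-1` B i).
  by rewrite -[X in measurable X]setTI; exact: measurable_funP.
have sE : (\sum_(i <oo) P0 (X i @^-1` B i) < +oo)%E.
  by rewrite (eq_eseriesr (g := fun i => P (B i))) ?sf// => i _; exact: lawX.
have a_mono m n : (0 < m)%N -> (m <= n)%N -> a n <= a m.
  move=> m0; elim: n => [|n IH]; first by rewrite leqn0 => /eqP m00; rewrite m00 in m0.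
  rewrite leq_eqVlt ltnS => /orP[/eqP <-//|mn].
  apply: le_trans (IH mn); apply: a_decr; exact: leq_trans mn.
have := ae_not_limsup mE sE; apply: filterS => w [N _ hN].
pose M := \sum_(i < N) `|f (X i w)|.
have M0 : 0 <= M by exact: sumr_ge0.
have e0 : 0 < c / (M + 1) by rewrite divr_gt0//; lra.
have [N' _ hN'] : \forall n \near \oo, a n <= c / (M + 1).
  have /cvgrPdist_lt/(_ _ e0) := a_0; apply: filterS => n; rewrite sub0r normrN => h.
  by rewrite ltW// (le_lt_trans (ler_norm _)).
exists (maxn 1 N') => // n /=; rewrite geq_max => /andP[n0 nN'] i.
have [iN|Ni] := ltnP i N.
  apply: (@le_trans _ _ (c / (M + 1) * M)); last first.
    by rewrite mulrAC ler_pdivrMr; [nra|lra].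
  apply: ler_pM => //; [exact/ltW/a_gt0|exact: hN'|].
  by rewrite /M (bigD1 (Ordinal iN))//= lerDl sumr_ge0.
have := hN i Ni; rewrite /= /B/= => /negP; rewrite -leNgt; apply: le_trans.
by rewrite ler_wpM2r//; apply: a_mono.
Qed.

Lemma max_small_fcomb (I : Type) (F : I -> T -> R) (s : seq (R * I)) :
  (forall i, max_small (F i)) -> max_small (fcomb F s).
Proof.
move=> HF; elim: s => [|p s IH] c c0.
  apply: aeW => w; apply: nearW => n i.
  by rewrite /fcomb /lcomb big_nil normr0 mulr0 ltW.
pose K := `|p.1| + 1.
have K0 : 0 < K by rewrite /K; have := normr_ge0 p.1; lra.
have e0 : 0 < c / 2 / K by rewrite !divr_gt0.
have c20 : 0 < c / 2 by rewrite divr_gt0.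
move: (HF p.2 _ e0) (IH _ c20); apply: filterS2 => w [N1 _ h1] [N2 _ h2].
exists (maxn 1 (maxn N1 N2)) => // n /=; rewrite !geq_max => /andP[n0 /andP[n1 n2]] i.
have an := a_gt0 n0.
have := h1 n n1 i; have := h2 n n2 i; rewrite /fcomb /lcomb big_cons.
set y := \sum_(_ <- _) _; set z := F p.2 _ => hy hz.
have hz' : `|p.1| * (a n * `|z|) <= c / 2.
  apply: (@le_trans _ _ (K * (c / 2 / K))); last by rewrite mulrC divfK// gt_eqF.
  by apply: ler_pM => //; [rewrite mulr_ge0// ltW|rewrite /K lerDl].
have := ler_normD (p.1 * z) y; rewrite normrM => h.
apply: (@le_trans _ _ (a n * (`|p.1| * `|z| + `|y|))); first by rewrite ler_wpM2l// ltW.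
by rewrite mulrDr mulrCA; lra.
Qed.

End data_laws.

(** * Rescaled differences of measures and events of the space of measures *)

Section scaled_differences.
Context d (T : measurableType d) (R : realType).
Implicit Type (m Q : {measure set T -> \bar R}).

Lemma Rintegral_mscale (r : {nonneg R}) m (f : T -> R) :
  m.-integrable setT (EFin \o f) ->
  (mscale r m).-integrable setT (EFin \o f) /\
  \int[mscale r m]_x f x = r%:num * \int[m]_x f x.
Proof.
move=> If; have mf := measurable_int _ If.
have mpos := measurable_funepos mf; have mneg := measurable_funeneg mf.
split.
  apply/integrableP; split => //; rewrite ge0_integral_mscale//; last exact: measurableT_comp.
  by case/integrableP : If => _ h; rewrite lte_mul_pinfty// ?lee_fin.
rewrite /Rintegral [in LHS]integralE [in RHS]integralE.
rewrite !ge0_integral_mscale//.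
have [p1] := integrableP _ _ _ (integrable_funepos measurableT If).
have [p2] := integrableP _ _ _ (integrable_funeneg measurableT If).
have F1 := integrable_fin_num measurableT (integrable_funepos measurableT If).
have F2 := integrable_fin_num measurableT (integrable_funeneg measurableT If).
move=> _ _; rewrite -(fineK F1) -(fineK F2) -!EFinM -!EFinB /=; ring.
Qed.

Lemma charge_integral_of_difference (Q m : {measure set T -> \bar R})
    (G : {charge set T -> \bar R}) (a : R) (f : T -> R) :
  0 < a -> (Q setT < +oo)%E -> (m setT < +oo)%E ->
  (forall B, measurable B -> Q B - m B = a%:E * G B)%E ->
  Q.-integrable setT (EFin \o f) -> m.-integrable setT (EFin \o f) ->
  charge_integral G f = a^-1 * (\int[Q]_x f x - \int[m]_x f x) /\
  (\int[Defs.total_variation G]_x (`|f x|%:E) < +oo)%E.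
Proof.
move=> a0 QT mT QG IQ Im.
have ai0 : 0 <= a^-1 by rewrite invr_ge0 ltW.
pose Q' := mscale (NngNum ai0) Q; pose m' := mscale (NngNum ai0) m.
have [IQ' eQ] := Rintegral_mscale (NngNum ai0) IQ.
have [Im' em] := Rintegral_mscale (NngNum ai0) Im.
have Q'T : (Q' setT < +oo)%E by rewrite /Q' /mscale/= lte_mul_pinfty// lee_fin.
have m'T : (m' setT < +oo)%E by rewrite /m' /mscale/= lte_mul_pinfty// lee_fin.
have fQ : fin_num_fun Q by exact: lty_fin_num_fun.
have fm : fin_num_fun m by exact: lty_fin_num_fun.
have GE B : measurable B -> (G B = Q' B - m' B)%E.
  move=> mB; rewrite /Q' /m' /mscale/=; have := QG B mB.
  have := fin_num_measure G _ mB; have := fQ B mB; have := fm B mB.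
  case: (m B) => //= q' _; case: (Q B) => //= q _; case: (G B) => //= g _ [e].
  by rewrite -!EFinM -EFinB -mulrBr e mulKf// gt_eqF.
have mf : measurable_fun setT f by apply/measurable_EFinP; exact: measurable_int IQ.
split; last exact: (total_variation_integral_lty Q'T m'T GE mf IQ' Im').
by rewrite (charge_integral_sub Q'T m'T GE mf IQ' Im') eQ em /= mulrBr.
Qed.

End scaled_differences.

(* The measurable events of the space of measures, as a measurable type, so that
   closure of measurability under linear combinations can be borrowed from the
   library. *)
Definition measures d (T : measurableType d) (R : realType) := {measure set T -> \bar R}.

HB.instance Definition _ d (T : measurableType d) (R : realType) :=
  gen_eqMixin (@measures d T R).
HB.instance Definition _ d (T : measurableType d) (R : realType) :=
  gen_choiceMixin (@measures d T R).
HB.instance Definition _ d (T : measurableType d) (R : realType) :=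
  isPointed.Build (@measures d T R) mzero.

Section sigma_Lambda_events.
Context d (T : measurableType d) (R : realType) (Sigma : set (T -> R)).

Let D : set (measures T R) := Lambda Sigma.
Let F : set (set (measures T R)) := sigma_Lambda Sigma.
Let Y := g_sigma_algebraType F.

Let sF : sigma_algebra D F. Proof. exact: smallest_sigma_algebra. Qed.

(** [Y] carries a sigma-algebra on the whole type, [F] is one on [D]. As the former is generated by
    [F], its trace on [D] falls back into [F], so events can be built in [Y] and then cut down to
    [D]. *)
Lemma sigma_Lambda_trace (B : set Y) : measurable B -> sigma_Lambda Sigma (D `&` B).
Proof.
have [F0 FC FU] := sF.
move: B; apply: smallest_sub; last first.
  move=> B FB; rewrite setIC (_ : B `&` D = D `\` (D `\` B)).
    by apply: (FC); exact: FC.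
  by rewrite setDD setIC.
split.
- by rewrite setI0.
- move=> B FB; rewrite (_ : D `&` (setT `\` B) = D `\` (D `&` B)); first exact: FC.
  by rewrite setDIr setDv set0U setTD setDE.
- move=> A FA; rewrite setI_bigcupr; exact: FU.
Qed.

Let mD : @measurable _ Y D.
Proof.
apply: sub_sigma_algebra; have [F0 FC FU] := sF.
by rewrite -(setD0 D); exact: FC.
Qed.

Lemma measurable_Lambda_integral (f : T -> R) : Sigma f ->
  measurable_fun (D : set Y) (fun Q : Y => \int[Q : {measure set T -> \bar R}]_x f x).
Proof.
move=> Sf _ B mB; apply: sub_sigma_algebra; apply: sub_sigma_algebra.
by exists f => //; exists B.
Qed.

Lemma measurable_Lambda_lcomb (s : seq (R * {f | Sigma f})) :
  measurable_fun (D : set Y) (fun Q : Y =>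
    lcomb (fun f => \int[Q : {measure set T -> \bar R}]_x (sval f) x) s).
Proof.
elim: s => [|p s IH]; rewrite /lcomb.
  by under eq_fun do rewrite big_nil; exact: measurable_cst.
under eq_fun do rewrite big_cons.
apply: measurable_funD => //; apply: measurable_funM => //.
by apply: measurable_Lambda_integral; case: p => ? [].
Qed.

Lemma sigma_Lambda_exists_gt m (s : 'I_m -> seq (R * {f | Sigma f})) (r : 'I_m -> R) :
  sigma_Lambda Sigma [set Q | Lambda Sigma Q /\ exists i,
    r i < lcomb (fun f => \int[Q]_x (sval f) x) (s i)].
Proof.
have := @sigma_Lambda_trace (\bigcup_(i in [set: 'I_m]) (D `&` [set Q : Y |
   r i < lcomb (fun f => \int[Q : {measure set T -> \bar R}]_x (sval f) x) (s i)])).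
rewrite (_ : D `&` _ = [set Q | Lambda Sigma Q /\ exists i,
    r i < lcomb (fun f => \int[Q]_x (sval f) x) (s i)]); last first.
  apply/seteqP; split => [Q [DQ [i _ [_ h]]]|Q [DQ [i h]]]; first by split => //; exists i.
  by split => //; exists i.
apply; apply: fin_bigcup_measurable => // i _.
have := measurable_Lambda_lcomb (s i) mD (measurable_itv `]r i, +oo[).
congr measurable; apply/seteqP; split => [Q|Q] [DQ] /=; rewrite in_itv/= ?andbT; by split.
Qed.

Lemma sigma_Lambda_forall_close m (f : 'I_m -> {f | Sigma f}) (r : 'I_m -> R) (e : R) :
  sigma_Lambda Sigma [set Q | Lambda Sigma Q /\ forall i,
    `|\int[Q]_x (sval (f i)) x - r i| < e].
Proof.
have := @sigma_Lambda_trace (\bigcap_(i in [set: 'I_m]) (D `&` [set Q : Y |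
   `|\int[Q : {measure set T -> \bar R}]_x (sval (f i)) x - r i| < e])).
rewrite (_ : D `&` _ = [set Q | Lambda Sigma Q /\ forall i,
    `|\int[Q]_x (sval (f i)) x - r i| < e]); last first.
  apply/seteqP; split => [Q [DQ h]|Q [DQ h]]; first by split => // i; have [] := h i I.
  by split => [|i _]; [exact: DQ|split; [exact: DQ|exact: h]].
apply; apply: fin_bigcap_measurable => // i _.
have mh : measurable_fun (D : set Y) (fun Q : Y =>
    `|\int[Q : {measure set T -> \bar R}]_x (sval (f i)) x - r i|).
  apply: measurableT_comp => //; apply: measurable_funB => //.
  by apply: measurable_Lambda_integral; case: (f i).
have := mh mD _ (measurable_itv `]-oo, e[).
by congr measurable; apply/seteqP; split => [Q|Q] [DQ] /=; rewrite in_itv/=.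
Qed.

End sigma_Lambda_events.

(** Covariance with [b] appears instead of the integral because truncation destroys the zero mean
    and the tilting weights recentre [b]. *)
Lemma bounded_density_approx d (T : measurableType d) (R : realType) (P : probability T R)
    (m : nat) (f : 'I_m -> T -> R) (g : T -> R) (eps : R) :
  (forall i, L2 P (f i)) -> L2 P g -> \int[P]_x g x = 0 -> 0 < eps ->
  exists (b : T -> R) (M : R), [/\ 0 <= M, L2 P b, forall x, `|b x| <= M,
    forall i, `|cov P (f i) b - ip P (f i) g| <= eps & cov P b b <= ip P g g].
Proof.
move=> Lf Lg g0 e0; have mg : measurable_fun setT g by case: Lg.
pose mu i := \int[P]_x f i x.
(* [h] dominates all the integrands at once, including the terms with [mu i] that come from the mean
   of [b], so one truncation level suits every [i]. *)
pose h x := \sum_(i < m) (`|f i x * g x| + `|mu i * g x|).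
have h_ge0 x : 0 <= h x by apply: sumr_ge0 => i _; rewrite addr_ge0.
have Ifg i : P.-integrable setT (EFin \o (fun x => f i x * g x)) by exact: L2_mul_integrable.
have Ig : P.-integrable setT (EFin \o g) by exact: L2_integrable.
have Ih : P.-integrable setT (EFin \o h).
  have Ii i : P.-integrable setT (EFin \o (fun x => `|f i x * g x| + `|mu i * g x|)).
    exact: (integrableD measurableT (integrable_norm (Ifg i))
      (integrable_norm (integrable_scale (mu i) Ig))).
  have := @integrable_sum _ _ _ P setT measurableT _ (index_enum 'I_m) xpredT _ (fun i _ => Ii i).
  by apply: eq_integrable => // x _; rewrite /h /= sumEFin.
have [M hM] := integral_tail_small Ih mg e0.
pose A := [set x | M%:R < `|g x|].
have mA : measurable A by exact: measurable_norm_gt.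
pose b x := g x * (1 - \1_A x).
have bM x : `|b x| <= M%:R.
  rewrite /b indicE; have [/set_mem Ax|/negP nAx] := boolP (x \in A); first by rewrite subrr mulr0 normr0.
  by rewrite subr0 mulr1 leNgt; apply/negP => gM; apply: nAx; rewrite inE.
have m1 : measurable_fun setT (\1_A : T -> R) by exact: measurable_indic.
have mb : measurable_fun setT b by apply: measurable_funM => //; exact: measurable_funB.
have Lb : L2 P b by exact: L2_bounded bM.
have Lgb : L2 P (fun x => g x - b x) by exact: L2B.
exists b, M%:R; split => // [i|].
- have -> : cov P (f i) b - ip P (f i) g =
      \int[P]_x ((-1) * (f i x * (g x - b x)) + mu i * (g x - b x)).
    rewrite Rintegral_lin; [|exact: L2_mul_integrable|exact: L2_integrable].
    rewrite [\int[P]_x (g x - b x)]RintegralB//; last exact: L2_integrable.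
    rewrite (_ : (fun x => f i x * (g x - b x)) = (fun x => f i x * g x - f i x * b x)); last first.
      by apply/funext => x; rewrite mulrBr.
    rewrite RintegralB//; last exact: L2_mul_integrable.
    by rewrite /cov /ip g0 -/(mu i); ring.
  apply: le_trans (le_normr_Rintegral _ _) _ => //.
    have := integrableD measurableT (integrable_scale (-1) (L2_mul_integrable (Lf i) Lgb))
      (integrable_scale (mu i) (L2_integrable Lgb)).
    exact: eq_integrable.
  apply: le_trans hM.
  apply: le_RintegralT.
  - apply: integrable_norm; have := integrableD measurableT (integrable_scale (-1) (L2_mul_integrable (Lf i) Lgb))
      (integrable_scale (mu i) (L2_integrable Lgb)).
    exact: eq_integrable.
  - have mh : measurable_fun setT h by apply/measurable_EFinP; exact: measurable_int Ih.
    apply: (integrable_le_norm (g := h)) Ih.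
      by apply: measurable_funM => //; exact: measurableT_comp.
    move=> x; rewrite normrM normr_id ger0_norm ?h_ge0// [`|_|]ger0_norm//.
    by rewrite ler_piMr// indicE lern1 leq_b1.
  - move=> x; rewrite /b (_ : g x - g x * (1 - \1_A x) = g x * \1_A x); last by ring.
    apply: (@le_trans _ _ ((`|f i x * g x| + `|mu i * g x|) * \1_A x)).
      apply: le_trans (ler_normD _ _) _; rewrite mulN1r normrN mulrDl.
      have e1 : `|\1_A x| = \1_A x :> R by rewrite ger0_norm.
      by rewrite !mulrA [`|f i x * g x * _|]normrM [`|mu i * g x * _|]normrM !e1.
    apply: ler_wpM2r => //; rewrite (ger0_norm (h_ge0 x)) /h (bigD1 i)//= lerDl.
    by apply: sumr_ge0 => j _; rewrite addr_ge0.
rewrite /cov; apply: (@le_trans _ _ (ip P b b)); first by rewrite lerBlDr lerDl -expr2 sqr_ge0.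
apply: le_RintegralT; [exact: L2_mul_integrable..|].
move=> x; rewrite -!expr2 -[leLHS]real_normK ?num_real// -[leRHS]real_normK ?num_real//.
rewrite lerXn2r ?nnegrE// /b normrM ler_piMr// indicE.
by case: (x \in A); rewrite ?subrr ?subr0 ?normr0 ?normr1.
Qed.

(** * Large deviations of the resampled empirical measure *)

Section log_probabilities.
Context {R : realType}.

Lemma le_lne_scaled (p : \bar R) (x M L delta : R) : 0 < x -> 0 < M -> (0 <= p)%E ->
  (p <= (M * expR (- (x * L)))%:E)%E -> ln M <= delta * x ->
  ((L - delta)%:E <= - ((x^-1)%:E * lne p))%E.
Proof.
move=> x0 M0 p0 pM lM.
have q0 : 0 < M * expR (- (x * L)) by rewrite mulr_gt0 ?expR_gt0.
have h : (lne p <= (ln M - x * L)%:E)%E.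
  have -> : ln M - x * L = ln (M * expR (- (x * L))).
    by rewrite lnM ?posrE ?expR_gt0// expRK.
  rewrite -lne_EFin// lee_lne// ?in_itv/= ?leey ?andbT// lee_fin; exact: ltW.
rewrite leeNr; apply: (@le_trans _ _ ((x^-1)%:E * (ln M - x * L)%:E)%E).
  by apply: lee_wpmul2l => //; rewrite lee_fin invr_ge0 ltW.
rewrite -EFinM -EFinN lee_fin mulrC ler_pdivrMr//; lra.
Qed.

Lemma ge_lne_scaled (p : \bar R) (x M L delta : R) : 0 < x -> 0 < M ->
  ((M * expR (- (x * L)))%:E <= p)%E -> - ln M <= delta * x ->
  ((- L - delta)%:E <= (x^-1)%:E * lne p)%E.
Proof.
move=> x0 M0 pM lM.
have q0 : 0 < M * expR (- (x * L)) by rewrite mulr_gt0 ?expR_gt0.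
have h : ((ln M - x * L)%:E <= lne p)%E.
  have -> : ln M - x * L = ln (M * expR (- (x * L))).
    by rewrite lnM ?posrE ?expR_gt0// expRK.
  rewrite -lne_EFin// lee_lne// ?in_itv/= ?leey ?andbT//; first by rewrite lee_fin ltW.
  by apply: le_trans pM; rewrite lee_fin ltW.
apply: (@le_trans _ _ ((x^-1)%:E * (ln M - x * L)%:E)%E).
  by rewrite -EFinM lee_fin mulrC ler_pdivlMr//; lra.
by apply: lee_wpmul2l => //; rewrite lee_fin invr_ge0 ltW.
Qed.

End log_probabilities.

Lemma lcomb_avg {R : realType} (T : Type) (Sigma : set (T -> R)) n (y : 'I_n -> T)
    (s : seq (R * {f | Sigma f})) :
  lcomb (fun f => avg (fun i => sval f (y i))) s = avg (fun i => fcomb sval s (y i)).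
Proof.
elim: s => [|p s IH].
  by rewrite /lcomb big_nil /avg big1 ?mulr0// => i _; rewrite /fcomb /lcomb big_nil.
rewrite (@eq_avg _ _ _ (fun i => p.1 * sval p.2 (y i) + fcomb sval s (y i))).
  by rewrite avgD avgZ -IH /lcomb big_cons.
by move=> i; rewrite /fcomb /lcomb big_cons.
Qed.

Lemma lcombB {R : realType} (I : Type) (u v : I -> R) (c : R) (s : seq (R * I)) :
  lcomb (fun i => c * (u i - v i)) s = c * (lcomb u s - lcomb v s).
Proof.
rewrite /lcomb -sumrB mulr_sumr; apply: eq_bigr => p _; ring.
Qed.

(** Of the two inverses, one pays for approximating the infimum of the rate and the other for the
    slack [delta] of the bounds. *)
Lemma le_of_forall_inv {R : realType} (x y : R) : (forall j : nat, x - j.+1%:R^-1 - j.+1%:R^-1 <= y) -> x <= y.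
Proof.
move=> h; apply/ler_addgt0Pl => e e0.
have e20 : 0 < e / 2 by rewrite divr_gt0.
have [j _ hj] : \forall j \near \oo, j.+1%:R^-1 <= e / 2 :> R.
  have /cvgrPdist_lt/(_ _ e20) := @cvg_harmonic R; apply: filterS => j.
  by rewrite sub0r normrN => /ltW; apply: le_trans; rewrite ler_norm.
have hj' : j.+1%:R^-1 <= e / 2 := hj j (leqnn j).
by move: (j.+1%:R^-1) hj' (h j) => q; lra.
Qed.

Section bootstrap.
Context d (T : measurableType d) (R : realType) (P : probability T R).
Hypothesis measurable_set1 : forall x : T, measurable [set x].
Context d1 (O : measurableType d1) (P0 : probability O R).
Variable X : nat -> {RV P0 >-> T}.
Hypothesis iidX : iid P0 (fun i => X i : O -> T) P.
Variable k : nat -> nat.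
Hypothesis k_gt0 : forall n, (0 < n)%N -> (0 < k n)%N.
Context d2 (U : measurableType d2) (Pstar : nat -> O -> probability U R).
Variable Xstar : nat -> nat -> {mfun U >-> T}.
Hypothesis iidXstar : forall n w, (0 < n)%N ->
  iid (Pstar n w) (fun j : 'I_(k n) => Xstar n j : U -> T) (Phat R X n w).
Variable a : nat -> R.
Hypothesis a_gt0 : forall n, (0 < n)%N -> 0 < a n.
Hypothesis a_0 : a n @[n --> \oo] --> (0 : R).
Hypothesis ka_oo : (k n)%:R * a n ^+ 2 @[n --> \oo] --> +oo.
Variable Sigma : set (T -> R).
Hypothesis SL2 : forall f, Sigma f -> L2 P f.
Hypothesis Smax : forall f, Sigma f -> max_small X a f.

Implicit Types (n : nat) (w : O) (Omega : set (Lambda0 Sigma)).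

Let mS (f : {f | Sigma f}) : measurable_fun setT (sval f).
Proof. by case: f => f /= /SL2[]. Qed.

Let emp n (u : U) : {measure set T -> \bar R} := empirical R (k n) (fun j => Xstar n j u).

Lemma Lambda_empirical n (x : nat -> T) : (0 < n)%N -> Lambda Sigma (empirical R n x).
Proof.
move=> n0; split; first exact: empiricalT.
move=> f /SL2[mf _]; rewrite (@ge0_integral_empirical _ _ _ _ _ (fun y => `|f y|)) ?ltry//.
exact: measurableT_comp.
Qed.

Lemma Lambda_integrable (Q : {measure set T -> \bar R}) (f : {f | Sigma f}) :
  Lambda Sigma Q -> Q.-integrable setT (EFin \o sval f).
Proof.
move=> [_ h]; apply/integrableP; split; first exact/measurable_EFinP/mS.
by case: f => f Sf; exact: h.
Qed.

Lemma cond_law_wprob n w (A : set {measure set T -> \bar R}) (B : ('I_(k n) -> T) -> Prop) :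
  (0 < n)%N -> measurable [set u | B (fun j => Xstar n j u)] ->
  (forall u, A (emp n u) <-> B (fun j => Xstar n j u)) ->
  cond_law Pstar Xstar k n w A = (wprob (fun=> n%:R^-1)
    (fun s : {ffun 'I_(k n) -> 'I_n} => `[< B (fun j => X (s j) w) >]))%:E.
Proof.
move=> n0 mB AB; rewrite /cond_law.
rewrite -(resample_law measurable_set1 n0 (iidXstar w n0) mB).
congr (Pstar n w _); apply/seteqP; split => u /=; apply AB.
Qed.

Lemma log_outer_le Omega (L delta : R) : 0 <= L -> 0 < delta ->
  (L%:E < rho2_inf P (closure Omega))%E ->
  as_liminf_ge P0 (fun n w => - log_outer X Pstar Xstar k a Omega n w)%E (L - delta)%:E.
Proof.
move=> L0 d0 Lrho; have [m [s [e [e0 cover]]]] := half_space_cover SL2 L0 Lrho.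
pose phi i := fcomb sval (s i); pose c i := Num.sqrt (2 * L * cov P (phi i) (phi i)) + e i.
have Lphi i : L2 P (phi i) by apply: L2_fcomb => -[f /= /SL2].
have mphi i : measurable_fun setT (phi i) by have [] := Lphi i.
(* The thresholds of [wprob_upper_rate] are chosen once for each half-space, before the data are
   looked at. *)
have [V [b Vb]] : exists V b : 'I_m -> R, forall i,
   [/\ cov P (phi i) (phi i) < V i, 0 < b i & forall (k n : nat) (u : 'I_n -> R) (a : R),
    (0 < n)%N -> 0 < a -> avg (fun i => u i ^+ 2) - avg u ^+ 2 <= V i ->
    (forall j, a * `|u j| <= b i) ->
    wprob (fun=> n%:R^-1) (fun s : {ffun 'I_k -> 'I_n} =>
      k%:R * (avg u + a * c i) <= \sum_j u (s j)) <= expR (- (k%:R * a ^+ 2 * L))].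
  have h i := wprob_upper_rate (cov_ge0 (Lphi i)) L0 (e0 i).
  exists (fun i => sval (cid (h i))), (fun i => sval (cid (svalP (cid (h i))))) => i.
  have [h1 h2 h3] := svalP (cid (svalP (cid (h i)))).
  by split => // k' n u a'; exact: h3.
pose av n w (u : T -> R) := avg (fun j : 'I_n => u (X j w)).
pose E n := \bigcap_(i in [set: 'I_m])
  ([set w | av n w (fun x => phi i x * phi i x) - av n w (phi i) * av n w (phi i) <= V i] `&`
   \bigcap_(j in [set: 'I_n]) [set w | a n * `|phi i (X j w)| <= b i]).
have mE n : measurable (E n).
  apply: fin_bigcap_measurable => // i _; apply: measurableI.
    apply: measurable_set_le; apply: measurable_funB.
      by apply: measurable_avg; exact: measurable_funM.
    by apply: measurable_funM; exact: measurable_avg.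
  apply: fin_bigcap_measurable => // j _; apply: measurable_set_le; apply: measurable_funM => //.
  by apply: measurableT_comp => //; exact: measurableT_comp.
have aeE : {ae P0, forall w, \forall n \near \oo, E n w}.
  have h1 i : {ae P0, forall w, \forall n \near \oo,
      av n w (fun x => phi i x * phi i x) - av n w (phi i) * av n w (phi i) <= V i}.
    have [Vi _ _] := Vb i; have g0 : 0 < V i - cov P (phi i) (phi i) by rewrite subr_gt0.
    apply: filterS (slln_cov iidX (Lphi i) (Lphi i) g0) => w; apply: filterS => n.
    by rewrite ler_norml => /andP[_]; rewrite /av; lra.
  have h2 i : {ae P0, forall w, \forall n \near \oo, forall j : 'I_n, a n * `|phi i (X j w)| <= b i}.
    have [_ bi _] := Vb i.
    by apply: (max_small_fcomb a_gt0) => // -[f Sf]; exact: Smax.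
  have : {ae P0, forall w, forall i : 'I_m, \forall n \near \oo,
      av n w (fun x => phi i x * phi i x) - av n w (phi i) * av n w (phi i) <= V i /\
      forall j : 'I_n, a n * `|phi i (X j w)| <= b i}.
    apply: filter_forall => i; move: (h1 i) (h2 i); apply: filterS2 => w.
    exact: filterS2.
  apply: filterS => w /filter_forall; apply: filterS => n h i _.
  have [g1 g2] := h i; split; [exact: g1|move=> j _; exact: g2].
(* [delta] absorbs the union bound over the half-spaces. Using [m.+1] instead of [m] keeps the
   factor positive when the cover is empty. *)
have [N _ hN] : \forall n \near \oo, 1 <= (k n)%:R * a n ^+ 2 /\
    ln m.+1%:R <= delta * ((k n)%:R * a n ^+ 2).
  have /cvgryPge h := ka_oo; have := h (Num.max 1 (ln m.+1%:R / delta)).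
  apply: filterS => n; rewrite ge_max => /andP[h1].
  by rewrite ler_pdivrMr// mulrC => h2.
apply: (as_liminf_ge_good (N0 := maxn 1 N) mE aeE) => n w; rewrite geq_max => /andP[n0 nN] En.
have [ka1 kal] := hN n nN; have a0 := a_gt0 n0.
rewrite /log_outer; apply: (@le_lne_scaled _ _ _ m.+1%:R) => //.
- exact: lt_le_trans ka1.
- by apply: le_ereal_inf_tmp => _ [A [FA _] <-]; rewrite /cond_law measure_ge0.
pose A := [set Q | Lambda Sigma Q /\ exists i,
    av n w (phi i) + a n * c i < lcomb (fun f => \int[Q]_x (sval f) x) (s i)].
have FA : sigma_Lambda Sigma A by exact: sigma_Lambda_exists_gt.
(* If [Q - Phat = a G] with [G] in Omega, a half-space containing [G] becomes a one-sided deviation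
   of the integrals against [Q]; the union of these events is measurable and bounds the outer
   probability. *)
have sA : shifted_event (Phat R X n w) (a n) Omega `<=` A.
  move=> Q [LQ [G OG QG]]; split => //; have [i hi] := cover G OG; exists i.
  have LP : Lambda Sigma (Phat R X n w) by exact: Lambda_empirical.
  have pairE f : pairing G f = (a n)^-1 * (\int[Q]_x (sval f) x - av n w (sval f)).
    have -> : av n w (sval f) = \int[Phat R X n w]_x (sval f) x.
      by rewrite /av Rintegral_empirical//; exact: mS.
    rewrite /pairing; have [|||||-> _] // :=
      @charge_integral_of_difference _ _ _ Q (Phat R X n w) (sval G) (a n) (sval f) a0.
    - by case: LQ => ->; rewrite ltry.
    - by case: LP => ->; rewrite ltry.
    - exact: Lambda_integrable.
    - exact: Lambda_integrable.
  move: hi; rewrite (_ : pairing G = fun f => (a n)^-1 *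
    (\int[Q]_x (sval f) x - av n w (sval f))); last exact/funext.
  rewrite lcombB lcomb_avg -/(phi i) -/(av n w (phi i)) -/(c i).
  by rewrite mulrC ltr_pdivlMr//; lra.
apply: (@le_trans _ _ (cond_law Pstar Xstar k n w A)).
  by apply: ereal_inf_lbound; exists A.
pose B (y : 'I_(k n) -> T) := exists i, av n w (phi i) + a n * c i < avg (fun j => phi i (y j)).
rewrite (@cond_law_wprob n w A B n0); last 2 first.
- rewrite (_ : [set u | _] = \bigcup_(i in [set: 'I_m])
    [set u | av n w (phi i) + a n * c i < avg (fun j : 'I_(k n) => phi i (Xstar n j u))]); last first.
    by apply/seteqP; split => [u [i h]|u [i _ h]]; exists i.
  apply: fin_bigcup_measurable => // i _.
  apply: measurable_set_gt; apply: measurable_funM => //.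
  by apply: measurable_sum => j; exact: measurableT_comp.
- move=> u; rewrite /A /B/=.
  have eE i : lcomb (fun f => \int[emp n u]_x (sval f) x) (s i) =
      avg (fun j : 'I_(k n) => phi i (Xstar n j u)).
    rewrite /phi -lcomb_avg; congr lcomb; apply/funext => f.
    by rewrite /emp Rintegral_empirical//; exact: mS.
  split => [[_ [i h]]|[i h]]; first by exists i; rewrite -eE.
  by split; [apply: Lambda_empirical; exact: k_gt0|exists i; rewrite eE].
rewrite lee_fin.
have q0 (j : 'I_n) : 0 <= n%:R^-1 :> R by rewrite invr_ge0.
apply: (@le_trans _ _ (wprob (fun=> n%:R^-1) (fun t : {ffun 'I_(k n) -> 'I_n} =>
   [exists i, (k n)%:R * (av n w (phi i) + a n * c i) <= \sum_j phi i (X (t j) w)]))).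
  apply: wprob_le => // t /asboolP[i h]; apply/existsP; exists i.
  have kn0 : 0 < (k n)%:R :> R by rewrite ltr0n k_gt0.
  by move: h; rewrite /avg ltr_pdivlMl// => /ltW.
apply: (@le_trans _ _ (\sum_(i < m) expR (- ((k n)%:R * a n ^+ 2 * L)))).
  apply: (@wprob_exists _ _ _ _ m (fun i (t : {ffun 'I_(k n) -> 'I_n}) =>
     (k n)%:R * (av n w (phi i) + a n * c i) <= \sum_j phi i (X (t j) w))) => // i.
  have [_ _ h] := Vb i; have [E1 E2] := En i I.
  apply: (h (k n) n (fun j => phi i (X j w)) (a n)) => //.
  by move=> j; exact: E2.
rewrite sumr_const card_ord -[_ *+ m]mulr_natl ler_wpM2r ?expR_ge0//.
by rewrite ler_nat.
Qed.

Lemma log_inner_ge Omega (G : Lambda0 Sigma) (r delta : R) : interior Omega G -> 0 < delta ->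
  rho2 P (sval G) = r%:E ->
  as_liminf_ge P0 (log_inner X Pstar Xstar k a Omega) (- r - delta)%:E.
Proof.
move=> oG d0 rG; have [m [f [e [e0 hN]]]] := interior_basis oG.
have [|g [Ig GE Ig2]] := @rho2_lty_density _ _ _ P (sval G); first by rewrite rG ltry.
have Lg : L2 P g by split => //; apply/measurable_EFinP; exact: measurable_int Ig.
have Lf i : L2 P (sval (f i)) by apply: SL2; case: (f i).
have rE : r = 2^-1 * ip P g g.
  have := rho2_density Ig GE; rewrite rG -EFin_Rintegral// -EFinM => -[->].
  by congr (_ * _); apply: eq_Rintegral => x _; rewrite expr2.
have g0 : \int[P]_x g x = 0.
  have [GT _] := svalP G; have := GE setT measurableT; rewrite GT -EFin_Rintegral//.
  by case.
have pairG i : pairing G (f i) = ip P (sval (f i)) g.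
  rewrite /pairing; have [|-> _ //] := charge_integral_density Ig GE (mS (f i)).
  exact: L2_mul_integrable.
(* One quarter of [e] is for replacing [g] by the bounded [b], another for the law of large numbers;
   together they are the [e / 2] allowed by the tilting lemma. *)
have e40 : 0 < e / 4 by rewrite divr_gt0.
have [b [M [M0 Lb bM hcov Vb]]] := bounded_density_approx Lf Lg g0 e40.
(* With this [V] the cost [V / 2 + delta / 4] is [r + delta / 2]; the remaining [delta / 2] absorbs
   the factor 1/2. *)
pose V := ip P g g + delta / 2; pose B := \sum_i ip P (sval (f i)) (sval (f i)) + 1.
have B0 : 0 <= B by rewrite addr_ge0// sumr_ge0// => i _; exact: ip_ge0.
have d40 : 0 < delta / 4 by rewrite divr_gt0.
have d20 : 0 < delta / 2 by rewrite divr_gt0.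
have [K0 [a0 [a00 tilt]]] := @wprob_tilt_lower R m M B V e (delta / 4) M0 B0 e0 d40.
pose v i := pairing G (f i).
pose av n w (u : T -> R) := avg (fun j : 'I_n => u (X j w)).
pose E n := [set w | av n w (fun x => b x * b x) - av n w b * av n w b <= V] `&`
  \bigcap_(i in [set: 'I_m])
  ([set w | `|av n w (fun x => sval (f i) x * b x) - av n w (sval (f i)) * av n w b - v i| <= e / 2] `&`
   [set w | av n w (fun x => sval (f i) x * sval (f i) x) <= B]).
have mb : measurable_fun setT b by case: Lb.
have mE n : measurable (E n).
  apply: measurableI; [|apply: fin_bigcap_measurable => // i _; apply: measurableI]; apply: measurable_set_le.
  - apply: measurable_funB; first by apply: measurable_avg; exact: measurable_funM.
    by apply: measurable_funM; exact: (measurable_avg X n mb).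
  - apply: measurableT_comp => //; apply: measurable_funB => //; apply: measurable_funB.
      by apply: measurable_avg; apply: measurable_funM => //; exact: mS.
    by apply: measurable_funM; [exact: (measurable_avg X n (mS (f i)))|exact: (measurable_avg X n mb)].
  - by apply: measurable_avg; apply: measurable_funM; exact: mS.
have aeE : {ae P0, forall w, \forall n \near \oo, E n w}.
  have h1 : {ae P0, forall w, \forall n \near \oo,
      av n w (fun x => b x * b x) - av n w b * av n w b <= V}.
    apply: filterS (slln_cov iidX Lb Lb d20) => w; apply: filterS => n.
    by rewrite ler_norml /V => /andP[_]; rewrite /av; lra.
  have h2 i : {ae P0, forall w, \forall n \near \oo,
      `|av n w (fun x => sval (f i) x * b x) - av n w (sval (f i)) * av n w b - v i| <= e / 2}.
    apply: filterS (slln_cov iidX (Lf i) Lb e40) => w; apply: filterS => n.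
    have := hcov i; rewrite -pairG -/(v i) !ler_norml => /andP[? ?] /andP[? ?].
    by apply/andP; split; rewrite /av; lra.
  have h3 i : {ae P0, forall w, \forall n \near \oo,
      av n w (fun x => sval (f i) x * sval (f i) x) <= B}.
    apply: filterS (slln iidX (L2_mul_integrable (Lf i) (Lf i)) ltr01) => w; apply: filterS => n.
    rewrite ler_norml => /andP[_ h].
    have : ip P (sval (f i)) (sval (f i)) <= \sum_i ip P (sval (f i)) (sval (f i)).
      by rewrite (bigD1 i)//= lerDl sumr_ge0// => j _; exact: ip_ge0.
    by move: h; rewrite /B /av /ip; lra.
  have h23 : {ae P0, forall w, forall i : 'I_m, \forall n \near \oo,
      `|av n w (fun x => sval (f i) x * b x) - av n w (sval (f i)) * av n w b - v i| <= e / 2 /\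
      av n w (fun x => sval (f i) x * sval (f i) x) <= B}.
    by apply: filter_forall => i; move: (h2 i) (h3 i); apply: filterS2 => w; exact: filterS2.
  move: h1 h23; apply: filterS2 => w h1 /filter_forall; move: h1; apply: filterS2 => n q1 q2.
  by split => // i _; have [] := q2 i.
have [N _ {}hN'] : \forall n \near \oo, [/\ 1 <= (k n)%:R * a n ^+ 2, K0 <= (k n)%:R * a n ^+ 2,
    - ln 2^-1 <= delta / 2 * ((k n)%:R * a n ^+ 2) & a n <= a0].
  have h1 : \forall n \near \oo, a n <= a0.
    have /cvgrPdist_lt/(_ _ a00) := a_0; apply: filterS => n; rewrite sub0r normrN => h.
    by rewrite ltW// (le_lt_trans (ler_norm _)).
  have /cvgryPge h := ka_oo.
  move: h1 (h (Num.max 1 (Num.max K0 (- ln 2^-1 / (delta / 2))))).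
  apply: filterS2 => n h1; rewrite !ge_max => /and3P[h2 h3].
  by rewrite ler_pdivrMr// mulrC => h4.
apply: (as_liminf_ge_good (N0 := maxn 1 N) mE aeE) => n w; rewrite geq_max => /andP[n0 nN] En.
have [ka1 kaK kal aa0] := hN' n nN; have an0 := a_gt0 n0.
have kn0 : 0 < (k n)%:R :> R by rewrite ltr0n k_gt0.
rewrite (_ : - r - delta = - (r + delta / 2) - delta / 2); last by lra.
rewrite /log_inner; apply: (@ge_lne_scaled _ _ _ 2^-1) => //; first exact: lt_le_trans ka1.
pose W := [set Q | Lambda Sigma Q /\ forall i,
    `|\int[Q]_x (sval (f i)) x - (av n w (sval (f i)) + a n * v i)| < a n * e].
have FW : sigma_Lambda Sigma W by exact: sigma_Lambda_forall_close.
have LP : Lambda Sigma (Phat R X n w) by exact: Lambda_empirical.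
have PhatE i : \int[Phat R X n w]_x (sval (f i)) x = av n w (sval (f i)).
  by rewrite /av Rintegral_empirical//; exact: mS.
(* For [Q] in [W], the charge [(Q - Phat) / a] lies in [Lambda0 Sigma] and in the chosen
   neighbourhood of [G], hence in Omega. *)
have WO : W `<=` shifted_event (Phat R X n w) (a n) Omega.
  move=> Q [LQ QW]; split => //.
  have QT : (Q setT < +oo)%E by case: LQ => ->; rewrite ltry.
  have PT : (Phat R X n w setT < +oo)%E by case: LP => ->; rewrite ltry.
  have [H HE] := exists_charge_sub (a n)^-1 QT PT.
  have QG B' : measurable B' -> (Q B' - Phat R X n w B' = (a n)%:E * H B')%E.
    by move=> mB'; rewrite HE// muleA -EFinM divff ?mul1e// gt_eqF.
  have HL f' : Sigma f' -> charge_integral H f' = (a n)^-1 * (\int[Q]_x f' x - \int[Phat R X n w]_x f' x) /\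
      (\int[Defs.total_variation H]_x (`|f' x|%:E) < +oo)%E.
    move=> Sf; apply: charge_integral_of_difference an0 QT PT QG _ _.
      exact: (Lambda_integrable (exist _ f' Sf)).
    exact: (Lambda_integrable (exist _ f' Sf)).
  have H0 : H setT = 0%E.
    by rewrite HE//; case: LQ => -> _; case: LP => -> _; rewrite subee// mule0.
  exists (exist _ H (conj H0 (fun f' Sf => (HL f' Sf).2))) => //.
  apply: hN => i; rewrite /pairing/=; have [-> _] := HL _ (svalP (f i)).
  rewrite PhatE -/(pairing G (f i)) -/(v i).
  have -> : (a n)^-1 * (\int[Q]_x sval (f i) x - av n w (sval (f i))) - v i =
     (a n)^-1 * (\int[Q]_x sval (f i) x - (av n w (sval (f i)) + a n * v i)).
    by field; rewrite gt_eqF.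
  by rewrite normrM gtr0_norm ?invr_gt0// ltr_pdivrMl//; exact: QW.
pose C (y : 'I_(k n) -> T) := forall i,
  `|avg (fun j => sval (f i) (y j)) - (av n w (sval (f i)) + a n * v i)| < a n * e.
have mC : measurable [set u | C (fun j => Xstar n j u)].
  rewrite (_ : [set u | _] = \bigcap_(i in [set: 'I_m])
    [set u | `|avg (fun j : 'I_(k n) => sval (f i) (Xstar n j u)) -
      (av n w (sval (f i)) + a n * v i)| < a n * e]); last first.
    by apply/seteqP; split => [u h i _|u h i]; exact: h.
  apply: fin_bigcap_measurable => // i _.
  apply: measurable_set_lt; apply: measurableT_comp => //; apply: measurable_funB => //.
  apply: measurable_funM => //; apply: measurable_sum => j.
  exact: (measurableT_comp (mS (f i))).
have WC u : W (emp n u) <-> C (fun j => Xstar n j u).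
  have eE i : \int[emp n u]_x (sval (f i)) x = avg (fun j : 'I_(k n) => sval (f i) (Xstar n j u)).
    by rewrite /emp Rintegral_empirical//; exact: mS.
  split => [[_ h] i|h]; first by rewrite -eE.
  by split; [apply: Lambda_empirical; exact: k_gt0|move=> i; rewrite eE; exact: h].
have WE := @cond_law_wprob n w W C n0 mC WC.
(* The complement of [W] in [Lambda Sigma] is a measurable set covering the complement of the
   shifted event, so the inner probability is at least the law of [W]. *)
apply: (@le_trans _ _ (cond_law Pstar Xstar k n w W)); last first.
  have dW : cond_law Pstar Xstar k n w (Lambda Sigma `\` W) = (1 - cond_law Pstar Xstar k n w W)%E.
    rewrite /cond_law; have mW : measurable [set u | W (emp n u)].
      by rewrite (_ : [set u | _] = [set u | C (fun j => Xstar n j u)])//; apply/seteqP; split => u /WC.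
    rewrite -(probability_setC _ mW); congr (Pstar n w _).
    apply/seteqP; split => u /=; first by case.
    by move=> nW; split => //; apply: Lambda_empirical; exact: k_gt0.
  have h : (outer_prob (sigma_Lambda Sigma) (cond_law Pstar Xstar k n w)
      (Lambda Sigma `\` shifted_event (Phat R X n w) (a n) Omega) <=
      1 - cond_law Pstar Xstar k n w W)%E.
    rewrite -dW; apply: ereal_inf_lbound; exists (Lambda Sigma `\` W) => //; split.
      have [_ + _] : sigma_algebra (Lambda Sigma) (sigma_Lambda Sigma) by exact: smallest_sigma_algebra.
      exact.
    by move=> Q [LQ nQ]; split => // /WO.
  rewrite /inner_prob; apply: le_trans (leeB (le_refl 1%E) h).
  by rewrite WE -!EFinB lee_fin; lra.
rewrite WE lee_fin.
have [E0 Ei] := En.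
have := tilt n (k n) (fun i j => sval (f i) (X j w)) (fun j => b (X j w)) v (a n) n0 an0 aa0 kaK.
move=> /(_ (fun j => bM _) (fun i => (Ei i I).1) (fun i => (Ei i I).2) E0).
have -> : V / 2 + delta / 4 = r + delta / 2 by rewrite rE /V; lra.
move=> h; apply: le_trans h _; apply: wprob_le.
  by move=> _; rewrite invr_ge0.
move=> s /forallP h; apply/asboolP => i; have := h i; move: (v i) => vi.
rewrite -[in X in _ -> X](@ltr_pM2l _ (k n)%:R)// [in X in _ -> X]mulrA.
set z := avg _ - _; have -> : (k n)%:R * `|z| = `|(k n)%:R * z| by rewrite normrM (gtr0_norm kn0).
have avE : (k n)%:R * avg (fun j => sval (f i) (X (s j) w)) = \sum_j sval (f i) (X (s j) w).
  by rewrite /avg mulVKf// gt_eqF.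
by rewrite /z mulrBr avE.
Qed.

Lemma rho2_ge0 (G : {charge set T -> \bar R}) : (0 <= rho2 P G)%E.
Proof.
rewrite /rho2; case: ifPn => // _; apply: mule_ge0; first by rewrite lee_fin.
by apply: integral_ge0 => x _; exact: sqre_ge0.
Qed.

Lemma rho2_inf_ge0 Omega : (0 <= rho2_inf P Omega)%E.
Proof. by apply: le_ereal_inf_tmp => _ [G _ <-]; exact: rho2_ge0. Qed.

Lemma liminf_log_inner Omega :
  as_liminf_ge P0 (log_inner X Pstar Xstar k a Omega) (- rho2_inf P (interior Omega))%E.
Proof.
have := rho2_inf_ge0 (interior Omega).
case rE : (rho2_inf P (interior Omega)) => [r| |] // r0; last exact: as_liminf_ge_Noo.
pose dl (j : nat) : R := j.+1%:R^-1.
have dl0 j : 0 < dl j by rewrite invr_gt0.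
have h j : exists G s, [/\ interior Omega G, rho2 P (sval G) = s%:E & s < r + dl j].
  have : (rho2_inf P (interior Omega) < (r + dl j)%:E)%E by rewrite rE lte_fin ltrDl.
  move=> /ereal_inf_lt[_ [G oG <-]]; have := rho2_ge0 (sval G).
  case sE : (rho2 P (sval G)) => [s| |] // _; rewrite lte_fin => sr.
  by exists G, s.
apply: (@as_liminf_ge_sup _ _ _ P0 _ (fun j => (- r - dl j - dl j)%:E)) => [j|x hx].
  have [G [s [oG sE sr]]] := h j.
  have [D [mD DZ D1]] := log_inner_ge oG (dl0 j) sE.
  exists D; split => //; apply/eqP; rewrite eq_le probability_le1//=; last first.
    exact: measurable_limn_einf_ge.
  rewrite -D1; apply: le_measure; rewrite ?inE; [exact: measurable_limn_einf_ge..|].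
  move=> w /=; apply: le_trans; rewrite lee_fin; lra.
case: x hx => [x| |] hx; [|by rewrite leey|by have := hx 0%N].
by rewrite -EFinN lee_fin; apply: le_of_forall_inv => j; have := hx j; rewrite lee_fin.
Qed.

Lemma log_outer_ge0 Omega n w : (0 < n)%N ->
  (0 <= - log_outer X Pstar Xstar k a Omega n w)%E.
Proof.
move=> n0; rewrite /log_outer leeNr oppe0; set p := outer_prob _ _ _.
have p1 : (p <= 1)%E.
  apply: (@le_trans _ _ (cond_law Pstar Xstar k n w (Lambda Sigma))).
    apply: ereal_inf_lbound; exists (Lambda Sigma) => //; split; last by move=> Q [].
    have [F0 FC _] : sigma_algebra (Lambda Sigma) (sigma_Lambda Sigma) by exact: smallest_sigma_algebra.
    by rewrite -(setD0 (Lambda Sigma)); exact: FC.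
  rewrite /cond_law; set A := [set u | _].
  have -> : A = setT by apply/seteqP; split => // u _; apply: Lambda_empirical; exact: k_gt0.
  by rewrite probability_setT.
have p0 : (0 <= p)%E.
  by apply: le_ereal_inf_tmp => _ [A [FA _] <-]; rewrite /cond_law measure_ge0.
have lp : (lne p <= 0)%E.
  have -> : 0%E = lne (1 : R)%:E by rewrite lne_EFin// ln1.
  by rewrite lee_lne// in_itv/= ?leey ?andbT// lee_fin.
apply: mule_ge0_le0 => //; rewrite lee_fin invr_ge0 mulr_ge0// sqr_ge0//.
Qed.

Lemma limsup_log_outer Omega :
  as_limsup_le P0 (log_outer X Pstar Xstar k a Omega) (- rho2_inf P (closure Omega))%E.
Proof.
have := rho2_inf_ge0 (closure Omega); rewrite /as_limsup_le.
case rE : (rho2_inf P (closure Omega)) => [r| |] //; last first.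
  move=> _; rewrite eqxx => s s0.
  rewrite (_ : s = s + 1 - 1); last by rewrite addrK.
  by apply: log_outer_le => //; [rewrite addr_ge0// ltW|rewrite rE ltry].
rewrite lee_fin => r0 /=; rewrite opprK.
pose dl (j : nat) : R := j.+1%:R^-1.
have dl0 j : 0 < dl j by rewrite invr_gt0.
apply: (@as_liminf_ge_sup _ _ _ P0 _ (fun j => (r - dl j - dl j)%:E)) => [j|x hx]; last first.
  case: x hx => [x| |] hx; [|by rewrite leey|by have := hx 0%N].
  by rewrite lee_fin; apply: le_of_forall_inv => j; have := hx j; rewrite lee_fin.
(* [log_outer_le] takes a nonnegative level. If [r - dl j] is negative, the bound follows from
   probabilities being at most 1. *)
have [rj|rj] := leP 0 (r - dl j).
  by apply: log_outer_le => //; rewrite rE lte_fin ltrBlDr ltrDl.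
apply: (@as_liminf_ge_good _ _ _ _ _ (fun=> setT) 1%N) => //.
  by apply: aeW => w; exact: nearW.
move=> n w n0 _; apply: le_trans (log_outer_ge0 Omega w n0).
by rewrite lee_fin; have := dl0 j; lra.
Qed.

End bootstrap.

(** * The classes Theta: square integrability and smallness of maxima *)

Section function_classes.
Context d (T : measurableType d) (R : realType) (P : probability T R).
Implicit Types f : T -> R.

Lemma Theta_integrable t f : Theta P t f -> P.-integrable setT (EFin \o (fun x => `|f x| `^ t)).
Proof.
move=> [mf If]; apply/integrableP; split.
  apply/measurable_EFinP; apply: (@measurableT_comp _ _ _ _ _ _ (@powR R ^~ t)) => //.
  exact: measurableT_comp.
by under eq_integral do rewrite /= ger0_norm ?powR_ge0//.
Qed.

Lemma Theta_L2 t f : 2 <= t -> Theta P t f -> L2 P f.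
Proof.
move=> t2 Tf; have [mf _] := Tf; split => //.
apply: (@integrable_le_norm _ _ _ P _ (fun x => 1 + `|f x| `^ t)).
- exact: measurable_funX.
- move=> x; rewrite normrX; have [f1|f1] := leP `|f x| 1.
    by apply: (@le_trans _ _ 1); [rewrite exprn_ile1|rewrite lerDl powR_ge0].
  rewrite -powR_mulrn//; apply: (@le_trans _ _ (`|f x| `^ t)); last by rewrite lerDr.
  by apply: ler_powR => //; exact: ltW.
- have := integrableD measurableT (L2_integrable (L2_cst P 1)) (Theta_integrable Tf).
  exact: eq_integrable.
Qed.

Lemma sum_indicator_le (y : R) n : 0 <= y -> \sum_(i < n) (i.+1%:R < y)%R%:R <= y.
Proof.
move=> y0; elim: n => [|n IH]; first by rewrite big_ord0.
rewrite big_ord_recr/=; have [ny|_] := ltP n.+1%:R y; last by rewrite addr0.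
apply: le_trans (ltW ny); rewrite -natr1 lerD2r.
apply: (@le_trans _ _ (\sum_(i < n) 1)); last by rewrite sumr_const card_ord.
by apply: ler_sum => i _; case: (_ < _).
Qed.

Lemma sum_tail_le_integral f : (forall x, 0 <= f x) -> P.-integrable setT (EFin \o f) ->
  (\sum_(n <oo) P [set x | (n.+1%:R < f x)%R] <= \int[P]_x (f x)%:E)%E.
Proof.
move=> f0 If; have mf : measurable_fun setT f by apply/measurable_EFinP; exact: measurable_int If.
have mA n : measurable [set x | n.+1%:R < f x] by exact: measurable_set_gt.
apply: nneseries_le_bound => // n; rewrite big_mkord.
rewrite (eq_bigr (fun i : 'I_n => \int[P]_x (\1_[set x | i.+1%:R < f x] x)%:E)%E); last first.
  by move=> i _; rewrite integral_indic// setIT.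
rewrite -ge0_integral_sum//; last by move=> i; apply/measurable_EFinP; exact: measurable_indic.
apply: ge0_le_integral => //.
- by move=> x _; apply: sume_ge0.
- by apply: emeasurable_sum => i; apply/measurable_EFinP; exact: measurable_indic.
- exact/measurable_EFinP.
move=> x _; rewrite sumEFin lee_fin; apply: le_trans (sum_indicator_le n (f0 x)).
apply: ler_sum => i _; rewrite indicE.
by have [/set_mem/= ->|_] := boolP (x \in _).
Qed.

End function_classes.

Lemma hausdorff_measurable_set1 (S : ptopologicalType) : hausdorff_space S ->
  forall x : borel S, measurable [set x].
Proof.
move=> hS x; rewrite -[X in measurable X]setCK; apply: measurableC.
apply: sub_sigma_algebra; apply: closed_openC.
exact: (accessible_closed_set1 (hausdorff_accessible hS)).
Qed.

Section data_maxima.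
Context d (T : measurableType d) (R : realType) (P : probability T R).
Context d' (O : measurableType d') (P0 : probability O R).
Variable X : nat -> {RV P0 >-> T}.
Hypothesis iidX : iid P0 (fun i => X i : O -> T) P.
Variable a : nat -> R.
Hypothesis a_gt0 : forall n, (0 < n)%N -> 0 < a n.
Hypothesis a_decr : forall n, (0 < n)%N -> a n.+1 <= a n.
Hypothesis a_0 : a n @[n --> \oo] --> (0 : R).

(** The defining inequality of the class at [s = a_n / c] is exactly a bound on the probability that
    [a_n |f| > c], summable by assumption. *)
Lemma Theta_h_max_small (t : R) (h : R -> R) (f : T -> R) :
  (forall s, 0 <= s -> 0 <= h s) ->
  (forall c, 0 < c -> (\sum_(1 <= n <oo) (h (c * a n))%:E < +oo)%E) ->
  Theta_h P t h f -> max_small X a f.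
Proof.
move=> h0 hs [[mf _] fh]; apply: (max_small_tail iidX) => // c c0.
have ci0 : 0 < c^-1 by rewrite invr_gt0.
(* The absolute value makes every term nonnegative, including [n = 0], where the sign of [a] is not
   prescribed. *)
pose u n := (h (c^-1 * `|a n|))%:E.
have u0 n : (0 <= u n)%E by rewrite lee_fin h0// mulr_ge0// ltW.
apply: le_lt_trans (hs _ ci0).
have -> : (\sum_(1 <= n <oo) (h (c^-1 * a n))%:E = \sum_(1 <= n <oo) u n)%E.
  congr (limn _); apply/funext => m; apply: eq_big_nat => i /andP[i1 _].
  by rewrite /u gtr0_norm// a_gt0.
rewrite -(nneseries_addn 1 u0); apply: lee_nneseries => // n _.
rewrite /u addn1; have an := a_gt0 (ltn0Sn n); rewrite gtr0_norm//.
have s0 : 0 < c^-1 * a n.+1 by rewrite mulr_gt0.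
apply: le_trans (ltW (fh _ s0)); rewrite le_eqVlt; apply/orP; left; apply/eqP; congr (P _).
by apply/seteqP; split => x /=; rewrite invfM invrK ltr_pdivrMr// mulrC.
Qed.

(** Once [a_n <= n^(-1/t)], the event [a_n |f| > c] implies [n < c^(-t) |f|^t], and the sum of these
    tail probabilities is at most an expectation. *)
Lemma Theta_max_small (t : R) (f : T -> R) : 2 < t ->
  a =o_\oo (fun n => n%:R `^ (- t^-1)) -> Theta P t f -> max_small X a f.
Proof.
move=> t2 ao Tf; have [mf _] := Tf; apply: (max_small_tail iidX) => // c c0.
have t0 : 0 < t by lra.
have [N _ hN] : \forall n \near \oo, a n <= n%:R `^ (- t^-1).
  have /eqoP h := ao; have := h 1 ltr01; apply: filterS => n.
  rewrite mul1r [X in _ <= X]ger0_norm ?powR_ge0//; apply: le_trans; exact: ler_norm.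
(* The constant [N] accounts for the indices where [a n <= n^(-1/t)] may fail: for [n < N] the event
   [n.+1 < Y] holds on the tail set because its first term is positive there. *)
pose Y x := c `^ (- t) * `|f x| `^ t + N%:R.
have Y0 x : 0 <= Y x by rewrite addr_ge0// mulr_ge0// powR_ge0.
have IY : P.-integrable setT (EFin \o Y).
  have := integrableD measurableT (integrable_scale (c `^ (- t)) (Theta_integrable Tf))
    (L2_integrable (L2_cst P N%:R)).
  exact: eq_integrable.
apply: (@le_lt_trans _ _ (\int[P]_x (Y x)%:E)%E); last first.
  by rewrite -EFin_Rintegral ?ltry.
apply: le_trans (sum_tail_le_integral Y0 IY); apply: lee_nneseries => // n _.
apply: le_measure; rewrite ?inE.
- by apply: measurable_set_gt; apply: measurable_funM => //; exact: measurableT_comp.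
- by apply: measurable_set_gt; apply/measurable_EFinP; exact: measurable_int IY.
move=> x /= cx; have an := a_gt0 (ltn0Sn n).
have f0 : 0 < `|f x| by rewrite -(pmulr_rgt0 _ an) (lt_trans c0).
have [nN|Nn] := ltnP n N.
  apply: (@le_lt_trans _ _ N%:R); first by rewrite ler_nat.
  by rewrite ltrDr mulr_gt0// powR_gt0.
apply: (@lt_le_trans _ _ (c `^ (- t) * `|f x| `^ t)); last by rewrite lerDl.
have : c < n.+1%:R `^ (- t^-1) * `|f x|.
  by apply: lt_le_trans cx _; apply: ler_wpM2r => //; apply: hN => /=; exact: leqW.
move=> /(gt0_ltr_powR t0); rewrite !nnegrE => /(_ (ltW c0)).
rewrite mulr_ge0 ?powR_ge0// => /(_ isT).
have e : (n.+1%:R `^ (- t^-1)) `^ t = n.+1%:R^-1 :> R.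
  by rewrite -powRrM mulNr mulVf ?gt_eqF// powRN powRr1.
rewrite powRM ?powR_ge0// e ltr_pdivlMl// => h.
by rewrite powRN ltr_pdivlMl ?powR_gt0// mulrC.
Qed.

End data_maxima.

Theorem theorem2p1 (R : realType) (S : ptopologicalType)
    (hausS : hausdorff_space S) (P : probability (borel S) R)
    (d1 : measure_display) (O : measurableType d1) (P0 : probability O R)
    (X : nat -> {RV P0 >-> borel S})
    (iidX : iid P0 (fun i => X i : O -> borel S) P)
    (k : nat -> nat) (c0 : R)
    (k_gt0 : forall n, (0 < n)%N -> (0 < k n)%N)
    (k_oo : k n @[n --> \oo] --> \oo)
    (k_c0 : forall n, (0 < n)%N -> (k n)%:R / n%:R < c0)
    (d2 : measure_display) (U : measurableType d2)
    (Pstar : nat -> O -> probability U R)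
    (Xstar : nat -> nat -> {mfun U >-> borel S})
    (iidXstar : forall n w, (0 < n)%N ->
      iid (Pstar n w) (fun j : 'I_(k n) => Xstar n j : U -> borel S)
        (Phat R X n w))
    (a : nat -> R)
    (a_gt0 : forall n, (0 < n)%N -> 0 < a n)
    (a_decr : forall n, (0 < n)%N -> a n.+1 <= a n)
    (a_0 : a n @[n --> \oo] --> (0 : R))
    (a_ratio : a n.+1 / a n @[n --> \oo] --> (1 : R))
    (ka_oo : (k n)%:R * a n ^+ 2 @[n --> \oo] --> +oo) :
  (forall h : R -> R,
    (forall s, 0 <= s -> 0 <= h s) ->
    (forall s s', 0 <= s -> s <= s' -> h s <= h s') ->
    (forall c, 0 < c -> (\sum_(1 <= n <oo) (h (c * a n))%:E < +oo)%E) ->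
    forall Omega0 : set (Lambda0 (Theta_h P 2 h)),
      as_liminf_ge P0 (log_inner X Pstar Xstar k a Omega0)
        (- rho2_inf P (interior Omega0))%E /\
      as_limsup_le P0 (log_outer X Pstar Xstar k a Omega0)
        (- rho2_inf P (closure Omega0))%E) /\
  (forall t : R, 2 < t ->
    a =o_\oo (fun n => n%:R `^ (- t^-1)) ->
    forall Omega0 : set (Lambda0 (Theta P t)),
      as_liminf_ge P0 (log_inner X Pstar Xstar k a Omega0)
        (- rho2_inf P (interior Omega0))%E /\
      as_limsup_le P0 (log_outer X Pstar Xstar k a Omega0)
        (- rho2_inf P (closure Omega0))%E).
Proof.
have mS1 := hausdorff_measurable_set1 hausS.
have main Sigma : (forall f, Sigma f -> L2 P f) -> (forall f, Sigma f -> max_small X a f) ->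
    forall Omega0 : set (Lambda0 Sigma),
      as_liminf_ge P0 (log_inner X Pstar Xstar k a Omega0) (- rho2_inf P (interior Omega0))%E /\
      as_limsup_le P0 (log_outer X Pstar Xstar k a Omega0) (- rho2_inf P (closure Omega0))%E.
  move=> SL2 Smax Omega0; split.
    exact: (liminf_log_inner mS1 iidX k_gt0 iidXstar a_gt0 a_0 ka_oo SL2).
  exact: (limsup_log_outer mS1 iidX k_gt0 iidXstar a_gt0 ka_oo SL2 Smax).
split=> [h h0 _ hs|t t2 ao]; apply: main => f Sf.
- by case: Sf => Tf _; exact: Theta_L2 Tf.
- exact: (Theta_h_max_small iidX a_gt0 a_decr a_0 h0 hs Sf).
- by apply: Theta_L2 Sf; exact: ltW.
- exact: (Theta_max_small iidX a_gt0 a_decr a_0 t2 ao Sf).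
Qed.
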